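(* Let $h_k\to0^+$ and let $u_k\in H^2(\Omega)^d\cap V$, $f_k\in H$, $q_k$ satisfy $-h_k^2\Delta u_k-u_k+h_k\nabla q_k=f_k$, $h_k\,\mathrm{div}\,u_k=0$ in $\Omega$, with $\|u_k\|_{L^2(\Omega)}=O(1)$, $\|f_k\|_{L^2(\Omega)}=o(h_k)$, $\|h_k\nabla q_k\|_{L^2(\Omega)}=O(1)$, $\int_\Omega q_k\,dx=0$, and $u_k\rightharpoonup0$ weakly in $L^2(\Omega)$. Let $a_i\in C_c^\infty(\Omega\times\mathbb{R}^d)$ be equal to $0$ near $\mathrm{Car}(P)$. Then, after extraction of a subsequence, $$\lim_{k\to\infty}(\mathrm{Op}_{h_k}(a_i)u_k|u_k)_{L^2}=0.$$
   Context: $\Omega\subset\mathbb{R}^d$ is a smooth bounded domain with outward normal $\nu$; $V=\{u\in H^1_0(\Omega)^d:\mathrm{div}\,u=0\}$, $H=\{u\in L^2(\Omega)^d:\mathrm{div}\,u=0,\ u\cdot\nu|_{\partial\Omega}=0\}$. $\mathrm{Car}(P)=\{(x,\xi):x\in\overline\Omega,\ |\xi|^2=1\}$ is the characteristic variety of $-h^2\Delta-1$. The symbol $a_i$ is scalar and $\mathrm{Op}_h(a_i)f(x)=(2\pi h)^{-d}\iint e^{i(x-z)\cdot\xi/h}a_i(x,\xi)\varphi_i(z)f(z)\,dz\,d\xi$, with $\varphi_i\in C_c^\infty(\Omega)$ equal to $1$ near the $x$-projection of $\mathrm{supp}(a_i)$. *)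

(* Defs.v *)
From HB Require Import structures.
From mathcomp Require Import all_boot all_order all_algebra.
From mathcomp Require Import complex.
From mathcomp Require Import all_classical all_reals all_analysis.

Set Implicit Arguments.
Unset Strict Implicit.
Unset Printing Implicit Defensive.

Import Order.TTheory GRing.Theory Num.Theory.
Import numFieldNormedType.Exports.

Local Open Scope classical_set_scope.
Local Open Scope ring_scope.
Local Open Scope complex_scope.

Section measurable_matrix.
Context {d : measure_display} {T : measurableType d} (m n : nat).

Definition mx_cylinders : set (set 'M[T]_(m, n)) :=
  [set B | exists i j (A : set T),
    measurable A /\ B = [set M : 'M[T]_(m, n) | A (M i j)]].

HB.instance Definition _ := @isMeasurable.Build (measure_tuple_display d)
  'M[T]_(m, n) <<s mx_cylinders >>
  (@sigma_algebra0 _ _ _) (@sigma_algebraC _ _)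
  (@sigma_algebra_bigcup _ _ _).

End measurable_matrix.

Lemma measurable_fun_mx d d' (T : measurableType d) (T' : measurableType d')
    m n (f : T' -> 'M[T]_(m, n)) :
  (forall i j, measurable_fun setT (fun x => f x i j)) -> measurable_fun setT f.
Proof.
move=> mf; apply: (@measurability _ _ _ _ _ _ (@mx_cylinders d T m n)) => //.
move=> _ [_ [i [j [A [mA ->]]]] <-].
exact: (mf i j).
Qed.

Lemma measurable_mx_coord d (T : measurableType d) m n i j :
  measurable_fun setT (fun M : 'M[T]_(m, n) => M i j).
Proof.
move=> _ A mA; rewrite setTI; apply: sub_sigma_algebra.
by exists i, j, A.
Qed.

Section lebesgue_rV.
Context {R : realType}.

Definition rV_cons n (p : measurableTypeR R * 'rV[R]_n) : 'rV[R]_n.+1 :=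
  row_mx (const_mx p.1 : 'rV_1) p.2.

Definition rV_uncons n (x : 'rV[R]_n.+1) : measurableTypeR R * 'rV[R]_n :=
  (x ord0 ord0, \row_j x ord0 (rshift 1 j)).

Lemma rV_consK n : cancel (@rV_cons n) (@rV_uncons n).
Proof.
move=> [x y]; rewrite /rV_uncons /rV_cons /=; congr pair.
  by rewrite !mxE; case: splitP => // j _; rewrite mxE.
by apply/rowP => j; rewrite mxE; exact: (@row_mxEr _ 1 1 n _ y ord0 j).
Qed.

Lemma measurable_rV_cons n : measurable_fun setT (@rV_cons n).
Proof.
apply: measurable_fun_mx => i j; rewrite ord1 /rV_cons.
case: (@splitP 1 n j) => k jk.
  rewrite (_ : (fun x => _) = fst); first exact: measurable_fst.
  apply/funext => x; rewrite (_ : j = lshift n k); last exact: val_inj.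
  by apply: etrans (@row_mxEl _ 1 1 n _ x.2 ord0 k) _; rewrite mxE.
rewrite (_ : (fun x => _) = (fun M : 'rV[R]_n => M ord0 k) \o snd).
  by apply: measurableT_comp; [exact: measurable_mx_coord|exact: measurable_snd].
apply/funext => x; rewrite (_ : j = rshift 1 k); last exact: val_inj.
exact: (@row_mxEr _ 1 1 n _ x.2 ord0 k).
Qed.

Lemma measurable_rV_uncons n : measurable_fun setT (@rV_uncons n).
Proof.
apply: measurable_fun_pair; first exact: (@measurable_mx_coord _ R).
apply: measurable_fun_mx => i j.
under eq_fun do rewrite mxE.
exact: measurable_mx_coord.
Qed.

Section step.
Context n (m : {sigma_finite_measure set 'rV[R]_n -> \bar R}).

Definition lebesgue_rV_step : set 'rV[R]_n.+1 -> \bar R :=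
  pushforward (@lebesgue_measure R \x m)%E (@rV_cons n).

Let mcons A : measurable A -> measurable (@rV_cons n @^-1` A).
Proof. by move=> mA; rewrite -[X in measurable X]setTI; exact: measurable_rV_cons. Qed.

Let step0 : lebesgue_rV_step set0 = 0%E.
Proof. by rewrite /lebesgue_rV_step /pushforward preimage_set0 measure0. Qed.

Let step_ge0 A : (0 <= lebesgue_rV_step A)%E.
Proof. by rewrite /lebesgue_rV_step /pushforward. Qed.

Let step_sigma_additive : semi_sigma_additive lebesgue_rV_step.
Proof.
move=> F mF tF mUF; rewrite /lebesgue_rV_step /pushforward preimage_bigcup.
apply: measure_semi_sigma_additive.
- by move=> k; exact: mcons.
- apply/trivIsetP => /= i j _ _ ij; rewrite -preimage_setI.
  by move/trivIsetP : tF => /(_ _ _ _ _ ij) ->//; rewrite preimage_set0.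
- by rewrite -preimage_bigcup; exact: mcons.
Qed.

HB.instance Definition _ := isMeasure.Build _ _ _
  lebesgue_rV_step step0 step_ge0 step_sigma_additive.

Let step_sigma_finite : sigma_finite setT lebesgue_rV_step.
Proof.
have [F TF Foo] : sigma_finite setT (@lebesgue_measure R \x m)%E.
  have /sigma_finiteP[F [TF ndF Foo]] := sigma_finiteT (@lebesgue_measure R).
  have /sigma_finiteP[G [TG ndG Goo]] := sigma_finiteT m.
  exists (fun k => F k `*` G k).
    rewrite -setXTT TF TG predeqE => -[x y]; split.
      move=> [/= [k _ Fkx] [l _ Gly]]; exists (maxn k l) => //; split.
      - by move: x Fkx; exact/subsetPset/ndF/leq_maxl.
      - by move: y Gly; exact/subsetPset/ndG/leq_maxr.
    by move=> [k _ []/= ? ?]; split; exists k.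
  move=> k; have [? ?] := Foo k; have [? ?] := Goo k.
  split; first exact: measurableX.
  by rewrite product_measure1E// lte_mul_pinfty// ge0_fin_numE.
exists (fun k => @rV_uncons n @^-1` F k).
  by rewrite -preimage_bigcup -TF preimage_setT.
move=> k; have [mFk Fkoo] := Foo k; split.
  by rewrite -[X in measurable X]setTI; exact: measurable_rV_uncons.
rewrite /lebesgue_rV_step /pushforward -comp_preimage.
by rewrite (_ : _ \o _ = id) ?preimage_id//; apply/funext => x; exact: rV_consK.
Qed.

HB.instance Definition _ := Measure_isSigmaFinite.Build _ _ _
  lebesgue_rV_step step_sigma_finite.

End step.

Fixpoint lebesgue_rV n : {sigma_finite_measure set 'rV[R]_n -> \bar R} :=
  match n with
  | 0 => dirac (0 : 'rV[R]_0)
  | n'.+1 => lebesgue_rV_step (lebesgue_rV n')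
  end.

End lebesgue_rV.

Lemma lebesgue_rV_box (R : realType) n (A : 'I_n -> set R) : (forall i, measurable (A i)) ->
  lebesgue_rV n [set x | forall i, A i (x ord0 i)] =
    (\big[mule/1]_(i < n) @lebesgue_measure R (A i))%E.
Proof.
elim: n A => [|n IH] A mA /=.
  rewrite big_ord0 diracE mem_set//= => i; by case: i.
rewrite /lebesgue_rV_step /pushforward (_ : _ @^-1` _ = A ord0 `*` [set x : 'rV[R]_n | forall i, A (lift ord0 i) (x ord0 i)]).
  set B := (X in _ `*` X).
  have mB : measurable B.
    have -> : B = \bigcap_(i in [set: 'I_n]) [set x | A (lift ord0 i) (x ord0 i)].
      by apply/seteqP; split => x /= H i; [move=> _|]; apply: H.
    apply: fin_bigcap_measurable => // i _.
    by rewrite -[X in measurable X]setTI; apply: (@measurable_mx_coord _ R).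
  rewrite product_measure1E; [|exact: mA|exact: mB].
  by rewrite big_ord_recl; congr (_ * _)%E; rewrite /B (IH (fun i => A (lift ord0 i))).

apply/seteqP; split => -[x y] /= H.
  split; first by have := H ord0; rewrite -[X in A _ X]/((rV_uncons (rV_cons (x,y))).1) rV_consK.
  move=> i /=. have := H (lift ord0 i).
  have -> // : rV_cons (x, y) ord0 (lift ord0 i) = y ord0 i.
  rewrite (_ : lift ord0 i = rshift 1 i); last exact: val_inj.
  exact: (@row_mxEr _ 1 1 n _ y ord0 i).
move=> i; case: (unliftP ord0 i) => [j|] ->.
  have -> : rV_cons (x, y) ord0 (lift ord0 j) = y ord0 j.
    rewrite (_ : lift ord0 j = rshift 1 j); last exact: val_inj.
    exact: (@row_mxEr _ 1 1 n _ y ord0 j).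
  exact: H.2.
rewrite -[X in A _ X]/((rV_uncons (rV_cons (x,y))).1) rV_consK.
exact: H.1.
Qed.

(* Complex-valued functions are treated through their real and imaginary
   parts. *)
Section complex_valued.
Context {R : realType}.

Definition part_Re {T} (f : T -> R[i]) : T -> R := fun x => complex.Re (f x).
Definition part_Im {T} (f : T -> R[i]) : T -> R := fun x => complex.Im (f x).

Section integral.
Context {d : measure_display} {T : measurableType d}.
Variable mu : {measure set T -> \bar R}.

Definition cmeasurable (D : set T) (f : T -> R[i]) :=
  measurable_fun D (part_Re f) /\ measurable_fun D (part_Im f).

Definition cintegrable (D : set T) (f : T -> R[i]) :=
  mu.-integrable D (EFin \o part_Re f) /\ mu.-integrable D (EFin \o part_Im f).

Definition cintegral (D : set T) (f : T -> R[i]) : R[i] :=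
  (\int[mu]_(x in D) part_Re f x) +i* (\int[mu]_(x in D) part_Im f x).

End integral.

Section calculus.
Context {V : normedModType R}.

Definition iter_derive (s : seq V) (f : V -> R) : V -> R :=
  foldr (fun v g x => 'D_v g x) f s.

(* V is finite dimensional below, and this is then C^oo. *)
Definition smooth (f : V -> R) := forall s : seq V,
  continuous (iter_derive s f) /\
  forall x v, derivable (iter_derive s f) x v.

Definition csmooth (f : V -> R[i]) := smooth (part_Re f) /\ smooth (part_Im f).

Definition cderive (v : V) (f : V -> R[i]) (x : V) : R[i] :=
  ('D_v (part_Re f) x) +i* ('D_v (part_Im f) x).

Definition supp (f : V -> R[i]) : set V := closure [set x | f x != 0].

Definition Cc_oo (U : set V) (f : V -> R[i]) :=
  [/\ csmooth f, compact (supp f) & supp f `<=` U].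

End calculus.
End complex_valued.

(* Elements of L^2(Omega), etc., are represented by total functions, whose
   values outside of Omega play no role. *)
Section function_spaces.
Context {R : realType} {d : nat}.
Notation Rd := 'rV[R]_d.
Notation leb := (lebesgue_rV d : {measure set Rd -> \bar R}).
Implicit Types (Omega : set Rd) (f g q : Rd -> R[i]) (u v : Rd -> 'rV[R[i]]_d).

Definition dotR (x y : Rd) : R := \sum_i x ord0 i * y ord0 i.

Definition ebasis (i : 'I_d) : Rd := delta_mx ord0 i.

Definition cmpt u (j : 'I_d) : Rd -> R[i] := fun x => u x ord0 j.

(* Near each boundary point, Omega is the sublevel set of a smooth function
   with nonvanishing differential. *)
Definition smooth_boundary Omega := forall p, closure Omega p -> ~ Omega p ->
  exists rho : Rd -> R, [/\ smooth rho, exists v : Rd, 'D_v rho p != 0 &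
    \forall x \near p, Omega x <-> rho x < 0].

Definition smooth_bounded_domain Omega :=
  [/\ open Omega, connected Omega, Omega !=set0, bounded_set Omega
    & smooth_boundary Omega].

Definition L2 Omega f :=
  cmeasurable Omega f /\
  (\int[leb]_(x in Omega) (ComplexField.Normc.normc (f x) ^+ 2)%:E < +oo)%E.

Definition L2norm Omega f : R :=
  Num.sqrt (\int[leb]_(x in Omega) (ComplexField.Normc.normc (f x) ^+ 2)).

Definition L2v Omega u := forall j, L2 Omega (cmpt u j).

Definition L2normv Omega u : R :=
  Num.sqrt (\sum_j L2norm Omega (cmpt u j) ^+ 2).

Definition L2dot Omega u v : R[i] :=
  \sum_j cintegral leb Omega (fun x => u x ord0 j * (v x ord0 j)^*).

Definition L1loc Omega f :=
  forall K, compact K -> K `<=` Omega -> cintegrable leb K f.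

(* g = d_i f in the sense of distributions on Omega *)
Definition weak_partial Omega (i : 'I_d) f g :=
  [/\ L1loc Omega f, L1loc Omega g & forall phi, Cc_oo Omega phi ->
    cintegral leb Omega (fun x => f x * cderive (ebasis i) phi x) =
    - cintegral leb Omega (fun x => g x * phi x)].

Definition weak_grad Omega q u := forall i, weak_partial Omega i q (cmpt u i).

Definition weak_div Omega u g :=
  [/\ forall j, L1loc Omega (cmpt u j), L1loc Omega g &
    forall phi, Cc_oo Omega phi ->
    cintegral leb Omega
      (fun x => \sum_j u x ord0 j * cderive (ebasis j) phi x) =
    - cintegral leb Omega (fun x => g x * phi x)].

Definition weak_laplacian Omega f g :=
  exists D D2 : 'I_d -> Rd -> R[i],
  [/\ forall i, weak_partial Omega i f (D i),
      forall i, weak_partial Omega i (D i) (D2 i)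
    & forall x, g x = \sum_i D2 i x].

Fixpoint Hm (m : nat) Omega f : Prop :=
  L2 Omega f /\
  match m with
  | 0 => True
  | m'.+1 => forall i, exists2 g, weak_partial Omega i f g & Hm m' Omega g
  end.

(* closure of C_c^oo(Omega) in H^1(Omega) *)
Definition H10 Omega f :=
  L2 Omega f /\ exists Df : Rd -> 'rV[R[i]]_d,
  [/\ weak_grad Omega f Df, L2v Omega Df &
    forall e : R, 0 < e -> exists phi, [/\ Cc_oo Omega phi,
      L2norm Omega (fun x => f x - phi x) < e &
      forall i, L2norm Omega (fun x => Df x ord0 i - cderive (ebasis i) phi x)
                < e]].

(* For u in L^2 with div u = 0, the normal trace u.nu on the boundary is the
   element of H^{-1/2} defined by Green's formula,
   <u.nu, q> = \int_Omega u . grad q  for all q in H^1(Omega). *)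
Definition normal_trace_eq0 Omega u := forall q Dq,
  Hm 1 Omega q -> weak_grad Omega q Dq ->
  cintegral leb Omega (fun x => \sum_j u x ord0 j * Dq x ord0 j) = 0.

Definition spaceV Omega u :=
  (forall j, H10 Omega (cmpt u j)) /\ weak_div Omega u (fun=> 0).

Definition spaceH Omega u :=
  [/\ L2v Omega u, weak_div Omega u (fun=> 0) & normal_trace_eq0 Omega u].

(* - h^2 Delta u - u + h grad q = F and h div u = 0 in Omega,
   where Dq stands for grad q *)
Definition stokes Omega (h : R) u Dq (F : Rd -> 'rV[R[i]]_d) :=
  exists Lu divu, [/\ forall j, weak_laplacian Omega (cmpt u j) (cmpt Lu j),
    weak_div Omega u divu,
    {ae leb, forall x, Omega x ->
      - (h ^+ 2)%:C *: Lu x - u x + h%:C *: Dq x = F x} &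
    {ae leb, forall x, Omega x -> h%:C * divu x = 0}].

Definition weakly_to0 Omega (u : nat -> Rd -> 'rV[R[i]]_d) :=
  forall v, L2v Omega v -> (L2dot Omega (u k) v : R[i]^o) @[k --> \oo] --> (0 : R[i]^o).

(* Car(P) for P = - h^2 Delta - 1 *)
Definition Car Omega : set (Rd * Rd) :=
  [set z | closure Omega z.1 /\ dotR z.2 z.2 = 1].

Definition cis (t : R) : R[i] := cos t +i* sin t.

(* Op_h(a) with cutoff phi; a being scalar, it acts componentwise *)
Definition Op_h (h : R) (a : Rd * Rd -> R[i]) phi u : Rd -> 'rV[R[i]]_d :=
  fun x => \row_j (((2 * pi * h) ^- d)%:C *
    cintegral leb setT (fun xi =>
      cintegral leb setT (fun z =>
        cis (dotR (x - z) xi / h) * a (x, xi) * phi z * u z ord0 j))).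

End function_spaces.

(* Main.v *)
Require Import Defs.
From HB Require Import structures.
From mathcomp Require Import all_boot all_order all_algebra.
From mathcomp Require Import complex.
From mathcomp Require Import all_classical all_reals all_analysis.
From mathcomp Require Import measurable_realfun.
From mathcomp Require Import ring lra.

(** Write F v (xi) for the integral of exp(- i z.xi / h) v(z), that is [FT s v xi]
    with [s = - 1 / h]. The pairing of Op_h(a) u with u only involves F(phi u) at
    the frequencies of the support of [a], a bounded set of frequencies on which
    the symbol |xi|^2 - 1 of the operator stays away from 0. The proof shows that
    F(phi u) has a vanishing energy there, the energy being h^-d times the
    integral of the squared modulus, a quantity that the Plancherel inequality
    [plancherel_box] controls by the squared L^2 norm.

    Testing the equation against the localized wave exp(- i z.xi / h) phi(z) gives
    [helmholtz_identity]: (|xi|^2 - 1) F(phi u) is F(phi f) - F(phi G), where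
    G = h grad q, plus commutators with phi that carry a factor h. The energies of
    F(phi f) and of the commutators vanish by the Plancherel inequality. The
    pressure term needs more, since G is only bounded in L^2.

    G is a gradient, and it is divergence free because [u] and [f] are. Hence
    phi G is harmonic up to commutators, and |xi| F(phi G) is bounded by h times
    transforms of the same kind ([high_frequency_bound]): the frequencies beyond
    L h carry an energy O(1 / L^2). At the frequencies up to L h, F(phi G) is the
    pairing of G with the fixed test functions exp(- i z.eta) phi(z), |eta| <= L.
    By the equation again, G tends to 0 against any test function, because
    u converges weakly to 0, f tends to 0 and h tends to 0; equicontinuity in eta
    makes this uniform ([FT_vanishes_uniformly]), and the volume of these
    frequencies, proportional to h^d, balances the normalisation of the energy.
    Letting k and then L tend to infinity gives [pressure_energy_vanishes], and
    with it [elliptic_energy_vanishes].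

    To return to Op_h(a), the symbol is written as the integral of its mixed
    derivative in x over an orthant ([mixed_FTC]). This decouples x from xi, and
    a Cauchy-Schwarz inequality with a free weight bounds the pairing by the energy
    of F(phi u) over the elliptic frequencies ([pairing_bound]). The Plancherel
    inequality itself is proved by a Schur test ([weighted_plancherel]): only an
    upper bound, for functions of bounded support and a bounded set of frequencies,
    is involved.

    The limit holds along the whole sequence, which is the subsequence chosen. *)

Set Implicit Arguments.
Unset Strict Implicit.
Unset Printing Implicit Defensive.

Import Order.TTheory GRing.Theory Num.Theory.
Import numFieldNormedType.Exports.

Local Open Scope classical_set_scope.
Local Open Scope ring_scope.
Local Open Scope complex_scope.

(** * Dominated integrals and exchange of integrations *)

Section real_integrals.
Context {R : realType}.

Lemma integrableZR d (T : measurableType d) (mu : {measure set T -> \bar R})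
    (c : R) (p : T -> R) : mu.-integrable setT (EFin \o p) ->
  mu.-integrable setT (EFin \o (fun x => c * p x)).
Proof.
move=> ip; have := integrableZl measurableT c ip.
by apply: eq_integrable => // y _; rewrite /= EFinM.
Qed.

Lemma integrableDR d (T : measurableType d) (mu : {measure set T -> \bar R})
    (p q : T -> R) : mu.-integrable setT (EFin \o p) ->
  mu.-integrable setT (EFin \o q) ->
  mu.-integrable setT (EFin \o (fun x => p x + q x)).
Proof.
move=> ip iq; have := integrableD measurableT ip iq.
by apply: eq_integrable => // y _; rewrite /= EFinD.
Qed.

Lemma integrable_dominated d (T : measurableType d)
    (mu : {measure set T -> \bar R}) (D : set T) (f g : T -> R) : measurable D ->
  measurable_fun D f -> mu.-integrable D (EFin \o g) ->
  (forall x, D x -> `|f x| <= g x) -> mu.-integrable D (EFin \o f).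
Proof.
move=> mD mf ig fg; apply: (le_integrable mD _ _ ig).
  exact/measurable_EFinP.
move=> x Dx /=; rewrite lee_fin (le_trans (fg x Dx))//; exact: ler_norm.
Qed.

Lemma Rintegral_le_dominated d (T : measurableType d)
    (mu : {measure set T -> \bar R}) (f g : T -> R) :
  measurable_fun setT f -> mu.-integrable setT (EFin \o g) ->
  (forall x, `|f x| <= g x) -> `|\int[mu]_x f x| <= \int[mu]_x g x.
Proof.
move=> mf ig fg.
have jf : mu.-integrable setT (EFin \o f) by exact: integrable_dominated ig _.
apply: le_trans (le_normr_Rintegral measurableT jf) _.
apply: le_Rintegral => //.
exact: integrable_norm.
Qed.

Section fubini.
Context d1 d2 (T1 : measurableType d1) (T2 : measurableType d2).
Variables (m1 : {sigma_finite_measure set T1 -> \bar R})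
          (m2 : {sigma_finite_measure set T2 -> \bar R}).
Implicit Types (f : T1 * T2 -> R) (p : T1 -> R) (q : T2 -> R).

Lemma measurable_Rintegral2 f : measurable_fun setT f ->
  measurable_fun setT (fun x => \int[m2]_y f (x, y)).
Proof.
move=> mf; have mF : measurable_fun setT (EFin \o f) by exact/measurable_EFinP.
apply: measurableT_comp; first exact: fine_measurable.
rewrite (_ : (fun x => _) = fun x => ((\int[m2]_y (EFin \o f)^\+ (x, y)) -
   \int[m2]_y (EFin \o f)^\- (x, y))%E).
  apply: emeasurable_funB.
    by apply: measurable_fun_fubini_tonelli_F => //; exact: measurable_funepos.
  by apply: measurable_fun_fubini_tonelli_F => //; exact: measurable_funeneg.
apply/funext => x; rewrite [LHS]integralE; congr (_ - _)%E;
  by apply: eq_integral => y _; rewrite !(funeposE, funenegE).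
Qed.

Section dominated.
Variables (f : T1 * T2 -> R) (p : T1 -> R) (q : T2 -> R).
Hypotheses (mf : measurable_fun setT f)
  (ip : m1.-integrable setT (EFin \o p)) (iq : m2.-integrable setT (EFin \o q))
  (p0 : forall x, 0 <= p x) (q0 : forall y, 0 <= q y)
  (fpq : forall x y, `|f (x, y)| <= p x * q y).

Lemma dominated_section_integrable x :
  m2.-integrable setT (EFin \o (fun y => f (x, y))).
Proof.
apply: (@integrable_dominated _ _ _ _ _ (fun y => p x * q y)) => //.
- by apply: (measurableT_comp mf); exact: measurable_pair1.
- exact: integrableZR iq.
Qed.

Lemma dominated_ysection_integrable y :
  m1.-integrable setT (EFin \o (fun x => f (x, y))).
Proof.
apply: (@integrable_dominated _ _ _ _ _ (fun x => q y * p x)) => //.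
- by apply: (measurableT_comp mf); exact: measurable_pair2.
- exact: integrableZR ip.
- by move=> x _; rewrite mulrC.
Qed.

(** A bound by a product [p x * q y] of integrable functions is all that Fubini
    asks for, by Tonelli. Every double integral below has such a bound: one
    variable stays in a bounded box and the integrand is bounded in it. *)
Lemma integrable_prod_dominated : (m1 \x m2)%E.-integrable setT (EFin \o f).
Proof.
have mF : measurable_fun setT (EFin \o f) by exact/measurable_EFinP.
apply/integrable12ltyP => //.
apply: (@le_lt_trans _ _ (\int[m1]_x ((p x)%:E * \int[m2]_y (q y)%:E))%E).
  apply: ge0_le_integral => //.
  - by move=> x _; exact: integral_ge0.
  - apply: (measurable_fun_fubini_tonelli_F (abse \o (EFin \o f))) => //=.
    exact: measurableT_comp.
  - apply: emeasurable_funM => //; apply/measurable_EFinP.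
    exact/measurable_EFinP/(measurable_int _ ip).
  move=> x _; rewrite -ge0_integralZl//; last 3 first.
  - exact: measurable_int iq.
  - by move=> y _; rewrite lee_fin.
  - by rewrite lee_fin.
  apply: ge0_le_integral => //.
  - apply: measurableT_comp => //; apply: (measurableT_comp mF).
    exact: measurable_pair1.
  - apply: emeasurable_funM => //; exact: measurable_int iq.
  - by move=> y _ /=; rewrite -EFinM lee_fin.
have qfin : (\int[m2]_y (q y)%:E)%E \is a fin_num by exact: integrable_fin_num.
rewrite -(fineK qfin); set c := fine _.
have /integrableP[_] := integrableZr measurableT c ip.
congr (_ < _)%E; apply: eq_integral => x _ /=.
by rewrite ger0_norm// mulr_ge0//; rewrite /c fine_ge0// integral_ge0// => y _; rewrite lee_fin.
Qed.

Lemma integrable_Rintegral2 :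
  m1.-integrable setT (EFin \o (fun x => \int[m2]_y f (x, y))).
Proof.
apply: (@integrable_dominated _ _ _ _ _ (fun x => (\int[m2]_y q y) * p x)) => //.
- exact: measurable_Rintegral2.
- exact: integrableZR ip.
move=> x _; rewrite mulrC -RintegralZl//.
apply: Rintegral_le_dominated => //.
  by apply: (measurableT_comp mf); exact: measurable_pair1.
exact: integrableZR iq.
Qed.

Lemma Rintegral12_prod :
  \int[m1]_x \int[m2]_y f (x, y) = \int[(m1 \x m2)%E]_z f z.
Proof.
rewrite {1 3}/Rintegral; congr fine.
rewrite -(integral12_prod_meas1 integrable_prod_dominated) /fubini_F.
apply: eq_integral => x _; rewrite /Rintegral fineK//.
exact: integrable_fin_num (dominated_section_integrable x).
Qed.

Lemma Rintegral21_prod :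
  \int[m2]_y \int[m1]_x f (x, y) = \int[(m1 \x m2)%E]_z f z.
Proof.
rewrite {1 3}/Rintegral; congr fine.
rewrite -(integral21_prod_meas1 integrable_prod_dominated) /fubini_G.
apply: eq_integral => x _; rewrite /Rintegral fineK//.
exact: integrable_fin_num (dominated_ysection_integrable x).
Qed.

Lemma Rintegral_swap :
  \int[m1]_x \int[m2]_y f (x, y) = \int[m2]_y \int[m1]_x f (x, y).
Proof. by rewrite Rintegral12_prod Rintegral21_prod. Qed.

End dominated.
End fubini.
End real_integrals.

(** * Complex numbers and complex-valued integrals *)

Notation cnorm := ComplexField.Normc.normc.
Arguments ComplexField.Normc.normc : simpl never.

Section complex_numbers.
Context {R : realType}.
Implicit Types (x y z : R[i]).

Lemma ReD x y : complex.Re (x + y) = complex.Re x + complex.Re y.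
Proof. by case: x y => [a b] [c e]. Qed.

Lemma ImD x y : complex.Im (x + y) = complex.Im x + complex.Im y.
Proof. by case: x y => [a b] [c e]. Qed.

Lemma ReM x y : complex.Re (x * y) =
  complex.Re x * complex.Re y - complex.Im x * complex.Im y.
Proof. by case: x y => [a b] [c e]. Qed.

Lemma ImM x y : complex.Im (x * y) =
  complex.Re x * complex.Im y + complex.Im x * complex.Re y.
Proof. by case: x y => [a b] [c e]. Qed.

Lemma ReN x : complex.Re (- x) = - complex.Re x.
Proof. by case: x. Qed.

Lemma ImN x : complex.Im (- x) = - complex.Im x.
Proof. by case: x. Qed.

Lemma ReJ x : complex.Re (x^*) = complex.Re x.
Proof. by case: x. Qed.

Lemma ImJ x : complex.Im (x^*) = - complex.Im x.
Proof. by case: x. Qed.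

Lemma complex_eqP x y :
  complex.Re x = complex.Re y -> complex.Im x = complex.Im y -> x = y.
Proof. by case: x y => [a b] [c e] /= -> ->. Qed.

Lemma Re_sum I (r : seq I) (P : pred I) (F : I -> R[i]) :
  complex.Re (\sum_(i <- r | P i) F i) = \sum_(i <- r | P i) complex.Re (F i).
Proof. by elim/big_rec2: _ => // i a b _ <-; rewrite ReD. Qed.

Lemma Im_sum I (r : seq I) (P : pred I) (F : I -> R[i]) :
  complex.Im (\sum_(i <- r | P i) F i) = \sum_(i <- r | P i) complex.Im (F i).
Proof. by elim/big_rec2: _ => // i a b _ <-; rewrite ImD. Qed.

Lemma cnormE z : cnorm z = Num.sqrt (complex.Re z ^+ 2 + complex.Im z ^+ 2).
Proof. by case: z. Qed.

Lemma cnorm_ge0 z : 0 <= cnorm z.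
Proof. by rewrite cnormE sqrtr_ge0. Qed.

Lemma sqr_cnorm z : cnorm z ^+ 2 = complex.Re z ^+ 2 + complex.Im z ^+ 2.
Proof. by rewrite cnormE sqr_sqrtr// addr_ge0// sqr_ge0. Qed.

Lemma normr_Re_le z : `|complex.Re z| <= cnorm z.
Proof.
by rewrite -(ler_sqr (normr_ge0 _) (cnorm_ge0 z)) sqr_cnorm real_normK ?num_real// lerDl sqr_ge0.
Qed.

Lemma normr_Im_le z : `|complex.Im z| <= cnorm z.
Proof.
by rewrite -(ler_sqr (normr_ge0 _) (cnorm_ge0 z)) sqr_cnorm real_normK ?num_real// lerDr sqr_ge0.
Qed.

Lemma cnorm_le_ReIm z : cnorm z <= `|complex.Re z| + `|complex.Im z|.
Proof.
rewrite -(ler_sqr (cnorm_ge0 z)) ?nnegrE ?addr_ge0// sqr_cnorm sqrrD.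
rewrite !real_normK ?num_real// -addrA (addrC (_ *+ 2)) addrA lerDl.
by rewrite mulrn_wge0// mulr_ge0.
Qed.

Lemma cnormM x y : cnorm (x * y) = cnorm x * cnorm y.
Proof. exact: ComplexField.Normc.normcM. Qed.

Lemma cnormD x y : cnorm (x + y) <= cnorm x + cnorm y.
Proof. exact: le_normcD. Qed.

Lemma cnormN x : cnorm (- x) = cnorm x.
Proof. by rewrite !cnormE ReN ImN !sqrrN. Qed.

Lemma cnormJ x : cnorm (x^*) = cnorm x.
Proof. by rewrite !cnormE ReJ ImJ !sqrrN. Qed.

Lemma cnorm0 : cnorm (0 : R[i]) = 0.
Proof. exact: ComplexField.Normc.normc0. Qed.

Lemma cnorm_real (a : R) : cnorm (a%:C) = `|a|.
Proof. by rewrite cnormE /= expr0n/= addr0 sqrtr_sqr. Qed.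

Lemma cnorm_sum I (r : seq I) (P : pred I) (F : I -> R[i]) :
  cnorm (\sum_(i <- r | P i) F i) <= \sum_(i <- r | P i) cnorm (F i).
Proof.
elim/big_rec2: _ => [|i a b _ H]; first by rewrite cnorm0.
by apply: le_trans (cnormD _ _) _; rewrite lerD2l.
Qed.

Lemma cnorm_cis (t : R) : cnorm (cis t) = 1.
Proof. by rewrite cnormE /= cos2Dsin2 sqrtr1. Qed.

Lemma cisD (s t : R) : cis (s + t) = cis s * cis t.
Proof. by apply: complex_eqP; rewrite ?ReM ?ImM /= ?cosD ?sinD// addrC. Qed.

End complex_numbers.

Section complex_integrals.
Context {R : realType}.

Section measurability.
Context d (T : measurableType d).
Implicit Types (D : set T) (f g : T -> R[i]).

Lemma cmeasurableD D f g :
  cmeasurable D f -> cmeasurable D g -> cmeasurable D (fun x => f x + g x).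
Proof.
move=> [f1 f2] [g1 g2]; split.
  by under [part_Re _]eq_fun do rewrite ReD; exact: measurable_funD.
by under [part_Im _]eq_fun do rewrite ImD; exact: measurable_funD.
Qed.

Lemma cmeasurableN D f : cmeasurable D f -> cmeasurable D (fun x => - f x).
Proof.
move=> [f1 f2]; split.
  by under [part_Re _]eq_fun do rewrite ReN; exact: measurable_funN.
by under [part_Im _]eq_fun do rewrite ImN; exact: measurable_funN.
Qed.

Lemma cmeasurableM D f g :
  cmeasurable D f -> cmeasurable D g -> cmeasurable D (fun x => f x * g x).
Proof.
move=> [f1 f2] [g1 g2]; split.
  under [part_Re _]eq_fun do rewrite ReM.
  by apply: measurable_funB; exact: measurable_funM.
under [part_Im _]eq_fun do rewrite ImM.
by apply: measurable_funD; exact: measurable_funM.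
Qed.

Lemma cmeasurable_cst D (c : R[i]) : cmeasurable D (fun=> c).
Proof. by split; exact: measurable_cst. Qed.

Lemma cmeasurableJ D f : cmeasurable D f -> cmeasurable D (fun x => (f x)^*).
Proof.
move=> [f1 f2]; split.
  by under [part_Re _]eq_fun do rewrite ReJ.
by under [part_Im _]eq_fun do rewrite ImJ; exact: measurable_funN.
Qed.

Lemma cmeasurable_real D (f : T -> R) :
  measurable_fun D f -> cmeasurable D (fun x => (f x)%:C).
Proof. by move=> mf; split => //; exact: measurable_cst. Qed.

Lemma measurable_sqr_cnorm D f :
  cmeasurable D f -> measurable_fun D (fun x => cnorm (f x) ^+ 2).
Proof.
move=> [f1 f2]; under eq_fun do rewrite sqr_cnorm.
by apply: measurable_funD; exact: measurable_funX.
Qed.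

Lemma measurable_cnorm D f :
  cmeasurable D f -> measurable_fun D (fun x => cnorm (f x)).
Proof.
move=> mf; under eq_fun do rewrite -(ger0_norm (cnorm_ge0 (f _))) -sqrtr_sqr.
apply: (measurableT_comp (f := @Num.sqrt R)); last exact: measurable_sqr_cnorm.
apply: continuous_measurable_fun; exact: sqrt_continuous.
Qed.

Lemma cmeasurable_cis D (f : T -> R) :
  measurable_fun D f -> cmeasurable D (fun x => cis (f x)).
Proof.
move=> mf; split; apply: measurableT_comp => //.
  exact: continuous_measurable_fun (@continuous_cos R).
exact: continuous_measurable_fun (@continuous_sin R).
Qed.

End measurability.

Lemma cmeasurable_comp d d' (T : measurableType d) (T' : measurableType d')
    (f : T' -> R[i]) (g : T -> T') :
  cmeasurable setT f -> measurable_fun setT g -> cmeasurable setT (f \o g).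
Proof.
move=> [f1 f2] mg; split.
  exact: (measurableT_comp f1 mg).
exact: (measurableT_comp f2 mg).
Qed.

Section integrability.
Context d (T : measurableType d) (mu : {measure set T -> \bar R}).
Implicit Types (D : set T) (f g : T -> R[i]).

Lemma cintegrable_dominated D f (g : T -> R) : measurable D ->
  cmeasurable D f -> mu.-integrable D (EFin \o g) ->
  (forall x, D x -> cnorm (f x) <= g x) -> cintegrable mu D f.
Proof.
move=> mD [f1 f2] ig fg; split; apply: integrable_dominated ig _ => // x Dx;
  apply: le_trans (fg x Dx); [exact: normr_Re_le|exact: normr_Im_le].
Qed.

Lemma cintegrable_measurable D f : cintegrable mu D f -> cmeasurable D f.
Proof.
move=> [f1 f2]; split; apply/measurable_EFinP.
  exact: measurable_int f1.
exact: measurable_int f2.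
Qed.

Lemma cintegrableD D f g : measurable D -> cintegrable mu D f ->
  cintegrable mu D g -> cintegrable mu D (fun x => f x + g x).
Proof.
move=> mD [f1 f2] [g1 g2]; split.
  have := integrableD mD f1 g1.
  by apply: eq_integrable => // x _; rewrite /= -EFinD /part_Re ReD.
have := integrableD mD f2 g2.
by apply: eq_integrable => // x _; rewrite /= -EFinD /part_Im ImD.
Qed.

Lemma cintegrable_cnorm D f : measurable D -> cintegrable mu D f ->
  mu.-integrable D (EFin \o (fun x => cnorm (f x))).
Proof.
move=> mD [f1 f2].
have H := integrableD mD (integrable_norm f1) (integrable_norm f2).
apply: (@integrable_dominated _ _ _ _ _ _
  (fun x => `|part_Re f x| + `|part_Im f x|)) => //.
- apply: measurable_cnorm; exact: cintegrable_measurable.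
- by move=> x _; rewrite ger0_norm ?cnorm_ge0//; exact: cnorm_le_ReIm.
Qed.

Lemma cintegrableZ D (c : R[i]) f : measurable D -> cintegrable mu D f ->
  cintegrable mu D (fun x => c * f x).
Proof.
move=> mD jf.
apply: (@cintegrable_dominated _ _ (fun x => cnorm c * cnorm (f x))) => //.
- apply: cmeasurableM; first exact: cmeasurable_cst.
  exact: cintegrable_measurable.
- have := integrableZl mD (cnorm c) (cintegrable_cnorm mD jf).
  by apply: eq_integrable => // x _; rewrite /= EFinM.
- by move=> x _; rewrite cnormM.
Qed.

Lemma cintegrableN D f : measurable D -> cintegrable mu D f ->
  cintegrable mu D (fun x => - f x).
Proof.
by move=> mD /(cintegrableZ (-1) mD); under eq_fun do rewrite mulN1r.
Qed.

Lemma cintegrable_sum D I (r : seq I) (F : I -> T -> R[i]) : measurable D ->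
  (forall i, cintegrable mu D (F i)) ->
  cintegrable mu D (fun x => \sum_(i <- r) F i x).
Proof.
move=> mD iF; elim: r => [|i r IH].
  under eq_fun do rewrite big_nil.
  by split; exact: integrable0.
by under eq_fun do rewrite big_cons; exact: cintegrableD.
Qed.

Lemma cintegralD D f g : measurable D -> cintegrable mu D f ->
  cintegrable mu D g ->
  cintegral mu D (fun x => f x + g x) = cintegral mu D f + cintegral mu D g.
Proof.
move=> mD [f1 f2] [g1 g2]; apply: complex_eqP; rewrite ?ReD ?ImD /=.
  rewrite -RintegralD//; apply: eq_Rintegral => x _; exact: ReD.
rewrite -RintegralD//; apply: eq_Rintegral => x _; exact: ImD.
Qed.

Lemma cintegralZ D (c : R[i]) f : measurable D -> cintegrable mu D f ->
  cintegral mu D (fun x => c * f x) = c * cintegral mu D f.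
Proof.
move=> mD [f1 f2].
have f1' k : mu.-integrable D (EFin \o (fun x => k * part_Re f x)).
  have := integrableZl mD k f1.
  by apply: eq_integrable => // x _; rewrite /= EFinM.
have f2' k : mu.-integrable D (EFin \o (fun x => k * part_Im f x)).
  have := integrableZl mD k f2.
  by apply: eq_integrable => // x _; rewrite /= EFinM.
apply: complex_eqP; rewrite ?ReM ?ImM /=.
  rewrite -!RintegralZl// -RintegralB//; apply: eq_Rintegral => x _; exact: ReM.
rewrite -!RintegralZl// -RintegralD//; apply: eq_Rintegral => x _; exact: ImM.
Qed.

Lemma cintegralN D f : measurable D -> cintegrable mu D f ->
  cintegral mu D (fun x => - f x) = - cintegral mu D f.
Proof.
move=> mD jf; rewrite -mulN1r -cintegralZ//.
by congr cintegral; apply/funext => x; rewrite mulN1r.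
Qed.

Lemma cintegral0 D : cintegral mu D (fun=> 0) = 0.
Proof.
by apply: complex_eqP; rewrite /= /Rintegral /part_Re /part_Im /= integral0.
Qed.

Lemma cintegral_sum D I (r : seq I) (F : I -> T -> R[i]) : measurable D ->
  (forall i, cintegrable mu D (F i)) ->
  cintegral mu D (fun x => \sum_(i <- r) F i x) =
  \sum_(i <- r) cintegral mu D (F i).
Proof.
move=> mD iF; elim: r => [|i r IH].
  by under eq_fun do rewrite big_nil; rewrite big_nil cintegral0.
under eq_fun do rewrite big_cons.
by rewrite cintegralD ?big_cons ?IH//; exact: cintegrable_sum.
Qed.

Lemma eq_cintegral D f g : (forall x, D x -> f x = g x) ->
  cintegral mu D f = cintegral mu D g.
Proof.
move=> fg; apply: complex_eqP => /=; apply: eq_Rintegral => x /set_mem Dx;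
  by rewrite /part_Re /part_Im fg.
Qed.

(** The factor 2 is the price of estimating the real and the imaginary parts
    separately. *)
Lemma cnorm_cintegral_le f (g : T -> R) : cmeasurable setT f ->
  mu.-integrable setT (EFin \o g) -> (forall x, cnorm (f x) <= g x) ->
  cnorm (cintegral mu setT f) <= 2 * \int[mu]_x g x.
Proof.
move=> [f1 f2] ig fg; apply: le_trans (cnorm_le_ReIm _) _ => /=.
rewrite mulr_natl mulr2n lerD//; apply: Rintegral_le_dominated => // x.
  exact: le_trans (normr_Re_le _) (fg x).
exact: le_trans (normr_Im_le _) (fg x).
Qed.

End integrability.

Lemma cintegral_mkcond d (T : measurableType d) (mu : {measure set T -> \bar R})
    (D : set T) (f : T -> R[i]) :
  cintegral mu D f = cintegral mu setT (patch (fun=> 0) D f).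
Proof.
apply: complex_eqP => /=; rewrite Rintegral_mkcond; apply: eq_Rintegral => x _;
  by rewrite /patch /part_Re /part_Im; case: ifP.
Qed.

Lemma cintegrable_mkcond d (T : measurableType d)
    (mu : {measure set T -> \bar R}) (D : set T) (f : T -> R[i]) :
  measurable D -> cintegrable mu D f <->
  cintegrable mu setT (patch (fun=> 0) D f).
Proof.
move=> mD; rewrite /cintegrable.
have E (p : R[i] -> R) : p 0 = 0 ->
  (EFin \o (fun x => p (patch (fun=> 0) D f x))) = (EFin \o (p \o f)) \_ D.
  by move=> p0; apply/funext => x; rewrite /= /patch; case: ifP; rewrite ?p0.
rewrite [in X in _ <-> X](_ : EFin \o part_Re _ = (EFin \o part_Re f) \_ D);
  last exact: (E (@complex.Re R)).
rewrite [in X in _ <-> X](_ : EFin \o part_Im _ = (EFin \o part_Im f) \_ D);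
  last exact: (E (@complex.Im R)).
rewrite -!(integrable_mkcond (D := D))//.
Qed.

Section fubini.
Context d1 d2 (T1 : measurableType d1) (T2 : measurableType d2).
Variables (m1 : {sigma_finite_measure set T1 -> \bar R})
          (m2 : {sigma_finite_measure set T2 -> \bar R}).

Lemma cmeasurable_cintegral2 (f : T1 * T2 -> R[i]) : cmeasurable setT f ->
  cmeasurable setT (fun x => cintegral m2 setT (fun y => f (x, y))).
Proof.
move=> [f1 f2]; split.
  exact: (@measurable_Rintegral2 _ _ _ _ _ m2 (part_Re f)).
exact: (@measurable_Rintegral2 _ _ _ _ _ m2 (part_Im f)).
Qed.

Lemma cintegral_swap (f : T1 * T2 -> R[i]) (p : T1 -> R) (q : T2 -> R) :
  cmeasurable setT f ->
  m1.-integrable setT (EFin \o p) -> m2.-integrable setT (EFin \o q) ->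
  (forall x, 0 <= p x) -> (forall y, 0 <= q y) ->
  (forall x y, cnorm (f (x, y)) <= p x * q y) ->
  cintegral m1 setT (fun x => cintegral m2 setT (fun y => f (x, y))) =
  cintegral m2 setT (fun y => cintegral m1 setT (fun x => f (x, y))).
Proof.
move=> [f1 f2] ip iq p0 q0 fpq; apply: complex_eqP => /=.
  apply: (Rintegral_swap (f := part_Re f) f1 ip iq p0 q0) => x y.
  exact: le_trans (normr_Re_le _) (fpq x y).
apply: (Rintegral_swap (f := part_Im f) f2 ip iq p0 q0) => x y.
exact: le_trans (normr_Im_le _) (fpq x y).
Qed.

End fubini.
End complex_integrals.

(** * Borel sets of row vectors *)

Section borel_rV.
Context {R : realType}.

Lemma rV_ballP n (x y : 'rV[R]_n) (e : R) : 0 < e ->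
  (forall j, `|x ord0 j - y ord0 j| < e) -> ball x e y.
Proof. by move=> e0 xy; split => // i j; rewrite ord1; exact: xy. Qed.

Lemma rV_coord_le n (x : 'rV[R]_n) j : `|x ord0 j| <= `|x|.
Proof.
rewrite [leRHS]/Num.Def.normr/= mx_normrE.
exact: (@le_bigmax _ _ _ _ (fun ij : 'I_1 * 'I_n => `|x ij.1 ij.2|) (ord0, j)).
Qed.

(** The sigma-algebra of row vectors is generated by the coordinates while
    smooth functions are continuous for the topology of the norm: the link is
    that the topology has a countable basis of measurable boxes. *)
Lemma measurable_of_countable_basis d (T : measurableType d) (I : countType)
    (B : I -> set T) (U : set T) :
  (forall i, measurable (B i)) ->
  (forall x, U x -> exists i, B i x /\ B i `<=` U) -> measurable U.
Proof.
move=> mB BU.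
rewrite (_ : U = \bigcup_i (if `[< B i `<=` U >] then B i else set0)).
  apply: countable_bigcupT_measurable => [|i]; first exact: countableP.
  by case: ifP.
apply/seteqP; split => [x /BU[i [Bx BiU]]|x [i _]].
  by exists i => //; rewrite asboolT.
by case: asboolP => // + Bx; apply.
Qed.

Definition rational_box n (i : 'rV[rat]_n * nat) : set 'rV[R]_n :=
  [set x | forall j, `|ratr (i.1 ord0 j) - x ord0 j| < i.2.+1%:R^-1].

Lemma measurable_forall d (T : measurableType d) n (A : 'I_n -> set T) :
  (forall i, measurable (A i)) -> measurable [set x | forall i, A i x].
Proof.
move=> mA; rewrite (_ : [set _ | _] = \bigcap_(i in [set: 'I_n]) A i).
  exact: fin_bigcap_measurable.
by apply/seteqP; split => x /= H i; [move=> _|]; apply: H.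
Qed.

Lemma measurable_rV_coord n (j : 'I_n) :
  measurable_fun setT (fun x : 'rV[R]_n => x ord0 j).
Proof. exact: (@measurable_mx_coord _ R). Qed.

Lemma measurable_rational_box n i : measurable (@rational_box n i).
Proof.
apply: measurable_forall => j.
rewrite -[X in measurable X]setTI.
have : measurable_fun setT (fun x : 'rV[R]_n => `|ratr (i.1 ord0 j) - x ord0 j|).
  apply: (measurableT_comp (@normr_measurable _ _)).
  by apply: measurable_funB => //; exact: measurable_rV_coord.
move=> /(_ measurableT `]-oo, i.2.+1%:R^-1[%classic).
rewrite (_ : _ @^-1` _ = [set x : 'rV[R]_n | `|ratr (i.1 ord0 j) - x ord0 j| < i.2.+1%:R^-1]).
  by apply; exact: measurable_itv.
by apply/seteqP; split => x /=; rewrite in_itv.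
Qed.

Lemma rational_box_basis n (x : 'rV[R]_n) (e : R) : 0 < e ->
  exists i, rational_box i x /\ rational_box i `<=` ball x e.
Proof.
move=> e0.
have [k ke] : exists k : nat, k.+1%:R^-1 < e / 2.
  have e20 : 0 < e / 2 by rewrite divr_gt0.
  have [k _ H] := near_infty_natSinv_lt (PosNum e20).
  by exists k; apply: (H k) => /=.
have K0 : (0 : R) < k.+1%:R^-1 by rewrite invr_gt0.
have q j : exists q : rat, `|ratr q - x ord0 j| < k.+1%:R^-1.
  have /rat_in_itvoo[q] : x ord0 j - k.+1%:R^-1 < x ord0 j + k.+1%:R^-1.
    by rewrite ltrD2l gtrN.
  rewrite in_itv/= => /andP[q1 q2]; exists q.
  by rewrite ltr_norml ltrBrDl q1 ltrBlDl.
have {q}[q Hq] := choice q.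
exists (\row_j q j, k); split; first by move=> j; rewrite mxE.
move=> y /= Hy; apply: rV_ballP => // j; have := Hy j; rewrite mxE /= => Hj.
have := Hq j; rewrite distrC => Hqj.
rewrite (splitr e); apply: le_lt_trans (ler_distD (ratr (q j)) _ _) _.
by apply: ltrD; [apply: lt_trans Hqj _|apply: lt_trans Hj _].
Qed.

Lemma open_measurable_rV n (U : set 'rV[R]_n) : open U -> measurable U.
Proof.
move=> oU; apply: (@measurable_of_countable_basis _ _ _ (@rational_box n)).
  exact: measurable_rational_box.
move=> x Ux; have /nbhs_ballP[e /= e0 He] := open_nbhs_nbhs (conj oU Ux).
have [i [ix ie]] := rational_box_basis x e0.
by exists i; split => //; apply: subset_trans He.
Qed.

Lemma open_measurable_rV2 n m (U : set ('rV[R]_n * 'rV[R]_m)) :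
  open U -> measurable U.
Proof.
move=> oU; apply: (@measurable_of_countable_basis _ _ _
  (fun i : ('rV[rat]_n * nat) * ('rV[rat]_m * nat) =>
    rational_box i.1 `*` rational_box i.2)).
  by move=> i; apply: measurableX; exact: measurable_rational_box.
move=> [x y] Uxy; have /nbhs_ballP[e /= e0 He] := open_nbhs_nbhs (conj oU Uxy).
have [i [ix ie]] := rational_box_basis x e0.
have [j [jy je]] := rational_box_basis y e0.
exists (i, j); split => // -[a b] [/= ia jb]; apply: He; split => /=.
  exact: ie.
exact: je.
Qed.

Lemma measurable_fun_of_open d (T : measurableType d) (f : T -> R) :
  (forall U : set R, open U -> measurable (f @^-1` U)) -> measurable_fun setT f.
Proof.
move=> fU; apply: (measurability _ (RGenOInfty.measurableE R)) => //.
move=> _ [_ [x ->] <-]; rewrite setTI; apply: fU; exact: interval_open.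
Qed.

Lemma continuous_measurable_rV n (f : 'rV[R]_n -> R) :
  continuous f -> measurable_fun setT f.
Proof.
move=> /continuousP cf; apply: measurable_fun_of_open => U oU.
by apply: open_measurable_rV; apply: cf.
Qed.

Lemma continuous_measurable_rV2 n m (f : 'rV[R]_n * 'rV[R]_m -> R) :
  continuous f -> measurable_fun setT f.
Proof.
move=> /continuousP cf; apply: measurable_fun_of_open => U oU.
by apply: open_measurable_rV2; apply: cf.
Qed.

End borel_rV.

(** * Integrals on row vectors as iterated integrals *)

Section lebesgue_rV_integrals.
Context {R : realType}.
Local Notation leb n := (lebesgue_rV n : {measure set 'rV[R]_n -> \bar R}).

Lemma rV_cons0 n (p : measurableTypeR R * 'rV[R]_n) :
  rV_cons p ord0 ord0 = p.1.
Proof.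
rewrite /rV_cons (_ : @ord0 n = lshift n (@ord0 0)); last exact: val_inj.
by apply: etrans (@row_mxEl _ 1 1 n _ p.2 ord0 ord0) _; rewrite mxE.
Qed.

Lemma rV_consS n (p : measurableTypeR R * 'rV[R]_n) (i : 'I_n) :
  rV_cons p ord0 (lift ord0 i) = p.2 ord0 i.
Proof.
rewrite /rV_cons (_ : lift ord0 i = rshift 1 i); last exact: val_inj.
exact: (@row_mxEr _ 1 1 n _ p.2 ord0 i).
Qed.

(** [lebesgue_rV n.+1] is the image of a product measure under [rV_cons], so
    this is Tonelli after a change of variables. *)
Lemma ge0_integral_lebesgue_rVS n (f : 'rV[R]_n.+1 -> \bar R) :
  measurable_fun setT f -> (forall x, 0 <= f x)%E ->
  (\int[leb n.+1]_x f x =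
   \int[@lebesgue_measure R]_t \int[leb n]_y f (rV_cons (t, y)))%E.
Proof.
move=> mf f0.
have mc := @measurable_rV_cons R n.
have := ge0_integral_pushforward mc (@lebesgue_measure R \x lebesgue_rV n)%E
  measurableT mf (fun y _ => f0 y).
rewrite preimage_setT (fubini_tonelli1 (f \o @rV_cons R n)).
- by move=> <-; apply: eq_measure_integral.
- exact: measurableT_comp.
- by move=> x; exact: f0.
Qed.

Section dominated.
Variables (n : nat) (f : 'rV[R]_n.+1 -> R) (p : R -> R) (q : 'rV[R]_n -> R).
Hypotheses (mf : measurable_fun setT f)
  (ip : (@lebesgue_measure R).-integrable setT (EFin \o p))
  (iq : (leb n).-integrable setT (EFin \o q))
  (p0 : forall t, 0 <= p t) (q0 : forall y, 0 <= q y)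
  (fpq : forall t y, `|f (rV_cons (t, y))| <= p t * q y).

Let mfc : measurable_fun setT (f \o @rV_cons R n).
Proof. by apply: measurableT_comp => //; exact: measurable_rV_cons. Qed.

Let ifc : (@lebesgue_measure R \x lebesgue_rV n)%E.-integrable setT
  (EFin \o (f \o @rV_cons R n)).
Proof. exact: integrable_prod_dominated mfc ip iq p0 q0 fpq. Qed.

Lemma integrable_lebesgue_rVS : (leb n.+1).-integrable setT (EFin \o f).
Proof.
apply/integrableP; split; first exact/measurable_EFinP.
rewrite ge0_integral_lebesgue_rVS//; last first.
  by apply: measurableT_comp => //; exact/measurable_EFinP.
have := (@integrable12ltyP _ _ _ _ _ (@lebesgue_measure R) (lebesgue_rV n)
  (EFin \o (f \o @rV_cons R n)) _).1 ifc.
by apply; exact/measurable_EFinP.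
Qed.

Lemma Rintegral_lebesgue_rVS :
  \int[leb n.+1]_x f x =
  \int[@lebesgue_measure R]_t \int[leb n]_y f (rV_cons (t, y)).
Proof.
rewrite (Rintegral12_prod mfc ip iq p0 q0 fpq) /Rintegral; congr fine.
have mF : measurable_fun setT (EFin \o f) by exact/measurable_EFinP.
have mc := @measurable_rV_cons R n.
have <- := integral_pushforward mc (D := setT) mF ifc measurableT.
exact: eq_measure_integral.
Qed.

End dominated.

Lemma Rintegral_lebesgue_rV0 (f : 'rV[R]_0 -> R) :
  measurable_fun setT f -> \int[leb 0]_x f x = f 0.
Proof.
move=> mf; rewrite /Rintegral integral_dirac//; last exact/measurable_EFinP.
by rewrite diracT mul1e.
Qed.

Lemma integrable_lebesgue_rV0 (f : 'rV[R]_0 -> R) :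
  measurable_fun setT f -> (leb 0).-integrable setT (EFin \o f).
Proof.
move=> mf; apply/integrableP; split; first exact/measurable_EFinP.
rewrite integral_dirac// ?diracT ?mul1e ?ltry//.
by apply: measurableT_comp => //; exact/measurable_EFinP.
Qed.

Lemma measurable_prod_coord n (g : 'I_n -> R -> R) :
  (forall i, measurable_fun setT (g i)) ->
  measurable_fun setT (fun x : 'rV[R]_n => \prod_(i < n) g i (x ord0 i)).
Proof.
move=> mg; apply: measurable_prod => i _.
apply: (measurableT_comp (mg i)); exact: measurable_rV_coord.
Qed.

Lemma prod_rV_cons n (g : 'I_n.+1 -> R -> R) t (y : 'rV[R]_n) :
  \prod_(i < n.+1) g i (rV_cons (t, y) ord0 i) =
  g ord0 t * \prod_(i < n) g (lift ord0 i) (y ord0 i).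
Proof.
rewrite big_ord_recl rV_cons0; congr (_ * _).
by apply: eq_bigr => i _; rewrite rV_consS.
Qed.

Lemma integrable_Rintegral_prod n (g : 'I_n -> R -> R) :
  (forall i, (@lebesgue_measure R).-integrable setT (EFin \o g i)) ->
  (leb n).-integrable setT (EFin \o (fun x : 'rV[R]_n => \prod_(i < n) g i (x ord0 i))) /\
  \int[leb n]_x (\prod_(i < n) g i (x ord0 i)) =
    \prod_(i < n) \int[@lebesgue_measure R]_t g i t.
Proof.
elim: n g => [|n IH] g ig.
  have mg : measurable_fun setT
    (fun x : 'rV[R]_0 => \prod_(i < 0) g i (x ord0 i)).
    by apply: measurable_prod_coord => -[].
  split; first exact: integrable_lebesgue_rV0.
  by rewrite Rintegral_lebesgue_rV0// !big_ord0.
have mg i : measurable_fun setT (g i).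
  by apply/measurable_EFinP; exact: measurable_int (ig i).
have [iP EP] := IH (fun i => g (lift ord0 i)) (fun i => ig (lift ord0 i)).
have D t y : `|\prod_(i < n.+1) g i (rV_cons (t, y) ord0 i)| <=
  `|g ord0 t| * `|\prod_(i < n) g (lift ord0 i) (y ord0 i)|.
  by rewrite prod_rV_cons normrM.
have mP := measurable_prod_coord mg.
have i0 := integrable_norm (ig ord0).
have i1 := integrable_norm iP.
split.
  exact: (integrable_lebesgue_rVS mP i0 i1 (fun t => normr_ge0 _) (fun y => normr_ge0 _) D).
rewrite (Rintegral_lebesgue_rVS mP i0 i1 (fun t => normr_ge0 _) (fun y => normr_ge0 _) D).
rewrite big_ord_recl -EP.
under eq_Rintegral do under eq_Rintegral do rewrite prod_rV_cons/=.
rewrite -RintegralZr//; apply: eq_Rintegral => t _.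
by rewrite -RintegralZl.
Qed.

End lebesgue_rV_integrals.

(** * Continuity rules and the fundamental theorem of calculus *)

Section continuity_rules.
Context {R : realType} {T : topologicalType}.
Implicit Types (f g : T -> R).

Lemma ctsD f g : continuous f -> continuous g -> continuous (fun x => f x + g x).
Proof. by move=> cf cg x; apply: cvgD; [exact: cf|exact: cg]. Qed.

Lemma ctsB f g : continuous f -> continuous g -> continuous (fun x => f x - g x).
Proof. by move=> cf cg x; apply: cvgB; [exact: cf|exact: cg]. Qed.

Lemma ctsM f g : continuous f -> continuous g -> continuous (fun x => f x * g x).
Proof. by move=> cf cg x; apply: cvgM; [exact: cf|exact: cg]. Qed.

Lemma ctsC (c : R) : continuous (fun _ : T => c).
Proof. by move=> x; exact: cvg_cst. Qed.

Lemma ctsX f n : continuous f -> continuous (fun x => f x ^+ n).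
Proof.
move=> cf; elim: n => [|n IH].
  by under eq_fun do rewrite expr0; exact: ctsC.
by under eq_fun do rewrite exprS; exact: ctsM.
Qed.

Lemma cts_sum I (r : seq I) (F : I -> T -> R) : (forall i, continuous (F i)) ->
  continuous (fun x => \sum_(i <- r) F i x).
Proof.
move=> cF; elim: r => [|i r IH].
  by under eq_fun do rewrite big_nil; exact: ctsC.
by under eq_fun do rewrite big_cons; exact: ctsD.
Qed.

Lemma cts_comp (h : R -> R) f : continuous h -> continuous f ->
  continuous (fun x => h (f x)).
Proof. by move=> ch cf x; apply: continuous_comp; [exact: cf|exact: ch]. Qed.

End continuity_rules.

Lemma cts_id {R : realType} : continuous (fun x : R => x).
Proof. by move=> x; exact: cvg_id. Qed.

Section fundamental_theorem.
Context {R : realType}.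
Local Notation mu := (@lebesgue_measure R).

Lemma Rintegral_FTC (f F : R -> R) (a b : R) : a < b ->
  (forall x : R, is_derive x 1 F (f x)) -> continuous f ->
  \int[mu]_(x in `[a, b]) f x = F b - F a.
Proof.
move=> ab Ff cf; rewrite /Rintegral (@continuous_FTC2 _ f F)//.
- exact: continuous_subspaceT.
- have dF x : derivable F x 1 by have [] := Ff x.
  split => [x _||]; first exact: dF.
    apply: cvg_at_right_filter; apply: differentiable_continuous.
    exact/derivable1_diffP.
  apply: cvg_at_left_filter; apply: differentiable_continuous.
  exact/derivable1_diffP.
- by move=> x _; rewrite derive1E; have [_ ->] := Ff x.
Qed.

Lemma integrable_continuous_itv (f : R -> R) (a b : R) : continuous f ->
  mu.-integrable `[a, b] (EFin \o f).
Proof.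
move=> cf; apply: continuous_compact_integrable; first exact: segment_compact.
exact: continuous_subspaceT.
Qed.

End fundamental_theorem.

(** * A frequency weight with integrable Fourier transform *)

Section frequency_weight.
Context {R : realType}.
Local Notation mu := (@lebesgue_measure R).
Variables (L : R) (L0 : 0 < L).

(** Being continuous, this weight has a Fourier transform of size
    [1 / (1 + s ^ 2)], which is integrable, whereas that of an indicator is not;
    being a polynomial on its support, it makes all the integrals involved have
    elementary primitives. *)
Definition bump (x : R) : R := Num.max (L ^+ 2 - x ^+ 2) 0.

Lemma bump_ge0 x : 0 <= bump x.
Proof. by rewrite le_max lexx orbT. Qed.

Lemma bump_in x : `|x| <= L -> bump x = L ^+ 2 - x ^+ 2.
Proof.
move=> xL; rewrite /bump max_l// subr_ge0 -(real_normK (num_real x)).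
by rewrite ler_sqr ?nnegrE// ltW.
Qed.

Lemma bump_out x : L <= `|x| -> bump x = 0.
Proof.
move=> xL; rewrite /bump max_r// subr_le0 -(real_normK (num_real x)).
by rewrite ler_sqr ?nnegrE// ltW.
Qed.

Lemma continuous_bump : continuous bump.
Proof.
move=> x; apply: (@continuous_max _ R (fun x => L ^+ 2 - x ^+ 2) (fun=> 0)).
  by apply: ctsB; [exact: ctsC|apply/ctsX/cts_id].
exact: ctsC.
Qed.

Lemma Rintegral_bumpM (g : R -> R) :
  \int[mu]_x (bump x * g x) = \int[mu]_(x in `[- L, L]) ((L ^+ 2 - x ^+ 2) * g x).
Proof.
rewrite [RHS]Rintegral_mkcond; apply: eq_Rintegral => x _.
rewrite /patch mem_setE in_itv/= -ler_norml; case: ifPn => [xL|].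
  by rewrite bump_in.
by rewrite -ltNge => /ltW/bump_out ->; rewrite mul0r.
Qed.

Lemma continuous_quadM (g : R -> R) : continuous g ->
  continuous (fun x : R => (L ^+ 2 - x ^+ 2) * g x).
Proof.
by move=> cg; apply: ctsM => //; apply: ctsB; [exact: ctsC|apply/ctsX/cts_id].
Qed.

Lemma integrable_bumpM (g : R -> R) : continuous g ->
  mu.-integrable setT (EFin \o (fun x => bump x * g x)).
Proof.
move=> cg.
have /integrable_mkcond := integrable_continuous_itv (- L) L (continuous_quadM cg).
move=> /(_ (measurable_itv _)).
apply: eq_integrable => // x _ /=.
rewrite /patch mem_setE in_itv/= -ler_norml; case: ifPn => [xL|].
  by rewrite bump_in.
by rewrite -ltNge => /ltW/bump_out ->; rewrite mul0r.
Qed.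

Lemma integrable_bump : mu.-integrable setT (EFin \o bump).
Proof.
have := integrable_bumpM (@ctsC R R 1).
by apply: eq_integrable => // x _ /=; rewrite mulr1.
Qed.

(** [bump] is even, so its Fourier transform reduces to the cosine. *)
Definition bump_hat (s : R) : R := \int[mu]_x (bump x * cos (s * x)).

Lemma continuous_cosM (s : R) : continuous (fun x : R => cos (s * x)).
Proof.
apply: cts_comp; first exact: continuous_cos.
by apply: ctsM; [exact: ctsC|exact: cts_id].
Qed.

Lemma continuous_sinM (s : R) : continuous (fun x : R => sin (s * x)).
Proof.
apply: cts_comp; first exact: continuous_sin.
by apply: ctsM; [exact: ctsC|exact: cts_id].
Qed.

Let NLL : - L < L. Proof. by rewrite gtrN. Qed.

Lemma bump_sin_eq0 (s : R) : \int[mu]_x (bump x * sin (s * x)) = 0.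
Proof.
have [->|s0] := eqVneq s 0.
  under eq_Rintegral do rewrite mul0r sin0 mulr0.
  by rewrite /Rintegral integral0.
pose F (x : R) := (- s^-1) * ((L ^+ 2 + (-1) * (x * x)) * cos (s * x)) +
   ((- 2 / s ^+ 2) * (x * sin (s * x)) + (- 2 / s ^+ 3) * cos (s * x)).
have dF (x : R) : is_derive x 1 F ((L ^+ 2 - x ^+ 2) * sin (s * x)).
  apply: is_derive_eq; rewrite /GRing.scale /=.
  by field.
rewrite Rintegral_bumpM (Rintegral_FTC NLL dF).
  by rewrite /F !mulrN cosN sinN; ring.
exact/continuous_quadM/continuous_sinM.
Qed.

Definition decay_cst : R := 8 * L + 8 + 4 * L ^+ 3.

Lemma decay_cst_ge0 : 0 <= decay_cst.
Proof. by rewrite /decay_cst !addr_ge0// ?mulr_ge0// ?exprn_ge0// ltW. Qed.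

(** For [`|s| <= 1] the mass of the weight is a sufficient bound; for [`|s| > 1]
    the integral is [4 * (sin (s * L) - s * L * cos (s * L)) / s ^ 3]. *)
Lemma bump_hat_decay s : `|bump_hat s| <= decay_cst / (1 + s ^+ 2).
Proof.
have s21 : 0 < 1 + s ^+ 2 by rewrite ltr_pwDl// sqr_ge0.
have [s1|s1] := leP `|s| 1.
  have h1 : `|bump_hat s| <= 2 * L ^+ 3.
    apply: (@le_trans _ _ (\int[mu]_x (bump x * 1))).
      apply: Rintegral_le_dominated.
      - apply: measurable_funM.
          exact: continuous_measurable_fun continuous_bump.
        exact: continuous_measurable_fun (@continuous_cosM s).
      - exact: integrable_bumpM (@ctsC R R 1).
      - move=> x; rewrite normrM (ger0_norm (bump_ge0 x)).
        by rewrite ler_wpM2l ?bump_ge0// ler_norml cos_geN1 cos_le1.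
    rewrite Rintegral_bumpM.
    apply: (@le_trans _ _ (\int[mu]_(x in `[- L, L]) (L ^+ 2))).
      apply: le_Rintegral => //.
      - exact: integrable_continuous_itv (continuous_quadM (@ctsC R R 1)).
      - exact: integrable_continuous_itv (@ctsC _ _ _).
      - by move=> x _; rewrite mulr1 gerBl sqr_ge0.
    rewrite Rintegral_cst//= lebesgue_measure_itv/= lte_fin NLL/=.
    by rewrite le_eqVlt; apply/orP; left; apply/eqP; ring.
  rewrite ler_pdivlMr//.
  have s2 : s ^+ 2 <= 1 by rewrite -(real_normK (num_real s)) expr_le1.
  have L30 : 0 <= L ^+ 3 by rewrite exprn_ge0// ltW.
  apply: (@le_trans _ _ ((2 * L ^+ 3) * 2)).
    by apply: ler_pM => //; [rewrite ltW|lra].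
  by rewrite /decay_cst; move: L0 L30; nra.
have s0 : s != 0 by apply: contraTneq s1 => ->; rewrite normr0 ltr10.
have as0 : 0 < `|s| by rewrite normr_gt0.
pose F (x : R) := s^-1 * ((L ^+ 2 + (-1) * (x * x)) * sin (s * x)) +
   ((- 2 / s ^+ 2) * (x * cos (s * x)) + (2 / s ^+ 3) * sin (s * x)).
have dF (x : R) : is_derive x 1 F ((L ^+ 2 - x ^+ 2) * cos (s * x)).
  apply: is_derive_eq; rewrite /GRing.scale /=.
  by field.
rewrite /bump_hat Rintegral_bumpM (Rintegral_FTC NLL dF); last first.
  exact/continuous_quadM/continuous_cosM.
have -> : F L - F (- L) =
    (- 4 * L / s ^+ 2) * cos (s * L) + (4 / s ^+ 3) * sin (s * L).
  by rewrite /F !mulrN cosN sinN; field.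
have c1 : `|cos (s * L)| <= 1 by rewrite ler_norml cos_geN1 cos_le1.
have c2 : `|sin (s * L)| <= 1 by rewrite ler_norml sin_geN1 sin_le1.
have s2 : 1 <= s ^+ 2 by rewrite -(real_normK (num_real s)) exprn_ege1// ltW.
have s2p : 0 < s ^+ 2 by lra.
apply: (@le_trans _ _ (4 * L / s ^+ 2 + 4 / s ^+ 2)).
  apply: le_trans (ler_normD _ _) _; rewrite !normrM lerD//.
    rewrite normrN (ger0_norm (ltW L0)) normrV ?unitfE ?expf_neq0//.
    rewrite (ger0_norm (ltW s2p)) (@ger0_norm _ 4)//.
    by rewrite ler_piMr// !mulr_ge0// ?invr_ge0 ltW.
  rewrite normrV ?unitfE ?expf_neq0// (@ger0_norm _ 4)// normrX.
  apply: (@le_trans _ _ (4 / `|s| ^+ 3 * 1)).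
    by rewrite ler_wpM2l// mulr_ge0// invr_ge0 exprn_ge0.
  rewrite mulr1 ler_wpM2l// -(real_normK (num_real s)) lef_pV2 ?posrE ?exprn_gt0//.
  by rewrite [leRHS]exprS ler_peMl ?exprn_ge0// ltW.
rewrite -mulrDl ler_pdivrMr// mulrAC ler_pdivlMr// /decay_cst.
have L30 : 0 <= L ^+ 3 by rewrite exprn_ge0// ltW.
by move: L0 L30 s2; nra.
Qed.

End frequency_weight.

Section lorentzian.
Context {R : realType}.
Local Notation mu := (@lebesgue_measure R).

Lemma Rintegral_lorentzian_le (C B s x : R) : 0 <= C -> 0 < B -> s != 0 ->
  \int[mu]_(y in `[- B, B]) (C / (1 + (s * (x - y)) ^+ 2)) <= C * pi / `|s|.
Proof.
move=> C0 B0 s0.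
pose F (y : R) := (- C / s) * atan (s * (x + (-1) * y)).
have pos y : 0 < 1 + (s * (x - y)) ^+ 2 by rewrite ltr_pwDl// sqr_ge0.
have dF (y : R) : is_derive y 1 F (C / (1 + (s * (x - y)) ^+ 2)).
  apply: is_derive_eq; rewrite /GRing.scale /=.
  have -> : s * (x + -1 * y) = s * (x - y) by ring.
  by have := lt0r_neq0 (pos y) => py; field; rewrite s0 py.
have NBB : - B < B by rewrite gtrN.
rewrite (Rintegral_FTC NBB dF); last first.
  apply: ctsM; first exact: ctsC.
  have cD : continuous (fun y : R => 1 + (s * (x - y)) ^+ 2).
    apply: ctsD; first exact: ctsC.
    apply: ctsX; apply: ctsM; first exact: ctsC.
    by apply: ctsB; [exact: ctsC|exact: cts_id].
  by move=> y; apply: cvgV; [rewrite gt_eqF|exact: cD].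
have ha t : `|atan t| <= pi / 2 :> R.
  by rewrite ler_norml !ltW ?atan_gtNpi2 ?atan_ltpi2.
apply: le_trans (ler_norm _) _; apply: le_trans (ler_normB _ _) _.
rewrite /F !normrM !normrN normfV (ger0_norm C0) -mulrDr.
rewrite mulrAC -[leRHS]mulrA [leRHS]mulrCA mulrA [leRHS]mulrC mulrC.
apply: ler_wpM2r; first by rewrite invr_ge0.
rewrite [leRHS]mulrC; apply: ler_wpM2l => //.
by rewrite [leRHS](splitr pi) lerD.
Qed.

End lorentzian.

(** * Dot products, boxes and the weight in several variables *)

Section dot_product.
Context {R : realType}.

Lemma measurable_rV_coordT d (T : measurableType d) n (f : T -> 'rV[R]_n) j :
  measurable_fun setT f -> measurable_fun setT (fun t => f t ord0 j).
Proof. by move=> mf; exact: (measurableT_comp (measurable_rV_coord j) mf). Qed.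

Lemma measurable_dotR d (T : measurableType d) n (f g : T -> 'rV[R]_n) :
  measurable_fun setT f -> measurable_fun setT g ->
  measurable_fun setT (fun t => dotR (f t) (g t)).
Proof.
move=> mf mg; apply: measurable_sum => i.
by apply: measurable_funM; exact: measurable_rV_coordT.
Qed.

Lemma continuous_dotR n (s : 'rV[R]_n) : continuous (dotR s).
Proof.
apply: cts_sum => i; apply: ctsM; first exact: ctsC.
by move=> x; exact: coord_continuous.
Qed.

Lemma dotR_cons n (s : 'rV[R]_n.+1) t (y : 'rV[R]_n) :
  dotR s (rV_cons (t, y)) =
  s ord0 ord0 * t + dotR (\row_i s ord0 (lift ord0 i)) y.
Proof.
rewrite /dotR big_ord_recl rV_cons0; congr (_ + _).
by apply: eq_bigr => i _; rewrite rV_consS mxE.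
Qed.

Lemma dotRC n (x y : 'rV[R]_n) : dotR x y = dotR y x.
Proof. by apply: eq_bigr => i _; rewrite mulrC. Qed.

Lemma dotRD n (x y z : 'rV[R]_n) : dotR (x + y) z = dotR x z + dotR y z.
Proof. by rewrite /dotR -big_split; apply: eq_bigr => i _; rewrite mxE mulrDl. Qed.

Lemma dotRZ n a (x z : 'rV[R]_n) : dotR (a *: x) z = a * dotR x z.
Proof. by rewrite /dotR mulr_sumr; apply: eq_bigr => i _; rewrite mxE mulrA. Qed.

Lemma dotRN n (x z : 'rV[R]_n) : dotR (- x) z = - dotR x z.
Proof. by rewrite -scaleN1r dotRZ mulN1r. Qed.

Lemma dotRB n (x y z : 'rV[R]_n) : dotR (x - y) z = dotR x z - dotR y z.
Proof. by rewrite dotRD dotRN. Qed.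

End dot_product.

Section boxes.
Context {R : realType}.
Local Notation leb n := (lebesgue_rV n : {measure set 'rV[R]_n -> \bar R}).

Definition box n (B : R) : set 'rV[R]_n := [set x | forall i, `|x ord0 i| <= B].

Definition box1 n (B : R) (x : 'rV[R]_n) : R :=
  \prod_(i < n) \1_(`[- B, B]%classic) (x ord0 i).

Lemma box1_ge0 n B (x : 'rV[R]_n) : 0 <= box1 B x.
Proof. by apply: prodr_ge0 => i _; rewrite indicE. Qed.

Lemma box1_in n B (x : 'rV[R]_n) : box B x -> box1 B x = 1.
Proof.
move=> xB; rewrite /box1 big1// => i _.
by rewrite indicE mem_setE in_itv/= -ler_norml xB.
Qed.

Lemma box1_out n B (x : 'rV[R]_n) : ~ box B x -> box1 B x = 0.
Proof.
move=> /existsNP[i xi]; rewrite /box1 (bigD1 i)//= indicE mem_setE in_itv/=.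
by rewrite -ler_norml; move/negP/negbTE : xi => ->; rewrite mul0r.
Qed.

Lemma box1_le1 n B (x : 'rV[R]_n) : box1 B x <= 1.
Proof.
by have [/box1_in ->|/box1_out ->] := pselect (box B x); rewrite ?ler01.
Qed.

Lemma integrable_indic_seg (B : R) :
  (@lebesgue_measure R).-integrable setT (EFin \o \1_(`[- B, B]%classic)).
Proof. exact: integrable_indic_itv. Qed.

Lemma integrable_box1 n B : (leb n).-integrable setT (EFin \o (@box1 n B)).
Proof.
exact: (integrable_Rintegral_prod (fun=> integrable_indic_seg B)).1.
Qed.

Lemma measurable_box1 n B : measurable_fun setT (@box1 n B).
Proof. by apply/measurable_EFinP; exact: measurable_int (@integrable_box1 n B). Qed.

Lemma Rintegral_box1 n (B : R) : 0 <= B -> \int[leb n]_x box1 B x = (2 * B) ^+ n.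
Proof.
move=> B0; rewrite (integrable_Rintegral_prod (fun=> integrable_indic_seg B)).2.
rewrite -[in RHS](card_ord n) -prodr_const; apply: eq_bigr => i _.
transitivity (fine (@lebesgue_measure R `[- B, B]%classic)).
  by congr fine; rewrite integral_indic ?setIT.
rewrite lebesgue_measure_itv/= lte_fin.
have [|] := ltP (- B) B => H /=; first by ring.
have -> : B = 0 by apply/eqP; rewrite eq_le B0 andbT; lra.
by rewrite mulr0.
Qed.

End boxes.

Section weighted_plancherel.
Context {R : realType}.
Local Notation leb n := (lebesgue_rV n : {measure set 'rV[R]_n -> \bar R}).
Variables (L : R) (L0 : 0 < L).

Definition bumpn n (x : 'rV[R]_n) : R := \prod_(i < n) bump L (x ord0 i).

Lemma bumpn_ge0 n (x : 'rV[R]_n) : 0 <= bumpn x.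
Proof. by apply: prodr_ge0 => i _; exact: bump_ge0. Qed.

Lemma bumpn_cons n t (y : 'rV[R]_n) :
  bumpn (rV_cons (t, y)) = bump L t * bumpn y.
Proof. exact: (prod_rV_cons (fun=> bump L)). Qed.

Lemma integrable_bumpn n : (leb n).-integrable setT (EFin \o (@bumpn n)).
Proof. exact: (integrable_Rintegral_prod (fun=> integrable_bump L0)).1. Qed.

Lemma measurable_bumpn n : measurable_fun setT (@bumpn n).
Proof. by apply/measurable_EFinP; exact: measurable_int (@integrable_bumpn n). Qed.

Lemma normr_cos_le1 (t : R) : `|cos t| <= 1.
Proof. by rewrite ler_norml cos_geN1 cos_le1. Qed.

Lemma normr_sin_le1 (t : R) : `|sin t| <= 1.
Proof. by rewrite ler_norml sin_geN1 sin_le1. Qed.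

Lemma measurable_cosR : measurable_fun setT (@cos R).
Proof. exact: continuous_measurable_fun (@continuous_cos R). Qed.

Lemma measurable_sinR : measurable_fun setT (@sin R).
Proof. exact: continuous_measurable_fun (@continuous_sin R). Qed.

(** The phase [theta] makes the statement inductive: with the first coordinate
    [t] frozen, [s0 * t] joins the phase, and the sine that the addition formula
    then creates integrates to 0 against the even weight. *)
Lemma Rintegral_bumpn_cos n theta (s : 'rV[R]_n) :
  \int[leb n]_x (bumpn x * cos (theta + dotR s x)) =
  cos theta * \prod_(i < n) bump_hat L (s ord0 i).
Proof.
elim: n theta s => [|n IH] theta s.
  rewrite Rintegral_lebesgue_rV0 /bumpn /dotR ?big_ord0 ?addr0 ?mul1r ?mulr1//.
  apply: measurable_funM; first exact: measurable_bumpn.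
  apply: (measurableT_comp measurable_cosR); apply: measurable_funD => //.
  by apply: measurable_dotR => //; exact: measurable_cst.
have m1 : measurable_fun setT
    (fun x : 'rV[R]_n.+1 => bumpn x * cos (theta + dotR s x)).
  apply: measurable_funM; first exact: measurable_bumpn.
  apply: (measurableT_comp measurable_cosR); apply: measurable_funD => //.
  by apply: measurable_dotR => //; exact: measurable_cst.
rewrite (Rintegral_lebesgue_rVS m1 (integrable_bump L0) (@integrable_bumpn n));
  first last.
- move=> t y; rewrite bumpn_cons normrM -[leRHS]mulr1 ler_pM//.
    by rewrite ger0_norm// mulr_ge0 ?bump_ge0 ?bumpn_ge0.
  exact: normr_cos_le1.
- by move=> y; exact: bumpn_ge0.
- by move=> t; exact: bump_ge0.
set s' := \row_i s ord0 (lift ord0 i).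
set K := \prod_(i < n) bump_hat L (s' ord0 i).
set s0 := s ord0 ord0.
transitivity (\int[@lebesgue_measure R]_t
    (K * cos theta * (bump L t * cos (s0 * t)) +
     (- (K * sin theta)) * (bump L t * sin (s0 * t)))).
  apply: eq_Rintegral => t _.
  transitivity (bump L t * \int[leb n]_y
      (bumpn y * cos ((theta + s0 * t) + dotR s' y))).
    rewrite -RintegralZl//.
      apply: eq_Rintegral => y _.
      by rewrite bumpn_cons dotR_cons addrA mulrA.
    apply: integrable_dominated (@integrable_bumpn n) _ => //.
      apply: measurable_funM; first exact: measurable_bumpn.
      apply: (measurableT_comp measurable_cosR); apply: measurable_funD => //.
      by apply: measurable_dotR => //; exact: measurable_cst.
    move=> y _; rewrite normrM ger0_norm ?bumpn_ge0//.
    by rewrite ler_piMr ?bumpn_ge0// normr_cos_le1.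
  by rewrite IH -/K cosD; ring.
have ib (g : R -> R) c : continuous g ->
    (@lebesgue_measure R).-integrable setT (EFin \o (fun t => c * (bump L t * g t))).
  move=> cg; exact: integrableZR (integrable_bumpM L0 cg).
rewrite RintegralD//; first last.
- by apply: ib; exact: continuous_sinM.
- by apply: ib; exact: continuous_cosM.
rewrite !RintegralZl//; first last.
- by apply: integrable_bumpM => //; exact: continuous_cosM.
- by apply: integrable_bumpM => //; exact: continuous_sinM.
rewrite bump_sin_eq0// mulr0 addr0 big_ord_recl -/(bump_hat L s0) -/s0.
rewrite (_ : \prod_(i < n) _ = K); first by ring.
by apply: eq_bigr => i _; rewrite mxE.
Qed.

End weighted_plancherel.

(** * A Plancherel inequality with a frequency weight *)

Section real_plancherel.
Context {R : realType} (n : nat).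
Local Notation leb := (lebesgue_rV n : {measure set 'rV[R]_n -> \bar R}).
Local Notation lebs := (lebesgue_rV n).
Variables (L B s : R) (L0 : 0 < L) (B0 : 0 < B) (s0 : s != 0).
Variable alpha : 'rV[R]_n -> R.
Hypotheses (malpha : measurable_fun setT alpha)
  (ialpha2 : leb.-integrable setT (EFin \o (fun x => alpha x ^+ 2)))
  (alpha_box : forall x, ~ box B x -> alpha x = 0).

Lemma L2_box_integrable : leb.-integrable setT (EFin \o alpha).
Proof.
have H := integrableD measurableT (integrable_box1 n B) ialpha2.
apply: (@integrable_dominated _ _ _ _ _ _ (fun x => box1 B x + alpha x ^+ 2)) => //.
move=> x _; have [xB|/alpha_box ->] := pselect (box B x); last first.
  by rewrite normr0 addr_ge0 ?box1_ge0 ?sqr_ge0.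
rewrite box1_in// -(real_normK (num_real (alpha x))).
have := sqr_ge0 (`|alpha x| - 1); have := normr_ge0 (alpha x); nra.
Qed.

Let ia := L2_box_integrable.

Let mcos (xi : 'rV[R]_n) : measurable_fun setT (fun x => cos (s * dotR x xi) * alpha x).
Proof.
apply: measurable_funM => //; apply: (measurableT_comp measurable_cosR).
by apply: measurable_funM => //; apply: measurable_dotR => //; exact: measurable_cst.
Qed.

Let msin (xi : 'rV[R]_n) : measurable_fun setT (fun x => sin (s * dotR x xi) * alpha x).
Proof.
apply: measurable_funM => //; apply: (measurableT_comp measurable_sinR).
by apply: measurable_funM => //; apply: measurable_dotR => //; exact: measurable_cst.
Qed.

Let icos (xi : 'rV[R]_n) :
  leb.-integrable setT (EFin \o (fun x => cos (s * dotR x xi) * alpha x)).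
Proof.
apply: integrable_dominated (integrable_norm ia) _ => // x _ /=.
by rewrite normrM ler_piMl// normr_cos_le1.
Qed.

Let isin (xi : 'rV[R]_n) :
  leb.-integrable setT (EFin \o (fun x => sin (s * dotR x xi) * alpha x)).
Proof.
apply: integrable_dominated (integrable_norm ia) _ => // x _ /=.
by rewrite normrM ler_piMl// normr_sin_le1.
Qed.

Definition cosT (xi : 'rV[R]_n) : R := \int[leb]_x (cos (s * dotR x xi) * alpha x).
Definition sinT (xi : 'rV[R]_n) : R := \int[leb]_x (sin (s * dotR x xi) * alpha x).

Let g (xi x y : 'rV[R]_n) : R :=
  bumpn L xi * (alpha x * alpha y * cos (s * (dotR x xi - dotR y xi))).

Let int_y_g xi x : \int[leb]_y g xi x y =
  bumpn L xi * (cosT xi * (cos (s * dotR x xi) * alpha x)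
    + sinT xi * (sin (s * dotR x xi) * alpha x)).
Proof.
transitivity (\int[leb]_y
   ((bumpn L xi * (cos (s * dotR x xi) * alpha x)) * (cos (s * dotR y xi) * alpha y) +
   (bumpn L xi * (sin (s * dotR x xi) * alpha x)) * (sin (s * dotR y xi) * alpha y))).
  by apply: eq_Rintegral => y _; rewrite /g mulrBr cosB; ring.
rewrite RintegralD//; first last.
- exact: integrableZR (isin xi).
- exact: integrableZR (icos xi).
by rewrite !RintegralZl// -/(cosT xi) -/(sinT xi); ring.
Qed.

Let int_xy_g xi : \int[leb]_x \int[leb]_y g xi x y =
  bumpn L xi * (cosT xi ^+ 2 + sinT xi ^+ 2).
Proof.
under eq_Rintegral do rewrite int_y_g.
have i1 : leb.-integrable setT (EFin \o (fun x => cosT xi * (cos (s * dotR x xi) * alpha x))).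
  exact: integrableZR (icos xi).
have i2 : leb.-integrable setT (EFin \o (fun x => sinT xi * (sin (s * dotR x xi) * alpha x))).
  exact: integrableZR (isin xi).
rewrite RintegralZl//; last first.
  exact: integrableDR i1 i2.
by rewrite RintegralD// !RintegralZl.
Qed.

(** The kernel left once the frequency has been integrated out. *)
Let kern (x y : 'rV[R]_n) : R :=
  \prod_(i < n) bump_hat L (s * (x ord0 i - y ord0 i)).

Let int_xi_g x y : \int[leb]_xi g xi x y = alpha x * alpha y * kern x y.
Proof.
have -> : kern x y = \int[leb]_xi (bumpn L xi * cos (0 + dotR (s *: (x - y)) xi)).
  by rewrite (Rintegral_bumpn_cos L0) cos0 mul1r; apply: eq_bigr => i _; rewrite !mxE.
rewrite -RintegralZl//.
  by apply: eq_Rintegral => xi _; rewrite /g add0r dotRZ dotRB; ring.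
apply: integrable_dominated (@integrable_bumpn R L L0 n) _ => //.
  apply: measurable_funM; first exact: measurable_bumpn.
  apply: (measurableT_comp measurable_cosR); apply: measurable_funD => //.
  by apply: measurable_dotR => //; exact: measurable_cst.
move=> xi _; rewrite normrM ger0_norm ?bumpn_ge0//.
by rewrite ler_piMr ?bumpn_ge0// normr_cos_le1.
Qed.

Let g_le xi x y : `|g xi x y| <= bumpn L xi * (`|alpha x| * `|alpha y|).
Proof.
rewrite /g normrM ger0_norm ?bumpn_ge0// ler_wpM2l ?bumpn_ge0//.
by rewrite normrM normrM ler_piMr ?mulr_ge0// normr_cos_le1.
Qed.

Let mg : measurable_fun setT
  (fun z : ('rV[R]_n * 'rV[R]_n) * 'rV[R]_n => g z.1.1 z.1.2 z.2).
Proof.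
have m1 : measurable_fun setT (fun z : ('rV[R]_n * 'rV[R]_n) * 'rV[R]_n => z.1.1).
  exact: (measurableT_comp measurable_fst measurable_fst).
have m2 : measurable_fun setT (fun z : ('rV[R]_n * 'rV[R]_n) * 'rV[R]_n => z.1.2).
  exact: (measurableT_comp measurable_snd measurable_fst).
have m3 : measurable_fun setT (fun z : ('rV[R]_n * 'rV[R]_n) * 'rV[R]_n => z.2).
  exact: measurable_snd.
apply: measurable_funM; first exact: (measurableT_comp (@measurable_bumpn R L L0 n) m1).
apply: measurable_funM.
  by apply: measurable_funM; [exact: (measurableT_comp malpha m2)|
    exact: (measurableT_comp malpha m3)].
apply: (measurableT_comp measurable_cosR); apply: measurable_funM => //.
by apply: measurable_funB; apply: measurable_dotR.
Qed.

Let A := \int[leb]_x `|alpha x|.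

Let swap_g : \int[leb]_xi \int[leb]_x \int[leb]_y g xi x y =
  \int[leb]_x \int[leb]_y (alpha x * alpha y * kern x y).
Proof.
have A0 : 0 <= A by apply: Rintegral_ge0.
rewrite (@Rintegral_swap _ _ _ _ _ lebs lebs
  (fun z : 'rV[R]_n * 'rV[R]_n => \int[leb]_y g z.1 z.2 y)
  (@bumpn R L n) (fun x => A * `|alpha x|)); first last.
- move=> xi x /=; apply: (@le_trans _ _ (\int[leb]_y
    ((bumpn L xi * `|alpha x|) * `|alpha y|))).
    apply: Rintegral_le_dominated.
    + exact: (measurableT_comp mg (measurable_pair1 (xi, x))).
    + exact/integrableZR/integrable_norm.
    + by move=> y; rewrite -mulrA; exact: g_le.
  rewrite RintegralZl//; last exact: integrable_norm.
  by rewrite -/A -mulrA (mulrC _ A).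
- by move=> x; rewrite mulr_ge0.
- exact: bumpn_ge0.
- exact/integrableZR/integrable_norm.
- exact: integrable_bumpn.
- exact: (measurable_Rintegral2 lebs mg).
apply: eq_Rintegral => x _.
rewrite (@Rintegral_swap _ _ _ _ _ lebs lebs
  (fun z : 'rV[R]_n * 'rV[R]_n => g z.1 x z.2)
  (@bumpn R L n) (fun y => `|alpha x| * `|alpha y|)); first last.
- by move=> xi y; exact: g_le.
- by move=> y; rewrite mulr_ge0.
- exact: bumpn_ge0.
- exact/integrableZR/integrable_norm.
- exact: integrable_bumpn.
- have mm : measurable_fun setT (fun z : 'rV[R]_n * 'rV[R]_n => ((z.1, x), z.2)).
    apply/measurable_fun_pair; last exact: measurable_snd.
    by apply/measurable_fun_pair; [exact: measurable_fst|exact: measurable_cst].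
  exact: (measurableT_comp mg mm).
by apply: eq_Rintegral => y _; rewrite int_xi_g.
Qed.

Let D := decay_cst L.
Let maj (x y : 'rV[R]_n) : R :=
  \prod_(i < n) (D / (1 + (s * (x ord0 i - y ord0 i)) ^+ 2)).

Let D0 : 0 <= D. Proof. exact: decay_cst_ge0. Qed.

Let den_gt0 (t : R) : 0 < 1 + t ^+ 2.
Proof. by rewrite ltr_pwDl// sqr_ge0. Qed.

Let kern_maj x y : `|kern x y| <= maj x y.
Proof.
rewrite normr_prod; apply: ler_prod => i _; rewrite normr_ge0/=.
exact: bump_hat_decay.
Qed.

Let maj_ge0 x y : 0 <= maj x y.
Proof. by apply: prodr_ge0 => i _; rewrite divr_ge0// ltW. Qed.

Let maj_le x y : maj x y <= D ^+ n.
Proof.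
rewrite -[X in D ^+ X]card_ord -prodr_const; apply: ler_prod => i _.
set t := s * _; rewrite (divr_ge0 D0 (ltW (den_gt0 t)))/=.
rewrite (ler_pdivrMr _ _ (den_gt0 t)).
by apply: ler_peMr; [exact: D0|rewrite lerDl; exact: sqr_ge0].
Qed.

Let majC x y : maj x y = maj y x.
Proof. by apply: eq_bigr => i _; rewrite -(opprB (y ord0 i)) mulrN sqrrN. Qed.

Let mmaj : measurable_fun setT (fun z : 'rV[R]_n * 'rV[R]_n => maj z.1 z.2).
Proof.
apply: measurable_prod => i _; apply: measurable_funM => //.
have mz : measurable_fun setT (fun z : 'rV[R]_n * 'rV[R]_n =>
    1 + (s * (z.1 ord0 i - z.2 ord0 i)) ^+ 2).
  apply: measurable_funD; first exact: measurable_cst.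
  apply: measurable_funX; apply: measurable_funM; first exact: measurable_cst.
  apply: measurable_funB; apply: measurable_rV_coordT.
    exact: measurable_fst.
  exact: measurable_snd.
have ci : continuous (fun t : R => (1 + t ^+ 2)^-1).
  have cD : continuous (fun t : R => 1 + t ^+ 2).
    by apply: ctsD; [exact: ctsC|apply/ctsX/cts_id].
  by move=> t; apply: cvgV; [rewrite gt_eqF|exact: cD].
have mt : measurable_fun setT (fun z : 'rV[R]_n * 'rV[R]_n =>
    s * (z.1 ord0 i - z.2 ord0 i)).
  apply: measurable_funM; first exact: measurable_cst.
  apply: measurable_funB; apply: measurable_rV_coordT.
    exact: measurable_fst.
  exact: measurable_snd.
exact: (measurableT_comp (continuous_measurable_fun ci) mt).
Qed.

Let E := (D * pi / `|s|) ^+ n.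

Let int_maj x : \int[leb]_y (maj x y * box1 B y) <= E.
Proof.
pose h i (t : R) := D / (1 + (s * (x ord0 i - t)) ^+ 2) * \1_(`[- B, B]%classic) t.
have ch i : continuous (fun t : R => D / (1 + (s * (x ord0 i - t)) ^+ 2)).
  apply: ctsM; first exact: ctsC.
  have cD : continuous (fun t : R => 1 + (s * (x ord0 i - t)) ^+ 2).
    apply: ctsD; first exact: ctsC.
    apply: ctsX; apply: ctsM; first exact: ctsC.
    by apply: ctsB; [exact: ctsC|exact: cts_id].
  by move=> y; apply: cvgV; [rewrite gt_eqF|exact: cD].
have hE i t : h i t = ((fun t => D / (1 + (s * (x ord0 i - t)) ^+ 2)) \_ `[- B, B]) t.
  by rewrite /h /patch indicE; case: ifP => _; rewrite ?mulr1 ?mulr0.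
have ih i : (@lebesgue_measure R).-integrable setT (EFin \o h i).
  have /integrable_mkcond := integrable_continuous_itv (- B) B (ch i).
  move=> /(_ (measurable_itv _)); apply: eq_integrable => // t _ /=.
  by rewrite hE /patch; case: ifP.
have [_ Eh] := integrable_Rintegral_prod ih.
rewrite (_ : \int[leb]_y _ = \int[leb]_y (\prod_(i < n) h i (y ord0 i))); last first.
  by apply: eq_Rintegral => y _; rewrite /maj /box1 -big_split.
rewrite Eh /E -[X in _ ^+ X]card_ord -prodr_const; apply: ler_prod => i _.
rewrite Rintegral_ge0 ?andTb; last first.
  by move=> t _; rewrite /h mulr_ge0 ?divr_ge0 ?(ltW (den_gt0 _))// indicE.
under eq_Rintegral do rewrite hE.
rewrite -Rintegral_mkcond; exact: Rintegral_lorentzian_le.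
Qed.

Let mmajl (x : 'rV[R]_n) : measurable_fun setT (maj x).
Proof. exact: (measurableT_comp mmaj (measurable_pair1 x)). Qed.

Let ip : leb.-integrable setT (EFin \o (fun y => D ^+ n * box1 B y)).
Proof. exact/integrableZR/integrable_box1. Qed.

(** One of the two halves of the Schur test; the other one is its mirror image
    [F2], as [maj] is symmetric. *)
Let F1 (z : 'rV[R]_n * 'rV[R]_n) := alpha z.1 ^+ 2 * (maj z.1 z.2 * box1 B z.2).

Let mF1 : measurable_fun setT F1.
Proof.
have mb : measurable_fun setT (@box1 R n B) := @measurable_box1 R n B.
apply: measurable_funM.
  apply: measurable_funX; exact: (measurableT_comp malpha measurable_fst).
by apply: measurable_funM => //; exact: (measurableT_comp mb measurable_snd).
Qed.

Let F1_le x y : `|F1 (x, y)| <= alpha x ^+ 2 * (D ^+ n * box1 B y).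
Proof.
rewrite ger0_norm; last by rewrite mulr_ge0 ?sqr_ge0 ?mulr_ge0 ?box1_ge0.
by rewrite ler_wpM2l ?sqr_ge0// ler_wpM2r ?box1_ge0.
Qed.

Let q0 (y : 'rV[R]_n) : 0 <= D ^+ n * box1 B y.
Proof. by rewrite mulr_ge0 ?exprn_ge0 ?box1_ge0. Qed.

Let schur_half : \int[leb]_x \int[leb]_y F1 (x, y) <= E * \int[leb]_x (alpha x ^+ 2).
Proof.
rewrite -(RintegralZl E measurableT ialpha2); apply: le_Rintegral.
- exact: measurableT.
- exact: (@integrable_Rintegral2 _ _ _ _ _ lebs lebs F1 _ _ mF1 ialpha2 ip F1_le).
- exact: integrableZR.
- move=> x _.
  have im : leb.-integrable setT (EFin \o (fun y => maj x y * box1 B y)).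
    apply: (integrable_dominated measurableT _ ip).
      by apply: measurable_funM => //; exact: measurable_box1.
    move=> y _; rewrite (ger0_norm (mulr_ge0 (maj_ge0 x y) (box1_ge0 B y))).
    exact: (ler_wpM2r (box1_ge0 B y) (maj_le x y)).
  have -> : \int[leb]_y F1 (x, y) = alpha x ^+ 2 * \int[leb]_y (maj x y * box1 B y).
    by rewrite -(RintegralZl (alpha x ^+ 2) measurableT im).
  by rewrite mulrC; apply: ler_wpM2r; [exact: sqr_ge0|exact: int_maj].
Qed.

(** The square of the transform is the double integral of
    [alpha x * alpha y * cos (s * dotR (x - y) xi)]. Integrating first in [xi]
    against the weight turns the cosine into [kern x y], which a product of
    Lorentzians dominates. Their mass in each variable is [D * pi / `|s|], so the
    Schur test [alpha x * alpha y <= (alpha x ^ 2 + alpha y ^ 2) / 2] gives the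
    bound, with the expected power of [s]. Only an upper bound is at stake, and
    no inversion formula enters. *)
Theorem weighted_plancherel :
  \int[leb]_xi (bumpn L xi * (cosT xi ^+ 2 + sinT xi ^+ 2)) <=
  (decay_cst L * pi / `|s|) ^+ n * \int[leb]_x (alpha x ^+ 2).
Proof.
under eq_Rintegral do rewrite -int_xy_g.
rewrite swap_g.
pose F2 (z : 'rV[R]_n * 'rV[R]_n) := F1 (z.2, z.1).
have mF2 : measurable_fun setT F2.
  apply: (measurableT_comp mF1); apply/measurable_fun_pair.
    exact: measurable_snd.
  exact: measurable_fst.
have F2_le x y : `|F2 (x, y)| <= (D ^+ n * box1 B x) * alpha y ^+ 2.
  by rewrite /F2/= mulrC; exact: F1_le.
have s1 x : leb.-integrable setT (EFin \o (fun y => F1 (x, y))).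
  exact: (dominated_section_integrable mF1 ip F1_le).
have s2 x : leb.-integrable setT (EFin \o (fun y => F2 (x, y))).
  exact: (dominated_section_integrable mF2 ialpha2 F2_le).
have j1 : leb.-integrable setT (EFin \o (fun x => \int[leb]_y F1 (x, y))).
  exact: (integrable_Rintegral2 mF1 ialpha2 ip F1_le).
have j2 : leb.-integrable setT (EFin \o (fun x => \int[leb]_y F2 (x, y))).
  exact: (integrable_Rintegral2 mF2 ip ialpha2 F2_le).
have j12 : leb.-integrable setT (EFin \o (fun x =>
    2^-1 * (\int[leb]_y F1 (x, y) + \int[leb]_y F2 (x, y)))).
  apply: integrableZR; exact: integrableDR j1 j2.
have msk : measurable_fun setT (fun z : 'rV[R]_n * 'rV[R]_n =>
    alpha z.1 * alpha z.2 * kern z.1 z.2).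
  apply: measurable_funM.
    by apply: measurable_funM; [exact: (measurableT_comp malpha measurable_fst)|
      exact: (measurableT_comp malpha measurable_snd)].
  apply: measurable_prod => i _.
  have mh : measurable_fun setT (bump_hat L).
    have mbc : measurable_fun setT (fun z : R * R => bump L z.2 * cos (z.1 * z.2)).
      apply: measurable_funM.
        apply: (measurableT_comp (f := bump L)); last exact: measurable_snd.
        exact: continuous_measurable_fun (@continuous_bump R L).
      apply: (measurableT_comp measurable_cosR).
      by apply: measurable_funM; [exact: measurable_fst|exact: measurable_snd].
    exact: (measurable_Rintegral2 (@lebesgue_measure R) mbc).
  apply: (measurableT_comp mh); apply: measurable_funM => //.
  by apply: measurable_funB; apply: measurable_rV_coordT.
have F1_ge0 z : 0 <= F1 z.
  apply: mulr_ge0; first exact: sqr_ge0.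
  exact: (mulr_ge0 (maj_ge0 _ _) (box1_ge0 _ _)).
have half_ge0 x y : 0 <= 2^-1 * (F1 (x, y) + F2 (x, y)).
  by apply: mulr_ge0; [rewrite invr_ge0|exact: (addr_ge0 (F1_ge0 _) (F1_ge0 _))].
have pt x y : `|alpha x * alpha y * kern x y| <= 2^-1 * (F1 (x, y) + F2 (x, y)).
  have [xB|xB] := pselect (box B x); last first.
    by rewrite (alpha_box xB) !mul0r normr0.
  have [yB|yB] := pselect (box B y); last first.
    by rewrite (alpha_box yB) mulr0 !mul0r normr0.
  rewrite /F2 /F1/= (box1_in xB) (box1_in yB) !mulr1 (majC y x) -mulrDl mulrA normrM.
  apply: ler_pM => //; rewrite normrM.
  rewrite -(real_normK (num_real (alpha x))) -(real_normK (num_real (alpha y))).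
  by have := sqr_ge0 (`|alpha x| - `|alpha y|); nra.
have s12 x : leb.-integrable setT (EFin \o (fun y => 2^-1 * (F1 (x, y) + F2 (x, y)))).
  apply: integrableZR; exact: integrableDR (s1 x) (s2 x).
apply: (@le_trans _ _ (\int[leb]_x
    (2^-1 * (\int[leb]_y F1 (x, y) + \int[leb]_y F2 (x, y))))).
  apply: le_trans (ler_norm _) _; apply: Rintegral_le_dominated => //.
    exact: (measurable_Rintegral2 lebs msk).
  move=> x; apply: (@le_trans _ _ (\int[leb]_y (2^-1 * (F1 (x, y) + F2 (x, y))))).
    apply: Rintegral_le_dominated => //.
    exact: (measurableT_comp msk (measurable_pair1 x)).
  rewrite RintegralZl ?RintegralD//.
  exact: integrableDR (s1 x) (s2 x).
rewrite RintegralZl//; last first.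
  exact: integrableDR j1 j2.
rewrite RintegralD//.
rewrite [X in _ + X](@Rintegral_swap _ _ _ _ _ lebs lebs F2 _ _ mF2 ip ialpha2 q0
  (fun x => sqr_ge0 _) F2_le).
have := schur_half; rewrite -/D -/E => H.
rewrite (_ : \int[leb]_y \int[leb]_x F2 (x, y) = \int[leb]_x \int[leb]_y F1 (x, y))//.
lra.
Qed.

End real_plancherel.

(** * Fourier transform of functions with bounded support *)

Section fourier.
Context {R : realType} (n : nat).
Local Notation Rn := 'rV[R]_n.
Local Notation leb := (lebesgue_rV n : {measure set Rn -> \bar R}).
Implicit Types (v w : Rn -> R[i]).

(** The bounded support makes these square integrable functions integrable, so
    that their Fourier transform is an absolutely convergent integral. *)
Definition L2box (B : R) v :=
  [/\ cmeasurable setT v,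
      leb.-integrable setT (EFin \o (fun x => cnorm (v x) ^+ 2)) &
      forall x, ~ box B x -> v x = 0].

Definition sqnorm v : R := \int[leb]_x (cnorm (v x) ^+ 2).

Definition FT (s : R) v (xi : Rn) : R[i] :=
  cintegral leb setT (fun x => cis (s * dotR x xi) * v x).

Lemma sqnorm_ge0 v : 0 <= sqnorm v.
Proof. by apply: Rintegral_ge0 => x _; exact: sqr_ge0. Qed.

Lemma L2box_part B v (p : R[i] -> R) :
  (p 0 = 0) -> (forall z, `|p z| <= cnorm z) -> measurable_fun setT (p \o v) ->
  L2box B v ->
  [/\ measurable_fun setT (p \o v),
      leb.-integrable setT (EFin \o (fun x => (p (v x)) ^+ 2)) &
      forall x, ~ box B x -> p (v x) = 0].
Proof.
move=> p0 pz mp [mv iv v0]; split => //; last by move=> x /v0 ->.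
apply: (integrable_dominated measurableT _ iv); first exact: measurable_funX.
move=> x _; rewrite (ger0_norm (sqr_ge0 _)) -(real_normK (num_real (p (v x)))).
by rewrite ler_sqr ?nnegrE ?cnorm_ge0.
Qed.

Lemma L2box_Re B v : L2box B v ->
  [/\ measurable_fun setT (part_Re v),
      leb.-integrable setT (EFin \o (fun x => (part_Re v x) ^+ 2)) &
      forall x, ~ box B x -> part_Re v x = 0].
Proof.
move=> vB; have [[m1 m2] _ _] := vB.
exact: (@L2box_part B v (@complex.Re R) erefl (@normr_Re_le R) m1 vB).
Qed.

Lemma L2box_Im B v : L2box B v ->
  [/\ measurable_fun setT (part_Im v),
      leb.-integrable setT (EFin \o (fun x => (part_Im v x) ^+ 2)) &
      forall x, ~ box B x -> part_Im v x = 0].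
Proof.
move=> vB; have [[m1 m2] _ _] := vB.
exact: (@L2box_part B v (@complex.Im R) erefl (@normr_Im_le R) m2 vB).
Qed.

Lemma L2box_cintegrable B v : L2box B v -> cintegrable leb setT v.
Proof.
move=> vB; have [m1 i1 o1] := L2box_Re vB; have [m2 i2 o2] := L2box_Im vB.
by split; [exact: (L2_box_integrable m1 i1 o1)|exact: (L2_box_integrable m2 i2 o2)].
Qed.

Lemma L2box_integrable_cnorm B v : L2box B v ->
  leb.-integrable setT (EFin \o (fun x => cnorm (v x))).
Proof. by move=> /L2box_cintegrable; exact: cintegrable_cnorm. Qed.

Lemma L2boxM B v (psi : Rn -> R[i]) M : cmeasurable setT psi ->
  (forall x, cnorm (psi x) <= M) -> L2box B v ->
  L2box B (fun x => psi x * v x) /\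
  sqnorm (fun x => psi x * v x) <= M ^+ 2 * sqnorm v.
Proof.
move=> mpsi psiM [mv iv v0].
have M0 : 0 <= M by apply: le_trans (psiM 0); exact: cnorm_ge0.
have mpv := cmeasurableM mpsi mv.
have dom x : cnorm (psi x * v x) ^+ 2 <= M ^+ 2 * cnorm (v x) ^+ 2.
  rewrite cnormM exprMn; apply: ler_wpM2r; first exact: sqr_ge0.
  by rewrite ler_sqr ?nnegrE ?cnorm_ge0.
have ipv : leb.-integrable setT (EFin \o (fun x => cnorm (psi x * v x) ^+ 2)).
  apply: (integrable_dominated measurableT _ (integrableZR (M ^+ 2) iv)).
    exact: measurable_sqr_cnorm.
  by move=> x _; rewrite (ger0_norm (sqr_ge0 _)).
split; first by split => // x /v0 ->; rewrite mulr0.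
rewrite /sqnorm -(RintegralZl _ measurableT iv); apply: le_Rintegral => //.
exact: integrableZR.
Qed.

Lemma cmeasurable_wave (s : R) (xi : Rn) :
  cmeasurable setT (fun x : Rn => cis (s * dotR x xi)).
Proof.
apply: cmeasurable_cis; apply: measurable_funM; first exact: measurable_cst.
by apply: measurable_dotR; [exact: measurable_id|exact: measurable_cst].
Qed.

Lemma L2box_wave B s xi v : L2box B v -> L2box B (fun x => cis (s * dotR x xi) * v x).
Proof.
move=> vB; have [] := L2boxM (M := 1) (cmeasurable_wave s xi) _ vB => // x.
by rewrite cnorm_cis.
Qed.

Lemma FT_integrable B s xi v : L2box B v ->
  cintegrable leb setT (fun x => cis (s * dotR x xi) * v x).
Proof. by move=> /(L2box_wave s xi)/L2box_cintegrable. Qed.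

Lemma cmeasurable_FT_joint s v : cmeasurable setT v ->
  cmeasurable setT (fun z : Rn * Rn => cis (s * dotR z.2 z.1) * v z.2).
Proof.
move=> mv; apply: cmeasurableM.
  apply: cmeasurable_cis; apply: measurable_funM; first exact: measurable_cst.
  by apply: measurable_dotR; [exact: measurable_snd|exact: measurable_fst].
exact: (cmeasurable_comp mv measurable_snd).
Qed.

Lemma cmeasurable_FT s v : cmeasurable setT v -> cmeasurable setT (FT s v).
Proof.
by move=> mv; exact: (cmeasurable_cintegral2 (lebesgue_rV n) (cmeasurable_FT_joint s mv)).
Qed.

Lemma FT_bounded B s v xi : L2box B v ->
  cnorm (FT s v xi) <= 2 * \int[leb]_x cnorm (v x).
Proof.
move=> vB; apply: cnorm_cintegral_le.
- by have [m _ _] := L2box_wave s xi vB.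
- exact: L2box_integrable_cnorm vB.
- by move=> x; rewrite cnormM cnorm_cis mul1r.
Qed.

Lemma integrable_bounded_box (Rr M : R) (g : Rn -> R) : measurable_fun setT g ->
  (forall x, `|g x| <= M) ->
  leb.-integrable setT (EFin \o (fun x => box1 Rr x * g x)).
Proof.
move=> mg gM; have ib := integrableZR M (integrable_box1 n Rr).
apply: (integrable_dominated measurableT _ ib).
  by apply: measurable_funM => //; exact: measurable_box1.
move=> x _; rewrite normrM (ger0_norm (box1_ge0 _ _)) mulrC.
by apply: ler_wpM2r => //; exact: box1_ge0.
Qed.

Lemma integrable_box_FT B s (Rr : R) v : L2box B v ->
  leb.-integrable setT (EFin \o (fun xi => box1 Rr xi * cnorm (FT s v xi) ^+ 2)).
Proof.
move=> vB; have [mv _ _] := vB.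
apply: (@integrable_bounded_box _ ((2 * \int[leb]_x cnorm (v x)) ^+ 2)).
  exact/measurable_sqr_cnorm/cmeasurable_FT.
move=> xi; rewrite (ger0_norm (sqr_ge0 _)).
rewrite ler_sqr ?nnegrE ?cnorm_ge0//; first exact: FT_bounded vB.
by apply: mulr_ge0 => //; apply: Rintegral_ge0 => x _; exact: cnorm_ge0.
Qed.

Lemma box1_le_bumpn (Rr : R) (xi : Rn) : 0 < Rr -> box1 Rr xi <= bumpn (Rr + 1) xi.
Proof.
move=> R0; apply: ler_prod => i _; rewrite indicE.
case: (boolP (_ \in _)) => [|_ /=]; last by rewrite lexx bump_ge0.
rewrite mem_setE in_itv/= -ler_norml ler01 => xR.
have R10 : 0 < Rr + 1 by rewrite addr_gt0.
rewrite bump_in//; last by apply: le_trans xR _; rewrite lerDl.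
have := normr_ge0 (xi ord0 i); move: xR.
by rewrite -(real_normK (num_real (xi ord0 i))); set t := `|_| => *; nra.
Qed.

Definition plancherel_cst (Rr : R) : R := 2 * (decay_cst (Rr + 1) * pi) ^+ n.

Lemma plancherel_cst_ge0 Rr : 0 < Rr -> 0 <= plancherel_cst Rr.
Proof.
move=> R0; rewrite /plancherel_cst mulr_ge0// exprn_ge0// mulr_ge0 ?pi_ge0//.
by apply: decay_cst_ge0; rewrite addr_gt0.
Qed.

(** The weight of parameter [Rr + 1] is at least 1 on the box of size [Rr], so
    that [weighted_plancherel] applies to the real and the imaginary parts. *)
Theorem plancherel_box (Rr B s : R) v : 0 < Rr -> 0 < B -> s != 0 -> L2box B v ->
  \int[leb]_xi (box1 Rr xi * cnorm (FT s v xi) ^+ 2) <=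
  plancherel_cst Rr * `|s| ^- n * sqnorm v.
Proof.
move=> R0 B0 s0 vB.
have R10 : 0 < Rr + 1 by rewrite addr_gt0.
have [m1 i1 o1] := L2box_Re vB; have [m2 i2 o2] := L2box_Im vB.
have H1 := weighted_plancherel R10 B0 s0 m1 i1 o1.
have H2 := weighted_plancherel R10 B0 s0 m2 i2 o2.
set P1 := fun xi => cosT s (part_Re v) xi ^+ 2 + sinT s (part_Re v) xi ^+ 2 in H1.
set P2 := fun xi => cosT s (part_Im v) xi ^+ 2 + sinT s (part_Im v) xi ^+ 2 in H2.
have iw (f : R -> R) (p : Rn -> R) (xi : Rn) : measurable_fun setT f ->
    (forall t, `|f t| <= 1) -> leb.-integrable setT (EFin \o p) ->
    leb.-integrable setT (EFin \o (fun x => f (s * dotR x xi) * p x)).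
  move=> mf f1 ip; apply: (integrable_dominated measurableT _ (integrable_norm ip)).
    apply: measurable_funM.
      apply: (measurableT_comp mf); apply: measurable_funM; first exact: measurable_cst.
      by apply: measurable_dotR; [exact: measurable_id|exact: measurable_cst].
    by apply/measurable_EFinP; exact: measurable_int ip.
  by move=> x _ /=; rewrite normrM; apply: ler_piMl.
have [j1 j2] := L2box_cintegrable vB.
have FTE xi : cnorm (FT s v xi) ^+ 2 <= 2 * (P1 xi + P2 xi).
  have ERe : complex.Re (FT s v xi) = cosT s (part_Re v) xi - sinT s (part_Im v) xi.
    rewrite /cosT /sinT -RintegralB//.
    + by apply: eq_Rintegral => x _; rewrite /part_Re ReM.
    + exact: iw measurable_cosR (@normr_cos_le1 R) j1.
    + exact: iw measurable_sinR (@normr_sin_le1 R) j2.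
  have EIm : complex.Im (FT s v xi) = cosT s (part_Im v) xi + sinT s (part_Re v) xi.
    rewrite /cosT /sinT -RintegralD//.
    + by apply: eq_Rintegral => x _; rewrite /part_Im ImM.
    + exact: iw measurable_cosR (@normr_cos_le1 R) j2.
    + exact: iw measurable_sinR (@normr_sin_le1 R) j1.
  rewrite sqr_cnorm ERe EIm /P1 /P2.
  set a := cosT _ _ _; set b := sinT _ _ _; set c := cosT _ _ _; set e := sinT _ _ _.
  by have := sqr_ge0 (a + b); have := sqr_ge0 (c - e); nra.
have mT (f : R -> R) (p : Rn -> R) : measurable_fun setT f -> measurable_fun setT p ->
    measurable_fun setT (fun xi : Rn => \int[leb]_x (f (s * dotR x xi) * p x)).
  move=> mf mp.
  have mj : measurable_fun setT (fun z : Rn * Rn => f (s * dotR z.2 z.1) * p z.2).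
    apply: measurable_funM; last exact: (measurableT_comp mp measurable_snd).
    apply: (measurableT_comp mf); apply: measurable_funM; first exact: measurable_cst.
    by apply: measurable_dotR; [exact: measurable_snd|exact: measurable_fst].
  exact: (measurable_Rintegral2 (lebesgue_rV n) mj).
have bT (f : R -> R) (p : Rn -> R) (xi : Rn) : measurable_fun setT f ->
    (forall t, `|f t| <= 1) -> leb.-integrable setT (EFin \o p) ->
    (\int[leb]_x (f (s * dotR x xi) * p x)) ^+ 2 <= (\int[leb]_x `|p x|) ^+ 2.
  move=> mf f1 ip; rewrite -[leLHS](real_normK (num_real _)).
  rewrite ler_sqr ?nnegrE ?Rintegral_ge0//.
  apply: Rintegral_le_dominated.
  - by apply/measurable_EFinP; exact: measurable_int (iw _ _ _ mf f1 ip).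
  - exact: (integrable_norm ip).
  - by move=> x; rewrite normrM; apply: ler_piMl.
have bi (P : Rn -> R) M : measurable_fun setT P -> (forall xi, `|P xi| <= M) ->
    leb.-integrable setT (EFin \o (fun xi => bumpn (Rr + 1) xi * P xi)).
  move=> mP PM; apply: (integrable_dominated measurableT _
    (integrableZR M (integrable_bumpn R10 n))).
    by apply: measurable_funM => //; exact: measurable_bumpn.
  move=> xi _; rewrite normrM (ger0_norm (bumpn_ge0 _ _)) mulrC.
  by apply: ler_wpM2r => //; exact: bumpn_ge0.
have biP (p : Rn -> R) : leb.-integrable setT (EFin \o p) ->
    leb.-integrable setT (EFin \o (fun xi => bumpn (Rr + 1) xi *
      (cosT s p xi ^+ 2 + sinT s p xi ^+ 2))).
  move=> ip; have mp : measurable_fun setT p.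
    by apply/measurable_EFinP; exact: measurable_int ip.
  apply: (bi _ ((\int[leb]_x `|p x|) ^+ 2 + (\int[leb]_x `|p x|) ^+ 2)).
    by apply: measurable_funD; apply: measurable_funX; apply: mT => //;
      [exact: measurable_cosR|exact: measurable_sinR].
  move=> xi; rewrite ger0_norm ?addr_ge0 ?sqr_ge0//.
  apply: lerD; apply: bT => //; [exact: measurable_cosR|exact: normr_cos_le1|
    exact: measurable_sinR|exact: normr_sin_le1].
have bP1 := biP _ j1; have bP2 := biP _ j2.
have bP12 := integrableDR bP1 bP2.
apply: (@le_trans _ _ (2 * (\int[leb]_xi (bumpn (Rr + 1) xi * P1 xi) +
    \int[leb]_xi (bumpn (Rr + 1) xi * P2 xi)))).
  rewrite -(RintegralD measurableT bP1 bP2) -(RintegralZl _ measurableT bP12).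
  apply: le_Rintegral => //.
  - exact: integrable_box_FT vB.
  - exact: integrableZR.
  - move=> xi _; rewrite -mulrDr [leRHS]mulrCA.
    exact: (ler_pM (box1_ge0 _ _) (sqr_ge0 _) (box1_le_bumpn _ R0) (FTE xi)).
have -> : sqnorm v = \int[leb]_x (part_Re v x ^+ 2) + \int[leb]_x (part_Im v x ^+ 2).
  rewrite -(RintegralD measurableT i1 i2); apply: eq_Rintegral => x _.
  exact: sqr_cnorm.
rewrite /plancherel_cst -!mulrA; apply: ler_wpM2l => //.
rewrite mulrA -exprVn -exprMn mulrDr.
exact: lerD H1 H2.
Qed.

End fourier.

(** * Calculus of smooth functions *)

Section smooth_functions.
Context {R : realType}.

(** A derivative in the direction [v] sees the function on one line only. This
    replaces the chain rule for all the affine maps used below (slices,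
    translations, lines, linear phases). *)
Lemma derive_along (V W : normedModType R) (f : V -> R) (g : W -> R) a v b w :
  (forall h : R, f (h *: v + a) = g (h *: w + b)) ->
  (derivable f a v -> derivable g b w) /\ 'D_v f a = 'D_w g b.
Proof.
move=> fg.
have fgab : f a = g b by have := fg 0; rewrite !scale0r !add0r.
have E : (fun h : R => h^-1 *: ((f \o shift a) (h *: v) - f a)) =
         (fun h : R => h^-1 *: ((g \o shift b) (h *: w) - g b)).
  by apply/funext => h /=; rewrite fg fgab.
by split; rewrite /derivable /derive E.
Qed.

Section on_a_space.
Context {V : normedModType R}.
Implicit Types (f g : V -> R) (v : V) (s : seq V).

Lemma iter_derive_rcons s v f :
  iter_derive (rcons s v) f = iter_derive s (fun x => 'D_v f x).
Proof. by rewrite /iter_derive foldr_rcons. Qed.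

(** Products are smooth by induction on the number of derivatives, which the
    definition of [smooth] leaves unbounded. *)
Definition smooth_upto k f := forall s, (size s <= k)%N ->
  continuous (iter_derive s f) /\ forall x v, derivable (iter_derive s f) x v.

Lemma smoothP f : smooth f <-> forall k, smooth_upto k f.
Proof. by split=> [sf k s _|sf s]; [exact: sf|exact: (sf (size s))]. Qed.

Lemma smooth_continuous f : smooth f -> continuous f.
Proof. by move=> sf; have [] := sf [::]. Qed.

Lemma smooth_derivable f x v : smooth f -> derivable f x v.
Proof. by move=> sf; have [_] := sf [::]; exact. Qed.

Lemma smooth_derive f v : smooth f -> smooth (fun x => 'D_v f x).
Proof. by move=> sf s; rewrite -iter_derive_rcons; exact: sf. Qed.

Lemma smooth_iter_derive f s : smooth f -> smooth (iter_derive s f).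
Proof.
move=> sf; elim: s => [|v s IH]; first exact: sf.
exact: (smooth_derive v IH).
Qed.

Lemma smooth_uptoW k f : smooth_upto k.+1 f -> smooth_upto k f.
Proof. by move=> sf s sk; apply: sf; exact: leqW. Qed.

Lemma smooth_upto_derive k f v :
  smooth_upto k.+1 f -> smooth_upto k (fun x => 'D_v f x).
Proof.
by move=> sf s sk; rewrite -iter_derive_rcons; apply: sf; rewrite size_rcons.
Qed.

Lemma smooth_upto0 f :
  continuous f -> (forall x v, derivable f x v) -> smooth_upto 0 f.
Proof. by move=> cf df [|]. Qed.

Lemma smooth_uptoS k f : continuous f -> (forall x v, derivable f x v) ->
  (forall v, smooth_upto k (fun x => 'D_v f x)) -> smooth_upto k.+1 f.
Proof.
move=> cf df sf; elim/last_ind => [//|s v _]; rewrite size_rcons ltnS => sk.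
by rewrite iter_derive_rcons; exact: sf.
Qed.

Lemma smooth_upto_cts k f : smooth_upto k f -> continuous f.
Proof. by move=> sf; have [] := sf [::]. Qed.

Lemma smooth_upto_der k f x v : smooth_upto k f -> derivable f x v.
Proof. by move=> sf; have [//|_] := sf [::]; exact. Qed.

Lemma smooth_uptoD k f g : smooth_upto k f -> smooth_upto k g ->
  smooth_upto k (fun x => f x + g x).
Proof.
elim: k f g => [|k IH] f g sf sg;
  have cfg : continuous (fun x => f x + g x) by
    apply: ctsD; [exact: smooth_upto_cts sf|exact: smooth_upto_cts sg].
- apply: smooth_upto0 => // x v.
  by apply: derivableD; [exact: smooth_upto_der sf|exact: smooth_upto_der sg].
- apply: smooth_uptoS => // [x v|v].
    by apply: derivableD; [exact: smooth_upto_der sf|exact: smooth_upto_der sg].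
  rewrite (_ : (fun x => _) = (fun x => 'D_v f x + 'D_v g x)).
    by apply: IH; exact: smooth_upto_derive.
  apply/funext => x; apply: deriveD; first exact: smooth_upto_der sf.
  exact: smooth_upto_der sg.
Qed.

Lemma smooth_uptoM k f g : smooth_upto k f -> smooth_upto k g ->
  smooth_upto k (fun x => f x * g x).
Proof.
elim: k f g => [|k IH] f g sf sg;
  have cfg : continuous (fun x => f x * g x) by
    apply: ctsM; [exact: smooth_upto_cts sf|exact: smooth_upto_cts sg].
- apply: smooth_upto0 => // x v.
  by apply: derivableM; [exact: smooth_upto_der sf|exact: smooth_upto_der sg].
- apply: smooth_uptoS => // [x v|v].
    by apply: derivableM; [exact: smooth_upto_der sf|exact: smooth_upto_der sg].
  rewrite (_ : (fun x => _) = (fun x => f x * 'D_v g x + g x * 'D_v f x)).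
    apply: smooth_uptoD; apply: IH.
    - exact: smooth_uptoW sf.
    - exact: smooth_upto_derive sg.
    - exact: smooth_uptoW sg.
    - exact: smooth_upto_derive sf.
  apply/funext => x; apply: deriveM; first exact: smooth_upto_der sf.
  exact: smooth_upto_der sg.
Qed.

Lemma smoothD f g : smooth f -> smooth g -> smooth (fun x => f x + g x).
Proof.
by move=> /smoothP sf /smoothP sg; apply/smoothP => k; exact: smooth_uptoD.
Qed.

Lemma smoothM f g : smooth f -> smooth g -> smooth (fun x => f x * g x).
Proof.
by move=> /smoothP sf /smoothP sg; apply/smoothP => k; exact: smooth_uptoM.
Qed.

Lemma smooth_cst (c : R) : smooth (fun _ : V => c).
Proof.
apply/smoothP => k; elim: k c => [|k IH] c.
  by apply: smooth_upto0; [exact: ctsC|move=> x v; exact: derivable_cst].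
apply: smooth_uptoS; [exact: ctsC|move=> x v; exact: derivable_cst|move=> v].
have -> : (fun x : V => 'D_v (fun=> c) x) = (fun=> 0).
  by apply/funext => x; exact: derive_cst.
exact: IH.
Qed.

Lemma smoothZ (c : R) f : smooth f -> smooth (fun x => c * f x).
Proof. exact: (smoothM (smooth_cst c)). Qed.

Lemma smoothN f : smooth f -> smooth (fun x => - f x).
Proof.
by move=> /(smoothZ (-1)); under [X in smooth X]eq_fun do rewrite mulN1r.
Qed.

Lemma smoothB f g : smooth f -> smooth g -> smooth (fun x => f x - g x).
Proof. by move=> sf /smoothN; exact: smoothD. Qed.

Lemma deriveDE f g v x : smooth f -> smooth g ->
  'D_v (fun x => f x + g x) x = 'D_v f x + 'D_v g x.
Proof. by move=> sf sg; apply: deriveD; exact: smooth_derivable. Qed.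

Lemma deriveME f g v x : smooth f -> smooth g ->
  'D_v (fun x => f x * g x) x = f x * 'D_v g x + g x * 'D_v f x.
Proof. by move=> sf sg; apply: deriveM; exact: smooth_derivable. Qed.

Lemma deriveBE f g v x : smooth f -> smooth g ->
  'D_v (fun x => f x - g x) x = 'D_v f x - 'D_v g x.
Proof. by move=> sf sg; apply: deriveB; exact: smooth_derivable. Qed.

Section plane_waves.
Variable l : V -> R.
Hypotheses (lD : forall (h : R) v x, l (h *: v + x) = h * l v + l x)
  (cl : continuous l).

(** The span of [cos \o l] and [sin \o l] is stable under differentiation. *)
Let wave c1 c2 x := c1 * cos (l x) + c2 * sin (l x).

Let is_derive_wave c1 c2 x v :
  is_derive x v (wave c1 c2) (l v * wave c2 (- c1) x).
Proof.
pose g (t : R) := c1 * cos (t * l v + l x) + c2 * sin (t * l v + l x).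
have := @derive_along (R : normedModType R) V g (wave c1 c2) 0 1 x v.
have gw h : g (h *: 1 + 0) = wave c1 c2 (h *: v + x).
  by rewrite /g /wave lD addr0 [h *: 1]mulr1.
move=> /(_ gw)[dg Dg].
have [dg0 Dg0] : is_derive (0 : R) 1 g (l v * wave c2 (- c1) x).
  apply: is_derive_eq; rewrite /GRing.scale/= /wave mul0r add0r; ring.
by split; [exact: dg|rewrite -Dg].
Qed.

Let cts_wave c1 c2 : continuous (wave c1 c2).
Proof.
apply: ctsD; apply: ctsM; try exact: ctsC.
  by apply: cts_comp => //; exact: continuous_cos.
by apply: cts_comp => //; exact: continuous_sin.
Qed.

Let smooth_wave c1 c2 : smooth (wave c1 c2).
Proof.
apply/smoothP => k; elim: k c1 c2 => [|k IH] c1 c2.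
  by apply: smooth_upto0 => // x v; have [] := is_derive_wave c1 c2 x v.
apply: smooth_uptoS => // [x v|v]; first by have [] := is_derive_wave c1 c2 x v.
rewrite (_ : (fun x => _) = wave (l v * c2) (l v * (- c1))) => //.
apply/funext => x; have [_ ->] := is_derive_wave c1 c2 x v.
by rewrite /wave mulrDr !mulrA.
Qed.

Lemma smooth_cos_linear : smooth (fun x => cos (l x)).
Proof.
have := smooth_wave 1 0; rewrite /wave.
by under [X in smooth X]eq_fun do rewrite mul1r mul0r addr0.
Qed.

Lemma smooth_sin_linear : smooth (fun x => sin (l x)).
Proof.
have := smooth_wave 0 1; rewrite /wave.
by under [X in smooth X]eq_fun do rewrite mul1r mul0r add0r.
Qed.

Lemma derive_cos_linear v x : 'D_v (fun x => cos (l x)) x = - (l v * sin (l x)).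
Proof.
have [_] := is_derive_wave 1 0 x v; rewrite /wave.
have -> : (fun x => 1 * cos (l x) + 0 * sin (l x)) = (fun x => cos (l x)).
  by apply/funext => y; rewrite mul1r mul0r addr0.
by move=> ->; ring.
Qed.

Lemma derive_sin_linear v x : 'D_v (fun x => sin (l x)) x = l v * cos (l x).
Proof.
have [_] := is_derive_wave 0 1 x v; rewrite /wave.
have -> : (fun x => 0 * cos (l x) + 1 * sin (l x)) = (fun x => sin (l x)).
  by apply/funext => y; rewrite mul1r mul0r add0r.
by move=> ->; ring.
Qed.

End plane_waves.

Lemma derive_vanish (U : set V) f v : open U -> (forall x, U x -> f x = 0) ->
  forall x, U x -> 'D_v f x = 0.
Proof.
move=> oU f0 x Ux.
have -> : 'D_v f x = 'D_v (fun=> 0 : R) x.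
  by apply: near_eq_derive; near=> y; apply: f0; near: y; exact: open_nbhs_nbhs.
exact: derive_cst.
Unshelve. all: by end_near. Qed.

Lemma iter_derive_vanish (U : set V) f s : open U ->
  (forall x, U x -> f x = 0) -> forall x, U x -> iter_derive s f x = 0.
Proof.
move=> oU f0; elim: s => [|v s IH]; first exact: f0.
exact: (@derive_vanish U (iter_derive s f) v oU IH).
Qed.

Lemma compact_support_bounded (T : topologicalType) (K : set T) (f : T -> R) :
  compact K -> continuous f -> (forall x, ~ K x -> f x = 0) ->
  exists2 M : R, 0 < M & forall x, `|f x| <= M.
Proof.
move=> cK cf f0.
have : compact (f @` K) by apply: continuous_compact => //; exact: continuous_subspaceT.
move=> /(@compact_bounded _ R) [M0 [_ /(_ (`|M0| + 1))]].
have M1 : M0 < `|M0| + 1 by apply: le_lt_trans (ler_norm _) _; rewrite ltrDl.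
move=> /(_ M1) H; exists (`|M0| + 1); first by rewrite ltr_wpDl.
move=> x; have [Kx|/f0 ->] := pselect (K x); last by rewrite normr0 addr_ge0.
by apply: H; exists x.
Qed.

End on_a_space.
End smooth_functions.

(** * A compactly supported function as the integral of its mixed derivative *)

Section slices.
Context {R : realType} (n : nat).
Implicit Types (g : 'rV[R]_n.+1 -> R) (t : R) (y v : 'rV[R]_n).

Lemma rV_cons_eta (x : 'rV[R]_n.+1) :
  x = rV_cons (x ord0 ord0, \row_i x ord0 (lift ord0 i)).
Proof.
apply/rowP => j; case: (unliftP ord0 j) => [k|] ->.
  by rewrite rV_consS mxE.
by rewrite rV_cons0.
Qed.

Lemma rV_cons_linel (h t : R) y :
  rV_cons (h *: 1 + t, y) = h *: rV_cons (1, 0) + rV_cons (t, y).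
Proof.
apply/rowP => j; rewrite [RHS]mxE [X in _ = X + _]mxE.
case: (unliftP ord0 j) => [k|] ->; last by rewrite !rV_cons0.
by rewrite !rV_consS [X in _ * X]mxE mulr0 add0r.
Qed.

Lemma rV_cons_liner (h t : R) v y :
  rV_cons (t, h *: v + y) = h *: rV_cons (0, v) + rV_cons (t, y).
Proof.
apply/rowP => j; rewrite [RHS]mxE [X in _ = X + _]mxE.
case: (unliftP ord0 j) => [k|] ->; last by rewrite !rV_cons0 mulr0 add0r.
by rewrite !rV_consS [LHS]mxE [X in X + _]mxE.
Qed.

Lemma continuous_rV_consr t : continuous (fun y => rV_cons (t, y)).
Proof.
move=> y A /nbhs_ballP[e /= e0 eA]; apply/nbhs_ballP; exists e => //= z [_ yz].
apply: eA; apply: rV_ballP => // j; case: (unliftP ord0 j) => [k|] ->.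
  by rewrite !rV_consS; exact: yz.
by rewrite !rV_cons0 subrr normr0.
Qed.

Lemma continuous_rV_consl y : continuous (fun t : R => rV_cons (t, y)).
Proof.
move=> t A /nbhs_ballP[e /= e0 eA]; apply/nbhs_ballP; exists e => //= z tz.
apply: eA; apply: rV_ballP => // j; case: (unliftP ord0 j) => [k|] ->.
  by rewrite !rV_consS subrr normr0.
by rewrite !rV_cons0.
Qed.

Lemma iter_derive_slice s g t y :
  iter_derive [seq rV_cons (0, v) | v <- s] g (rV_cons (t, y)) =
  iter_derive s (fun z => g (rV_cons (t, z))) y.
Proof.
elim: s y => [//|v s IH] y /=.
by apply: (derive_along _).2 => h; rewrite -rV_cons_liner IH.
Qed.

Lemma smooth_slice g t : smooth g -> smooth (fun y => g (rV_cons (t, y))).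
Proof.
move=> sg s; have [cs ds] := sg [seq rV_cons (0, v) | v <- s].
have E : (fun y => iter_derive [seq rV_cons (0, v) | v <- s] g (rV_cons (t, y))) =
    iter_derive s (fun y => g (rV_cons (t, y))).
  by apply/funext => y; exact: iter_derive_slice.
split=> [|y v].
  rewrite -E => y; apply: (@continuous_comp _ _ _ (fun y => rV_cons (t, y))
    (iter_derive [seq rV_cons (0, v) | v <- s] g)).
    exact: continuous_rV_consr.
  exact: cs.
apply: (derive_along _).1 (ds (rV_cons (t, y)) (rV_cons (0, v))) => h.
by rewrite -rV_cons_liner iter_derive_slice.
Qed.

Lemma is_derive_slice g y (t : R) : smooth g ->
  is_derive t 1 (fun t => g (rV_cons (t, y))) ('D_(rV_cons (1, 0)) g (rV_cons (t, y))).
Proof.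
move=> sg; have [dg Dg] := @derive_along R _ (R : normedModType R) g
  (fun t => g (rV_cons (t, y))) (rV_cons (t, y)) (rV_cons (1, 0)) t 1
  (fun h => esym (congr1 g (rV_cons_linel h t y))).
by split; [apply: dg; exact: smooth_derivable|rewrite Dg].
Qed.

End slices.

Section mixed_derivative.
Context {R : realType}.
Local Notation leb n := (lebesgue_rV n : {measure set 'rV[R]_n -> \bar R}).

(** [iter_derive] applies the last direction of the list first: the first
    coordinate is differentiated before all the others, and the induction on the
    dimension peels it off. *)
Fixpoint mixed_dirs n : seq 'rV[R]_n :=
  match n with
  | 0 => [::]
  | n'.+1 => rcons [seq rV_cons (0, v) | v <- mixed_dirs n'] (rV_cons (1, 0))
  end.

Definition mixed n (g : 'rV[R]_n -> R) : 'rV[R]_n -> R :=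
  iter_derive (mixed_dirs n) g.

(** The indicator of the orthant of vertex [t], as a function of [x]. *)
Definition orth n (t x : 'rV[R]_n) : R :=
  \prod_(i < n) \1_(`[0, +oo[%classic) (x ord0 i - t ord0 i).

Lemma orth_ge0 n (t x : 'rV[R]_n) : 0 <= orth t x.
Proof. by apply: prodr_ge0 => i _; rewrite indicE. Qed.

Lemma orth_le1 n (t x : 'rV[R]_n) : orth t x <= 1.
Proof.
by apply: prodr_ile1 => i _; rewrite indicE ler0n lern1 leq_b1.
Qed.

Lemma measurable_orth d (T : measurableType d) n (f g : T -> 'rV[R]_n) :
  measurable_fun setT f -> measurable_fun setT g ->
  measurable_fun setT (fun z => orth (f z) (g z)).
Proof.
move=> mf mg; apply: measurable_prod => i _.
have mi : measurable_fun setT (\1_(`[0, +oo[%classic) : R -> R).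
  by apply: measurable_indic; exact: measurable_itv.
apply: (measurableT_comp mi).
by apply: measurable_funB; exact: measurable_rV_coordT.
Qed.

Lemma orth_cons n (t x0 : R) (y x' : 'rV[R]_n) :
  orth (rV_cons (t, y)) (rV_cons (x0, x')) =
  \1_(`[0, +oo[%classic) (x0 - t) * orth y x'.
Proof.
rewrite /orth big_ord_recl !rV_cons0; congr (_ * _).
by apply: eq_bigr => i _; rewrite !rV_consS.
Qed.

Lemma box_compl_open n (B : R) : open (~` @box R n B).
Proof.
rewrite openC; have -> : @box R n B = \bigcap_(i in [set: 'I_n])
    ((fun x : 'rV[R]_n => `|x ord0 i|) @^-1` [set z | z <= B]).
  by apply/seteqP; split => [x xB i _|x xB i]; [exact: xB|exact: (xB i)].
apply: closed_bigI => i _; apply: closed_comp; last exact: closed_le.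
by move=> x _; apply: continuous_comp; [exact: coord_continuous|exact: norm_continuous].
Qed.

Lemma compact_box n (B : R) : compact (@box R n B).
Proof.
have -> : @box R n B = [set v : 'rV[R]_n | forall i, `[- B, B]%classic (v ord0 i)].
  by apply/seteqP; split => x xB i; have := xB i; rewrite /= in_itv/= -ler_norml.
apply: (@rV_compact _ n (fun=> `[- B, B]%classic)) => i; exact: segment_compact.
Qed.

Lemma mixed_vanish n (g : 'rV[R]_n -> R) B : (forall x, ~ box B x -> g x = 0) ->
  forall x, ~ box B x -> mixed g x = 0.
Proof. by move=> g0; exact: (iter_derive_vanish _ (@box_compl_open n B) g0). Qed.

Lemma measurable_smooth n (g : 'rV[R]_n -> R) : smooth g -> measurable_fun setT g.
Proof. by move=> /smooth_continuous; exact: continuous_measurable_rV. Qed.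

Lemma measurable_mixed n (g : 'rV[R]_n -> R) :
  smooth g -> measurable_fun setT (mixed g).
Proof. by move=> sg; apply: measurable_smooth; exact: smooth_iter_derive. Qed.

Lemma mixed_bounded n (g : 'rV[R]_n -> R) B : smooth g ->
  (forall x, ~ box B x -> g x = 0) ->
  exists2 M : R, 0 < M & forall x, `|mixed g x| <= M * box1 B x.
Proof.
move=> sg g0; have m0 := mixed_vanish g0.
have [|M M0 gM] := compact_support_bounded (@compact_box n B) _ m0.
  by apply: smooth_continuous; exact: smooth_iter_derive.
exists M => // x; have [xB|xB] := pselect (box B x).
  by rewrite box1_in// mulr1.
by rewrite m0// normr0 mulr_ge0 ?box1_ge0// ltW.
Qed.

Lemma Rintegral_halfline (G G' : R -> R) (B x0 : R) : 0 <= B ->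
  (forall t : R, is_derive t 1 G (G' t)) -> continuous G' ->
  (forall t, B < `|t| -> G t = 0) -> (forall t, B < `|t| -> G' t = 0) ->
  \int[@lebesgue_measure R]_t (\1_(`[0, +oo[%classic) (x0 - t) * G' t) = G x0.
Proof.
move=> B0 GG' cG' G0 G'0.
pose a := - (`|x0| + B + 1).
have xa := ler_norm (- x0); rewrite normrN in xa.
have ax0 : a < x0 by rewrite /a; lra.
have Ba t : t <= a -> B < `|t|.
  move=> ta; have := ler_norm (- t); rewrite normrN => tt.
  by move: ta tt (normr_ge0 x0); rewrite /a; lra.
transitivity (\int[@lebesgue_measure R]_(t in `[a, x0]) G' t).
  rewrite [RHS]Rintegral_mkcond; apply: eq_Rintegral => t _.
  rewrite /patch indicE mem_setE in_itv/= andbT subr_ge0 mem_setE in_itv/=.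
  case: (leP t x0) => tx; last by rewrite andbF mul0r.
  rewrite andbT mul1r; case: (leP a t) => // /ltW /Ba.
  exact: G'0.
by rewrite (Rintegral_FTC ax0 GG' cG') (G0 a (Ba _ (lexx a))) subr0.
Qed.

(** One-dimensional fundamental theorem of calculus in each variable, started
    outside the box, where the function vanishes. *)
Theorem mixed_FTC n (g : 'rV[R]_n -> R) (B : R) : 0 <= B -> smooth g ->
  (forall x, ~ box B x -> g x = 0) ->
  forall x, g x = \int[leb n]_t (orth t x * mixed g t).
Proof.
move=> B0; elim: n g => [|n IH] g sg g0 x.
  rewrite Rintegral_lebesgue_rV0.
    by rewrite /orth big_ord0 mul1r; congr g; rewrite (thinmx0 x).
  apply: measurable_funM; last exact: measurable_mixed.
  by apply: measurable_orth; [exact: measurable_id|exact: measurable_cst].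
have [M M0 gM] := mixed_bounded sg g0.
have mf : measurable_fun setT (fun t => orth t x * mixed g t).
  apply: measurable_funM; last exact: measurable_mixed.
  by apply: measurable_orth; [exact: measurable_id|exact: measurable_cst].
have ip : (@lebesgue_measure R).-integrable setT
    (EFin \o (fun t => M * \1_(`[- B, B]%classic) t)).
  exact: integrableZR (integrable_indic_seg B).
have p0 t : 0 <= M * \1_(`[- B, B]%classic) t.
  by apply: mulr_ge0; [exact: ltW|rewrite indicE].
have fpq t y : `|orth (rV_cons (t, y)) x * mixed g (rV_cons (t, y))| <=
    (M * \1_(`[- B, B]%classic) t) * box1 B y.
  rewrite normrM (ger0_norm (orth_ge0 _ _)) -mulrA.
  have -> : \1_(`[- B, B]%classic) t * box1 B y = box1 B (rV_cons (t, y)).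
    exact/esym/(prod_rV_cons (fun=> \1_(`[- B, B]%classic))).
  apply: le_trans (gM _); apply: ler_piMl => //; exact: orth_le1.
rewrite (Rintegral_lebesgue_rVS mf ip (integrable_box1 n B) p0 (box1_ge0 B) fpq).
set x0 := x ord0 ord0; set x' := \row_i x ord0 (lift ord0 i).
have xE : x = rV_cons (x0, x') := rV_cons_eta x.
pose e0 : 'rV[R]_n.+1 := rV_cons (1, 0).
pose Dg := fun z => 'D_e0 g z.
have sDg : smooth Dg := smooth_derive e0 sg.
have Dg0 z : ~ box B z -> Dg z = 0.
  exact: (derive_vanish e0 (@box_compl_open n.+1 B) g0).
have box_cons t y : box B (rV_cons (t, y)) <-> `|t| <= B /\ box B y.
  split => [ty|[tB yB] j].
    split; first by have := ty ord0; rewrite rV_cons0.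
    by move=> i; have := ty (lift ord0 i); rewrite rV_consS.
  by case: (unliftP ord0 j) => [k|] ->; rewrite ?rV_consS ?rV_cons0//; exact: yB.
have inner t : \int[leb n]_y (orth (rV_cons (t, y)) x * mixed g (rV_cons (t, y))) =
    \1_(`[0, +oo[%classic) (x0 - t) * Dg (rV_cons (t, x')).
  have sl : smooth (fun y => Dg (rV_cons (t, y))) by exact: smooth_slice.
  have sl0 y : ~ box B y -> Dg (rV_cons (t, y)) = 0.
    by move=> yB; apply: Dg0 => /box_cons[].
  have mE y : mixed g (rV_cons (t, y)) = mixed (fun y => Dg (rV_cons (t, y))) y.
    by rewrite /mixed /= iter_derive_rcons iter_derive_slice.
  rewrite (IH _ sl sl0 x') -RintegralZl//.
    by apply: eq_Rintegral => y _; rewrite mE xE orth_cons mulrA.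
  have [M' M'0 slM] := mixed_bounded sl sl0.
  have ib := integrableZl measurableT M' (integrable_box1 n B).
  apply: (@integrable_dominated _ _ _ _ _ _ (fun y => M' * box1 B y)) => //.
    apply: measurable_funM; last exact: measurable_mixed.
    by apply: measurable_orth; [exact: measurable_id|exact: measurable_cst].
  move=> y _; rewrite normrM (ger0_norm (orth_ge0 _ _)).
  apply: le_trans (slM _); apply: ler_piMl => //; exact: orth_le1.
under eq_Rintegral do rewrite inner.
have dG (t : R) : is_derive t 1 (fun t => g (rV_cons (t, x'))) (Dg (rV_cons (t, x'))).
  exact: is_derive_slice.
have cDg : continuous (fun t : R => Dg (rV_cons (t, x'))).
  move=> t; apply: (@continuous_comp _ _ _ (fun t : R => rV_cons (t, x')) Dg).
    exact: continuous_rV_consl.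
  exact: smooth_continuous.
have out t : B < `|t| -> ~ box B (rV_cons (t, x')).
  by move=> Bt /box_cons[]; rewrite leNgt Bt.
rewrite (Rintegral_halfline x0 B0 dG cDg) -?xE// => t /out; [exact: g0|exact: Dg0].
Qed.

End mixed_derivative.

(** * Pairing with a compactly supported symbol *)

Section partial_slices.
Context {R : realType} {V W : normedModType R}.
Implicit Types (g : V * W -> R) (s : seq V) (x v : V) (xi : W).

Lemma pair_line (h : R) v x xi :
  (h *: v + x, xi) = h *: ((v, 0) : V * W) + (x, xi).
Proof. by rewrite -[X in (_, X)]add0r -{1}[X in (_, X + _)](scaler0 _ h). Qed.

Lemma continuous_pairl xi : continuous (fun x => (x, xi) : V * W).
Proof.
move=> x; apply: cvg_pair; first exact: cvg_id.
exact: cvg_cst.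
Qed.

Lemma iter_derive_pairl s g x xi :
  iter_derive [seq ((v, 0) : V * W) | v <- s] g (x, xi) =
  iter_derive s (fun z => g (z, xi)) x.
Proof.
elim: s x => [//|v s IH] x /=.
by apply: (derive_along _).2 => h; rewrite -pair_line IH.
Qed.

Lemma smooth_pairl g xi : smooth g -> smooth (fun x => g (x, xi)).
Proof.
move=> sg s; have [cs ds] := sg [seq (v, 0) | v <- s].
have E : (fun x => iter_derive [seq ((v, 0) : V * W) | v <- s] g (x, xi)) =
    iter_derive s (fun x => g (x, xi)).
  by apply/funext => x; exact: iter_derive_pairl.
split=> [|x v].
  rewrite -E => x; apply: (@continuous_comp _ _ _ (fun x => (x, xi))
    (iter_derive [seq ((v, 0) : V * W) | v <- s] g)).
    exact: continuous_pairl.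
  exact: cs.
apply: (derive_along _).1 (ds (x, xi) (v, 0)) => h.
by rewrite -pair_line iter_derive_pairl.
Qed.

End partial_slices.

Section supports.
Context {R : realType} {V : normedModType R}.

Lemma notin_supp (f : V -> R[i]) x : ~ supp f x -> f x = 0.
Proof.
move=> ns; apply: contrapT => /eqP fx; apply: ns; exact: subset_closure.
Qed.

Lemma closed_supp (f : V -> R[i]) : closed (supp f).
Proof. exact: closed_closure. Qed.

Lemma iter_derive_notin_supp (f : V -> R[i]) (g : V -> R) s x :
  (forall x, f x = 0 -> g x = 0) -> ~ supp f x -> iter_derive s g x = 0.
Proof.
move=> fg; apply: (@iter_derive_vanish _ _ (~` supp f)).
  by rewrite openC; exact: closed_supp.
by move=> y /notin_supp; exact: fg.
Qed.

End supports.

Section symbol.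
Context {R : realType} (n : nat).
Local Notation Rn := 'rV[R]_n.
Local Notation leb := (lebesgue_rV n : {measure set Rn -> \bar R}).
Local Notation lebs := (lebesgue_rV n).
Variable a : Rn * Rn -> R[i].
Hypotheses (sa : csmooth a) (ca : compact (supp a)).

Let dirs : seq (Rn * Rn) := [seq (v, 0) | v <- @mixed_dirs R n].
Let Ar := iter_derive dirs (part_Re a).
Let Ai := iter_derive dirs (part_Im a).

Definition mixed_symbol (t xi : Rn) : R[i] := Ar (t, xi) +i* Ai (t, xi).

Let A := mixed_symbol.

Let cts_part (g : Rn * Rn -> R) : smooth g ->
  measurable_fun setT (iter_derive dirs g).
Proof. by move=> sg; apply: continuous_measurable_rV2; have [] := sg dirs. Qed.

Let cmA : cmeasurable setT (fun z : Rn * Rn => A z.1 z.2).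
Proof.
split.
  by rewrite (_ : part_Re _ = Ar); [apply: cts_part; exact: sa.1|apply/funext => -[]].
by rewrite (_ : part_Im _ = Ai); [apply: cts_part; exact: sa.2|apply/funext => -[]].
Qed.

Let cma : cmeasurable setT a.
Proof.
by split; apply: continuous_measurable_rV2; apply: smooth_continuous;
  [exact: sa.1|exact: sa.2].
Qed.

Let A_supp t xi : ~ supp a (t, xi) -> A t xi = 0.
Proof.
move=> ns; apply: complex_eqP => /=; apply: iter_derive_notin_supp ns => z;
  by rewrite /part_Re /part_Im => ->.
Qed.

Let bounded_part (g : Rn * Rn -> R) : smooth g ->
  (forall z, a z = 0 -> g z = 0) ->
  forall s, exists2 M : R, 0 < M & forall z, `|iter_derive s g z| <= M.
Proof.
move=> sg ag s; apply: (@compact_support_bounded _ _ _ _ ca).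
  by have [] := sg s.
by move=> z; exact: iter_derive_notin_supp.
Qed.

Let bounded_cplx (f : Rn * Rn -> R[i]) (g1 g2 : Rn * Rn -> R) :
  (exists2 M : R, 0 < M & forall z, `|g1 z| <= M) ->
  (exists2 M : R, 0 < M & forall z, `|g2 z| <= M) ->
  (forall z, complex.Re (f z) = g1 z) -> (forall z, complex.Im (f z) = g2 z) ->
  exists2 M : R, 0 < M & forall z, cnorm (f z) <= M.
Proof.
move=> [M1 M10 h1] [M2 M20 h2] f1 f2; exists (M1 + M2); first exact: addr_gt0.
move=> z; apply: le_trans (cnorm_le_ReIm _) _.
by rewrite f1 f2; apply: lerD.
Qed.

Let A_bounded : exists2 M : R, 0 < M & forall z, cnorm (A z.1 z.2) <= M.
Proof.
apply: (bounded_cplx (g1 := Ar) (g2 := Ai)); last 2 first.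
- by case.
- by case.
- by apply: bounded_part => [|z]; [exact: sa.1|rewrite /part_Re => ->].
- by apply: bounded_part => [|z]; [exact: sa.2|rewrite /part_Im => ->].
Qed.

Lemma symbol_bounded : exists2 M : R, 0 < M & forall z, cnorm (a z) <= M.
Proof.
apply: (bounded_cplx (g1 := part_Re a) (g2 := part_Im a)) => //.
- by have := @bounded_part _ sa.1 _ [::]; apply => z; rewrite /part_Re => ->.
- by have := @bounded_part _ sa.2 _ [::]; apply => z; rewrite /part_Im => ->.
Qed.

Lemma supp_in_box : exists2 B : R, 0 < B & forall x xi, supp a (x, xi) ->
  box B x /\ box B xi.
Proof.
have /(@compact_bounded _ _)[M0 [_ /(_ (`|M0| + 1))]] := ca.
have M1 : M0 < `|M0| + 1 by apply: le_lt_trans (ler_norm _) _; rewrite ltrDl.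
move=> /(_ M1) H; exists (`|M0| + 1); first by rewrite ltr_wpDl.
move=> x xi /H /=; rewrite prod_normE/= ge_max => /andP[xM xiM].
by split => i; apply: le_trans (rV_coord_le _ _) _.
Qed.

Lemma symbol_mixed_FTC x xi :
  a (x, xi) = cintegral leb setT (fun t => (orth t x)%:C * A t xi).
Proof.
have [B B0 suppB] := supp_in_box.
have out (g : Rn * Rn -> R) : (forall z, a z = 0 -> g z = 0) ->
    forall y, ~ box B y -> g (y, xi) = 0.
  by move=> ag y yB; apply: ag; apply: notin_supp => /suppB[].
apply: complex_eqP => /=.
  have hRe z : a z = 0 -> part_Re a z = 0 by rewrite /part_Re => ->.
  apply: (etrans (mixed_FTC (ltW B0) (smooth_pairl xi sa.1) (out _ hRe) x)).
  apply: eq_Rintegral => t _; rewrite /part_Re ReM /= mul0r subr0.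
  by rewrite /A /mixed_symbol /Ar /= iter_derive_pairl.
have hIm z : a z = 0 -> part_Im a z = 0 by rewrite /part_Im => ->.
apply: (etrans (mixed_FTC (ltW B0) (smooth_pairl xi sa.2) (out _ hIm) x)).
apply: eq_Rintegral => t _; rewrite /part_Im ImM /= mul0r addr0.
by rewrite /A /mixed_symbol /Ai /= iter_derive_pairl.
Qed.

(** Freezing [t] in [a (x, xi) = \int_t orth t x * A t xi] decouples [x] from
    [xi]: what remains is the pairing of [F] with the Fourier transform of
    [orth t * w], a function of the same size as [w]. The inequality
    [p * q <= p ^ 2 / delta + delta * q ^ 2] and [plancherel_box] bound it for each
    [t], and [t] ranges over a bounded box. This plays the role of the boundedness
    on L^2 of pseudodifferential operators. The parameter [delta] is left free so
    that one factor may tend to 0 while the other one is only bounded. *)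
Theorem pairing_bound (B Rr : R) : 0 < B -> 0 < Rr ->
  exists2 K : R, 0 < K &
  forall (chi : Rn -> R) (F : Rn -> R[i]) (w : Rn -> R[i]) (MF s delta : R),
  measurable_fun setT chi -> (forall xi, 0 <= chi xi <= box1 Rr xi) ->
  (forall x xi, supp a (x, xi) -> chi xi = 1) ->
  cmeasurable setT F -> (forall xi, cnorm (F xi) <= MF) -> s != 0 ->
  L2box B w -> 0 < delta ->
  cnorm (cintegral leb setT (fun x =>
    cintegral leb setT (fun xi => cis (s * dotR x xi) * a (x, xi) * F xi) * w x))
  <= K * (delta^-1 * \int[leb]_xi (chi xi * cnorm (F xi) ^+ 2)
          + delta * (`|s| ^- n * sqnorm w)).
Proof.
move=> B0 R0.
have [M M0 AM] := A_bounded; have [Ma Ma0 aM] := symbol_bounded.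
have [Ba Ba0 suppB] := supp_in_box.
pose Cp := plancherel_cst n Rr.
have Cp0 : 0 <= Cp by exact: plancherel_cst_ge0.
exists (4 * M * (2 * Ba) ^+ n * (1 + Cp)).
  by rewrite !mulr_gt0 ?exprn_gt0 ?mulr_gt0// ltr_wpDr.
move=> chi F w MF s delta mchi chi01 chi1 mF FM s0 wB d0.
have [mw iw w0] := wB.
have icw := L2box_integrable_cnorm wB.
have MF0 : 0 <= MF by apply: le_trans (FM 0); exact: cnorm_ge0.
have chi0 xi : 0 <= chi xi by have /andP[] := chi01 xi.
have chib xi : chi xi <= box1 Rr xi by have /andP[] := chi01 xi.
have a_chi x xi : cnorm (a (x, xi)) <= Ma * chi xi.
  have [/chi1 ->|/notin_supp ->] := pselect (supp a (x, xi)); first by rewrite mulr1.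
  by rewrite cnorm0 mulr_ge0// ltW.
have A_chi t xi : cnorm (A t xi) <= M * box1 Ba t * chi xi.
  have [sp|/A_supp ->] := pselect (supp a (t, xi)); last first.
    by rewrite cnorm0 !mulr_ge0 ?box1_ge0// ltW.
  by rewrite (chi1 _ _ sp) (box1_in (suppB _ _ sp).1) !mulr1; exact: AM (t, xi).
have ichi : leb.-integrable setT (EFin \o chi).
  apply: (integrable_dominated measurableT _ (integrable_box1 n Rr)) => //.
  by move=> xi _; rewrite ger0_norm.
have m1 : measurable_fun setT (fun z : Rn * Rn => z.1) := measurable_fst.
have m2 : measurable_fun setT (fun z : Rn * Rn => z.2) := measurable_snd.
have mwave d (T : measurableType d) (f g : T -> Rn) : measurable_fun setT f ->
    measurable_fun setT g -> cmeasurable setT (fun z => cis (s * dotR (f z) (g z))).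
  move=> mf mg; apply: cmeasurable_cis; apply: measurable_funM.
    exact: measurable_cst.
  exact: measurable_dotR.
pose wt (t x : Rn) : R[i] := (orth t x)%:C * w x.
have wtB t : L2box B (wt t) /\ sqnorm (wt t) <= 1 ^+ 2 * sqnorm w.
  apply: L2boxM => //.
    apply: cmeasurable_real; apply: measurable_orth; first exact: measurable_cst.
    exact: measurable_id.
  by move=> x; rewrite cnorm_real ger0_norm ?orth_ge0// orth_le1.
(* The xi integral goes outside, so that the symbol can be expanded at fixed xi. *)
have -> : cintegral leb setT (fun x =>
    cintegral leb setT (fun xi => cis (s * dotR x xi) * a (x, xi) * F xi) * w x) =
  cintegral leb setT (fun xi => cintegral leb setT (fun x =>
    cis (s * dotR x xi) * a (x, xi) * F xi * w x)).
  rewrite -(@cintegral_swap _ _ _ _ _ lebs lebs (fun z : Rn * Rn =>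
    cis (s * dotR z.1 z.2) * a z * F z.2 * w z.1)
    (fun x => cnorm (w x)) (fun xi => Ma * MF * chi xi)).
  - apply: eq_cintegral => x _; rewrite mulrC -cintegralZ//.
      by apply: eq_cintegral => xi _; rewrite mulrC.
    apply: (cintegrable_dominated measurableT _ (integrableZR (Ma * MF) ichi)).
      apply: cmeasurableM => //; apply: cmeasurableM.
        by apply: mwave; [exact: measurable_cst|exact: measurable_id].
      exact: (cmeasurable_comp cma (measurable_pair1 x)).
    move=> xi _; rewrite !cnormM cnorm_cis mul1r mulrAC.
    by apply: ler_pM; rewrite ?cnorm_ge0.
  - apply: cmeasurableM; last exact: (cmeasurable_comp mw m1).
    apply: cmeasurableM; last exact: (cmeasurable_comp mF m2).
    by apply: cmeasurableM => //; exact: mwave.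
  - exact: icw.
  - exact: integrableZR.
  - by move=> x; exact: cnorm_ge0.
  - by move=> xi; rewrite !mulr_ge0// ltW.
  - move=> x xi /=; rewrite mulrC !cnormM cnorm_cis mul1r.
    apply: ler_wpM2l; first exact: cnorm_ge0.
    by rewrite mulrAC; apply: ler_pM; rewrite ?cnorm_ge0.
(* Expanding the symbol in t leaves the transform of the truncation wt t of w. *)
have inner xi : cintegral leb setT (fun x =>
    cis (s * dotR x xi) * a (x, xi) * F xi * w x) =
  cintegral leb setT (fun t => F xi * A t xi * FT s (wt t) xi).
  transitivity (cintegral leb setT (fun x => cintegral leb setT (fun t =>
    F xi * A t xi * (cis (s * dotR x xi) * wt t x)))).
    apply: eq_cintegral => x _.
    rewrite symbol_mixed_FTC.
    have -> (I : R[i]) : cis (s * dotR x xi) * I * F xi * w x =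
      (cis (s * dotR x xi) * F xi * w x) * I by ring.
    rewrite -cintegralZ//.
      by apply: eq_cintegral => t _; rewrite /wt; ring.
    apply: (cintegrable_dominated measurableT _ (integrableZR (M * chi xi) (integrable_box1 n Ba))).
      apply: cmeasurableM.
        apply: cmeasurable_real; apply: measurable_orth; first exact: measurable_id.
        exact: measurable_cst.
      exact: (cmeasurable_comp cmA (measurable_pair2 xi)).
    move=> t _; rewrite cnormM cnorm_real ger0_norm ?orth_ge0// mulrAC.
    by apply: le_trans (A_chi t xi); apply: ler_piMl; [exact: cnorm_ge0|exact: orth_le1].
  have mwt : cmeasurable setT (fun z : Rn * Rn => wt z.2 z.1).
    apply: cmeasurableM; last exact: (cmeasurable_comp mw m1).
    by apply: cmeasurable_real; exact: measurable_orth.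
  rewrite (@cintegral_swap _ _ _ _ _ lebs lebs (fun z : Rn * Rn =>
    F xi * A z.2 xi * (cis (s * dotR z.1 xi) * wt z.2 z.1))
    (fun x => cnorm (w x)) (fun t => MF * M * box1 Ba t)).
  - apply: eq_cintegral => t _; rewrite /FT -cintegralZ//.
    exact: (FT_integrable s xi (wtB t).1).
  - apply: cmeasurableM.
      apply: cmeasurableM; first exact: cmeasurable_cst.
      exact: (cmeasurable_comp (cmeasurable_comp cmA (measurable_pair2 xi)) m2).
    apply: cmeasurableM => //; apply: mwave => //; exact: measurable_cst.
  - exact: icw.
  - exact/integrableZR/integrable_box1.
  - by move=> x; exact: cnorm_ge0.
  - by move=> t; rewrite !mulr_ge0 ?box1_ge0// ltW.
  - move=> x t /=; rewrite mulrC !cnormM cnorm_cis mul1r cnorm_real.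
    apply: ler_pM; rewrite ?mulr_ge0 ?cnorm_ge0//.
      by apply: ler_piMl; [exact: cnorm_ge0|rewrite ger0_norm ?orth_ge0 ?orth_le1].
    rewrite -mulrA; apply: ler_pM; rewrite ?cnorm_ge0//.
    apply: le_trans (A_chi t xi) _; apply: ler_piMr.
      by rewrite mulr_ge0 ?box1_ge0// ltW.
    exact: le_trans (chib xi) (box1_le1 _ _).
rewrite (_ : (fun xi => _) = (fun xi => cintegral leb setT
  (fun t => F xi * A t xi * FT s (wt t) xi))); last exact/funext/inner.
have mFT : cmeasurable setT (fun z : Rn * Rn => FT s (wt z.2) z.1).
  have mj : cmeasurable setT (fun y : (Rn * Rn) * Rn =>
      cis (s * dotR y.2 y.1.1) * wt y.1.2 y.2).
    have n11 : measurable_fun setT (fun y : (Rn * Rn) * Rn => y.1.1).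
      exact: (measurableT_comp measurable_fst measurable_fst).
    have n12 : measurable_fun setT (fun y : (Rn * Rn) * Rn => y.1.2).
      exact: (measurableT_comp measurable_snd measurable_fst).
    have n2 : measurable_fun setT (fun y : (Rn * Rn) * Rn => y.2) := measurable_snd.
    apply: cmeasurableM; first exact: mwave.
    apply: cmeasurableM; last exact: (cmeasurable_comp mw n2).
    by apply: cmeasurable_real; exact: measurable_orth.
  exact: (cmeasurable_cintegral2 lebs mj).
pose W := 2 * \int[leb]_x cnorm (w x).
have W0 : 0 <= W by rewrite mulr_ge0 ?Rintegral_ge0// => x _; exact: cnorm_ge0.
have FTW t xi : cnorm (FT s (wt t) xi) <= W.
  apply: cnorm_cintegral_le.
  - by have [[m _ _] _] := wtB t; apply: cmeasurableM => //; exact: cmeasurable_wave.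
  - exact: icw.
  - move=> x; rewrite !cnormM cnorm_cis mul1r cnorm_real.
    by apply: ler_piMl; [exact: cnorm_ge0|rewrite ger0_norm ?orth_ge0 ?orth_le1].
pose G (z : Rn * Rn) := (M * box1 Ba z.2) * (chi z.1 *
  (delta^-1 * cnorm (F z.1) ^+ 2 + delta * cnorm (FT s (wt z.2) z.1) ^+ 2)).
have mG : measurable_fun setT G.
  apply: measurable_funM.
    apply: measurable_funM; first exact: measurable_cst.
    exact: (measurableT_comp (@measurable_box1 R n Ba) m2).
  apply: measurable_funM; first exact: (measurableT_comp mchi m1).
  apply: measurable_funD; apply: measurable_funM; try exact: measurable_cst.
    exact: (measurable_sqr_cnorm (cmeasurable_comp mF m1)).
  exact: measurable_sqr_cnorm.
have dV0 : 0 <= delta^-1 by rewrite invr_ge0 ltW.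
have sum_ge0 z : 0 <= delta^-1 * cnorm (F z.1) ^+ 2 +
    delta * cnorm (FT s (wt z.2) z.1) ^+ 2.
  by apply: addr_ge0; apply: mulr_ge0; rewrite ?sqr_ge0// ltW.
have G0 z : 0 <= G z.
  apply: mulr_ge0; first by apply: mulr_ge0; [exact: ltW|exact: box1_ge0].
  by apply: mulr_ge0.
pose CG := delta^-1 * MF ^+ 2 + delta * W ^+ 2.
have CG0 : 0 <= CG by apply: addr_ge0; apply: mulr_ge0; rewrite ?sqr_ge0// ltW.
have sqle (p q : R) : 0 <= p -> p <= q -> p ^+ 2 <= q ^+ 2.
  by move=> p0 pq; rewrite ler_sqr ?nnegrE// (le_trans p0).
have Gle xi t : `|G (xi, t)| <= (CG * chi xi) * (M * box1 Ba t).
  rewrite (ger0_norm (G0 _)) /G/= mulrC; apply: ler_wpM2r.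
    by apply: mulr_ge0; [exact: ltW|exact: box1_ge0].
  rewrite mulrC; apply: ler_wpM2r => //; apply: lerD; apply: ler_wpM2l => //.
  - exact: (sqle _ _ (cnorm_ge0 _) (FM xi)).
  - exact: ltW.
  - exact: (sqle _ _ (cnorm_ge0 _) (FTW t xi)).
have ip : leb.-integrable setT (EFin \o (fun xi => CG * chi xi)) by exact: integrableZR.
have iq : leb.-integrable setT (EFin \o (fun t => M * box1 Ba t)).
  exact/integrableZR/integrable_box1.
have pt xi t : cnorm (F xi * A t xi * FT s (wt t) xi) <= G (xi, t).
  rewrite !cnormM /G/= mulrAC mulrC mulrA.
  apply: (@le_trans _ _ ((M * box1 Ba t * chi xi) * (cnorm (F xi) * cnorm (FT s (wt t) xi)))).
    exact: (ler_wpM2r (mulr_ge0 (cnorm_ge0 _) (cnorm_ge0 _)) (A_chi t xi)).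
  apply: ler_wpM2l; first by rewrite !mulr_ge0 ?box1_ge0// ltW.
  set p := cnorm (F xi); set q := cnorm _.
  have dd : delta^-1 * delta = 1 by rewrite mulVf// gt_eqF.
  have h1 : 0 <= delta^-1 * (p - delta * q) ^+ 2 by rewrite mulr_ge0 ?sqr_ge0.
  have h2 : delta^-1 * (p - delta * q) ^+ 2 =
    delta^-1 * p ^+ 2 - (delta^-1 * delta) * (p * q) *+ 2 + (delta^-1 * delta) * delta * q ^+ 2.
    by ring.
  rewrite h2 dd !mul1r in h1.
  have pq : 0 <= p * q by rewrite mulr_ge0 ?cnorm_ge0.
  by move: h1 pq; lra.
have mint : cmeasurable setT (fun z : Rn * Rn => F z.1 * A z.2 z.1 * FT s (wt z.2) z.1).
  apply: cmeasurableM => //; apply: cmeasurableM; first exact: (cmeasurable_comp mF m1).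
  have sw : measurable_fun setT (fun z : Rn * Rn => (z.2, z.1)).
    exact/measurable_fun_pair.
  exact: (cmeasurable_comp cmA sw).
have iG1 xi : leb.-integrable setT (EFin \o (fun t => G (xi, t))).
  exact: (@dominated_section_integrable _ _ _ _ _ lebs G _ _ mG iq Gle).
have step1 xi : cnorm (cintegral leb setT (fun t => F xi * A t xi * FT s (wt t) xi))
    <= 2 * \int[leb]_t G (xi, t).
  apply: cnorm_cintegral_le => //.
  exact: (cmeasurable_comp mint (measurable_pair1 xi)).
have iGG : leb.-integrable setT (EFin \o (fun xi => \int[leb]_t G (xi, t))).
  exact: (@integrable_Rintegral2 _ _ _ _ _ lebs lebs G _ _ mG ip iq Gle).
apply: (@le_trans _ _ (2 * \int[leb]_xi (2 * \int[leb]_t G (xi, t)))).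
  apply: cnorm_cintegral_le => //; last exact: integrableZR.
  exact: (cmeasurable_cintegral2 lebs mint).
rewrite (RintegralZl _ measurableT iGG).
have q0 (t : Rn) : 0 <= M * box1 Ba t by apply: mulr_ge0; [exact: ltW|exact: box1_ge0].
rewrite (@Rintegral_swap _ _ _ _ _ lebs lebs G _ _ mG ip iq _ q0 Gle); last first.
  by move=> xi; apply: mulr_ge0.
set D := \int[leb]_xi (chi xi * cnorm (F xi) ^+ 2).
set E := `|s| ^- n * sqnorm w.
have E0 : 0 <= E by rewrite mulr_ge0 ?sqnorm_ge0// invr_ge0 exprn_ge0.
have D0 : 0 <= D by apply: Rintegral_ge0 => xi _; rewrite mulr_ge0 ?sqr_ge0.
have ib (g : Rn -> R[i]) (C : R) : cmeasurable setT g -> (forall xi, cnorm (g xi) <= C) ->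
    leb.-integrable setT (EFin \o (fun xi => chi xi * cnorm (g xi) ^+ 2)).
  move=> mg gC; apply: (integrable_dominated measurableT _ (integrableZR (C ^+ 2) ichi)).
    by apply: measurable_funM => //; exact: measurable_sqr_cnorm.
  move=> xi _; rewrite (ger0_norm (mulr_ge0 (chi0 xi) (sqr_ge0 _))) mulrC.
  exact: (ler_wpM2r (chi0 xi) (sqle _ _ (cnorm_ge0 _) (gC xi))).
have mFTt t : cmeasurable setT (FT s (wt t)).
  by have [[m _ _] _] := wtB t; exact: cmeasurable_FT.
have step2 t : \int[leb]_xi G (xi, t) <=
    M * box1 Ba t * (delta^-1 * D + delta * (Cp * E)).
  have i1 := integrableZR delta^-1 (ib _ _ mF FM).
  have i2 := integrableZR delta (ib _ _ (mFTt t) (FTW t)).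
  have -> : \int[leb]_xi G (xi, t) = M * box1 Ba t * (delta^-1 * D +
      delta * \int[leb]_xi (chi xi * cnorm (FT s (wt t) xi) ^+ 2)).
    rewrite -(RintegralZl _ measurableT (ib _ _ mF FM)).
    rewrite -(RintegralZl _ measurableT (ib _ _ (mFTt t) (FTW t))).
    rewrite -(RintegralD measurableT i1 i2) -(RintegralZl _ measurableT (integrableDR i1 i2)).
    by apply: eq_Rintegral => xi _; rewrite /G/=; ring.
  apply: ler_wpM2l => //; apply: lerD => //; apply: ler_wpM2l; first exact: ltW.
  have [wtL wtN] := wtB t.
  apply: (@le_trans _ _ (\int[leb]_xi (box1 Rr xi * cnorm (FT s (wt t) xi) ^+ 2))).
    apply: le_Rintegral => //.
    - exact: ib (mFTt t) (FTW t).
    - exact: integrable_box_FT wtL.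
    - by move=> xi _; apply: ler_wpM2r => //; exact: sqr_ge0.
  apply: le_trans (plancherel_box R0 B0 s0 wtL) _.
  rewrite -/Cp -mulrA; apply: ler_wpM2l => //; apply: ler_wpM2l.
    by rewrite invr_ge0 exprn_ge0.
  by apply: le_trans wtN _; rewrite expr1n mul1r.
set Q := delta^-1 * D + delta * (Cp * E).
have jG : leb.-integrable setT (EFin \o (fun t => \int[leb]_xi G (xi, t))).
  have sw : measurable_fun setT (fun z : Rn * Rn => (z.2, z.1)) by exact/measurable_fun_pair.
  apply: (@integrable_Rintegral2 _ _ _ _ _ lebs lebs (fun z => G (z.2, z.1)) _ _
    (measurableT_comp mG sw) iq ip) => t xi /=.
  by rewrite mulrC.
apply: (@le_trans _ _ (4 * \int[leb]_t (Q * (M * box1 Ba t)))).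
  rewrite (_ : 4 = 2 * 2 :> R) ?mulrA; last by ring.
  apply: ler_wpM2l; first by rewrite mulr_ge0.
  apply: le_Rintegral => //; first exact: integrableZR.
  by move=> t _; rewrite mulrC; exact: step2.
rewrite (RintegralZl _ measurableT iq) (RintegralZl _ measurableT (integrable_box1 n Ba)).
rewrite (Rintegral_box1 n (ltW Ba0)).
have -> : 4 * (Q * (M * (2 * Ba) ^+ n)) = 4 * M * (2 * Ba) ^+ n * Q by ring.
rewrite -[leRHS]mulrA; apply: ler_wpM2l.
  by rewrite !mulr_ge0 ?exprn_ge0 ?mulr_ge0// ltW.
have dD : 0 <= delta^-1 * D by rewrite mulr_ge0.
have dE : 0 <= delta * E by rewrite mulr_ge0// ltW.
have -> : Q = delta^-1 * D + Cp * (delta * E) by rewrite /Q; ring.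
rewrite -/D -/E mulrDl mul1r.
by rewrite mulrDr; move: dD dE (mulr_ge0 Cp0 dD) (mulr_ge0 Cp0 dE); lra.
Qed.

End symbol.

(** * Symmetry of second derivatives *)

Section symmetry_of_second_derivatives.
Context {R : realType} {V : normedModType R}.
Implicit Types (f : V -> R) (u v x : V).

Lemma is_derive_along f u y (t : R) : smooth f ->
  is_derive t 1 (fun t => f (t *: u + y)) ('D_u f (t *: u + y)).
Proof.
move=> sf.
have line (h : R) : f (h *: u + (t *: u + y)) = f ((h *: 1 + t) *: u + y).
  by rewrite addrA -scalerDl [h *: 1]mulr1.
have [dg Dg] := @derive_along R V (R : normedModType R) f
  (fun t => f (t *: u + y)) (t *: u + y) u t 1 line.
by split; [apply: dg; exact: smooth_derivable|rewrite -Dg].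
Qed.

Lemma MVT_along f u y (h : R) : smooth f -> 0 < h ->
  exists2 c : R, 0 <= c <= h & f (h *: u + y) - f y = 'D_u f (c *: u + y) * h.
Proof.
move=> sf h0.
have d t := is_derive_along u y t sf.
have cts : {within `[0, h], continuous (fun t : R => f (t *: u + y))}.
  apply: continuous_subspaceT => t; apply: differentiable_continuous.
  by apply/derivable1_diffP; have [] := d t.
have [c ch E] := @MVT R _ _ 0 h h0 (fun t _ => d t) cts.
exists c; first by move: ch; rewrite in_itv/= => /andP[c0 c1]; rewrite !ltW.
by move: E; rewrite scale0r add0r subr0.
Qed.

Lemma second_difference f u v x (h : R) : smooth f -> 0 < h ->
  exists c d : R, [/\ 0 <= c <= h, 0 <= d <= h &
  f (h *: u + (h *: v + x)) - f (h *: u + x) - f (h *: v + x) + f x =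
  'D_v (fun y => 'D_u f y) (d *: v + (c *: u + x)) * h ^+ 2].
Proof.
move=> sf h0.
pose g y := f (h *: v + y) - f y.
have sT : smooth (fun y => f (h *: v + y)).
  have E s y : iter_derive s (fun y => f (h *: v + y)) y = iter_derive s f (h *: v + y).
    elim: s y => [//|w s IH] y /=.
    apply: (derive_along _).2 => k; rewrite IH; congr (iter_derive s f _).
    by rewrite addrCA.
  move=> s; have [cs ds] := sf s; split.
    have -> : iter_derive s (fun y => f (h *: v + y)) =
      (fun y => iter_derive s f (h *: v + y)) by apply/funext => y; exact: E.
    move=> y; apply: (@continuous_comp _ _ _ (fun y => h *: v + y) (iter_derive s f)).
      by apply: cvgD; [exact: cvg_cst|exact: cvg_id].
    exact: cs.
  move=> y w; apply: (derive_along _).1 (ds (h *: v + y) w) => k.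
  by rewrite E; congr (iter_derive s f _); rewrite addrCA.
have sg : smooth g by exact: smoothB.
have [c ch Ec] := MVT_along u x sg h0.
have Dg y : 'D_u g y = 'D_u f (h *: v + y) - 'D_u f y.
  rewrite (deriveBE u y sT sf); congr (_ - _); apply: (derive_along _).2 => k.
  by rewrite addrCA.
have [d dh Ed] := MVT_along v (c *: u + x) (smooth_derive u sf) h0.
exists c, d; split => //.
rewrite expr2 mulrA -Ed -Dg -Ec /g (addrCA (h *: v)).
by rewrite opprB addrACA addrA; ring.
Qed.

Lemma two_parameter_continuity f u v x (e : R) : continuous f -> 0 < e ->
  exists2 r : R, 0 < r & forall c d : R, 0 <= c <= r -> 0 <= d <= r ->
    `|f (d *: v + (c *: u + x)) - f x| < e.
Proof.
move=> cf e0; have /cvgrPdist_lt/(_ e e0)/nbhs_ballP[r /= r0 rf] := cf x.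
pose m := `|u| + `|v| + 1.
have m0 : 0 < m by rewrite ltr_wpDl// addr_ge0.
exists (r / m / 2); first by rewrite !divr_gt0.
move=> c d /andP[c0 cr] /andP[d0 dr].
rewrite distrC; apply: rf; rewrite -ball_normE /= addrA opprD addrCA subrr addr0.
rewrite normrN; apply: le_lt_trans (ler_normD _ _) _; rewrite !normrZ.
rewrite (ger0_norm c0) (ger0_norm d0).
apply: (@le_lt_trans _ _ (r / m / 2 * m)).
  apply: (@le_trans _ _ (r / m / 2 * (`|v| + `|u|))).
    by rewrite mulrDr lerD// ler_wpM2r.
  apply: ler_wpM2l; first by rewrite !divr_ge0 ?ltW.
  by rewrite /m; lra.
have -> : r / m / 2 * m = r / 2 by field; rewrite gt_eqF.
by rewrite ltr_pdivrMr// mulr_natr mulr2n ltrDl.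
Qed.

Lemma close_to_both (z p q e : R) :
  `|z - p| < e / 2 -> `|z - q| < e / 2 -> `|q - p| <= e.
Proof.
move=> zp zq; have -> : q - p = (z - p) - (z - q) by ring.
by apply: le_trans (ler_normB _ _) _; move: zp zq; lra.
Qed.

(** The same second difference is equal to either mixed derivative at some
    nearby point ([second_difference]), and both are continuous. *)
Lemma clairaut f u v x : smooth f ->
  'D_v (fun y => 'D_u f y) x = 'D_u (fun y => 'D_v f y) x.
Proof.
move=> sf; apply/eqP; rewrite -subr_eq0 -normr_eq0 eq_le normr_ge0 andbT.
apply/ler_addgt0Pr => e e0; rewrite add0r.
have e20 : 0 < e / 2 by rewrite divr_gt0.
have c1 : continuous (fun x => 'D_v (fun y => 'D_u f y) x).
  by apply: smooth_continuous; do 2 apply: smooth_derive.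
have c2 : continuous (fun x => 'D_u (fun y => 'D_v f y) x).
  by apply: smooth_continuous; do 2 apply: smooth_derive.
have [r1 r10 H1] := two_parameter_continuity u v x c1 e20.
have [r2 r20 H2] := two_parameter_continuity v u x c2 e20.
pose h := Num.min r1 r2.
have h0 : 0 < h by rewrite lt_min r10 r20.
have h1 : h <= r1 by rewrite ge_min lexx.
have h2 : h <= r2 by rewrite ge_min lexx orbT.
have [c [d [/andP[ca cb] /andP[da db] E]]] := second_difference u v x sf h0.
have [c' [d' [/andP[ca' cb'] /andP[da' db'] E']]] := second_difference v u x sf h0.
have EE : 'D_v (fun y => 'D_u f y) (d *: v + (c *: u + x)) =
    'D_u (fun y => 'D_v f y) (d' *: u + (c' *: v + x)).
  apply: (mulIf (x := h ^+ 2)); first by rewrite expf_neq0// gt_eqF.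
  apply: (etrans (esym E)); apply: etrans _ E'.
  by rewrite (addrCA (h *: u)) (addrAC (f (h *: v + (h *: u + x)))).
have := H1 c d; rewrite ca da (le_trans cb h1) (le_trans db h1) => /(_ isT isT) K1.
have := H2 c' d'; rewrite ca' da' (le_trans cb' h2) (le_trans db' h2) => /(_ isT isT) K2.
by rewrite EE in K1; exact: (close_to_both K2 K1).
Qed.

End symmetry_of_second_derivatives.

(** * Complex-valued test functions *)

Section complex_calculus.
Context {R : realType} {V : normedModType R}.
Implicit Types (f g : V -> R[i]) (v w x : V).

Lemma csmoothD f g : csmooth f -> csmooth g -> csmooth (fun x => f x + g x).
Proof.
move=> [f1 f2] [g1 g2]; split.
  have -> : part_Re (fun x => f x + g x) = (fun x => part_Re f x + part_Re g x).
    by apply/funext => x; exact: ReD.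
  exact: smoothD.
have -> : part_Im (fun x => f x + g x) = (fun x => part_Im f x + part_Im g x).
  by apply/funext => x; exact: ImD.
exact: smoothD.
Qed.

Lemma part_ReM f g : part_Re (fun x => f x * g x) =
  (fun x => part_Re f x * part_Re g x - part_Im f x * part_Im g x).
Proof. by apply/funext => x; exact: ReM. Qed.

Lemma part_ImM f g : part_Im (fun x => f x * g x) =
  (fun x => part_Re f x * part_Im g x + part_Im f x * part_Re g x).
Proof. by apply/funext => x; exact: ImM. Qed.

Lemma csmoothM f g : csmooth f -> csmooth g -> csmooth (fun x => f x * g x).
Proof.
move=> [f1 f2] [g1 g2]; split.
  by rewrite part_ReM; apply: smoothB; exact: smoothM.
by rewrite part_ImM; apply: smoothD; exact: smoothM.
Qed.

Lemma csmooth_cst (c : R[i]) : csmooth (fun _ : V => c).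
Proof. by split; exact: smooth_cst. Qed.

Lemma csmooth_derive f v : csmooth f -> csmooth (cderive v f).
Proof. by move=> [f1 f2]; split; exact: smooth_derive. Qed.

Lemma csmooth_sum I (r : seq I) (F : I -> V -> R[i]) :
  (forall i, csmooth (F i)) -> csmooth (fun x => \sum_(i <- r) F i x).
Proof.
move=> sF; elim: r => [|i r IH].
  by under [X in csmooth X]eq_fun do rewrite big_nil; exact: csmooth_cst.
by under [X in csmooth X]eq_fun do rewrite big_cons; exact: csmoothD.
Qed.

Lemma cderiveD f g v x : csmooth f -> csmooth g ->
  cderive v (fun x => f x + g x) x = cderive v f x + cderive v g x.
Proof.
move=> [f1 f2] [g1 g2]; apply: complex_eqP; rewrite ?ReD ?ImD /=.
  rewrite -deriveDE//; congr ('D_v _ x).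
  by apply/funext => y; exact: ReD.
rewrite -deriveDE//; congr ('D_v _ x).
by apply/funext => y; exact: ImD.
Qed.

Lemma cderiveM f g v x : csmooth f -> csmooth g ->
  cderive v (fun x => f x * g x) x = f x * cderive v g x + g x * cderive v f x.
Proof.
move=> [f1 f2] [g1 g2].
have m1 := smoothM f1 g1; have m2 := smoothM f2 g2.
have m3 := smoothM f1 g2; have m4 := smoothM f2 g1.
apply: complex_eqP; rewrite ?ReD ?ImD ?ReM ?ImM /cderive [LHS]/=.
  rewrite part_ReM (deriveBE v x m1 m2) (deriveME v x f1 g1) (deriveME v x f2 g2).
  by rewrite /part_Re /part_Im /= opprD addrACA.
rewrite part_ImM (deriveDE v x m3 m4) (deriveME v x f1 g2) (deriveME v x f2 g1).
rewrite /part_Re /part_Im /=; set p : R := 'D_v _ x; set q : R := 'D_v _ x.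
move: p q => p q; set p' : R := 'D_v _ x; set q' : R := 'D_v _ x.
by move: p' q' => p' q'; ring.
Qed.

Lemma cderive_cst (c : R[i]) v x : cderive v (fun=> c) x = 0.
Proof. by apply: complex_eqP => /=; exact: derive_cst. Qed.

Lemma cderive_sum I (r : seq I) (F : I -> V -> R[i]) v x :
  (forall i, csmooth (F i)) ->
  cderive v (fun x => \sum_(i <- r) F i x) x = \sum_(i <- r) cderive v (F i) x.
Proof.
move=> sF; elim: r => [|i r IH].
  by under [X in cderive v X]eq_fun do rewrite big_nil; rewrite big_nil cderive_cst.
rewrite big_cons -IH -(cderiveD _ _ (sF i) (csmooth_sum r sF)).
have -> : (fun x => \sum_(j <- i :: r) F j x) =
  (fun x => F i x + \sum_(j <- r) F j x) by apply/funext => y; rewrite big_cons.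
by [].
Qed.

Lemma cderiveC f v w x : csmooth f ->
  cderive v (cderive w f) x = cderive w (cderive v f) x.
Proof. by move=> [f1 f2]; apply: complex_eqP => /=; exact: clairaut. Qed.

Lemma cderive_notin_supp f v x : ~ supp f x -> cderive v f x = 0.
Proof.
move=> ns; apply: complex_eqP => /=.
  by apply: (@iter_derive_notin_supp _ _ f _ [:: v] x _ ns) => y; rewrite /part_Re => ->.
by apply: (@iter_derive_notin_supp _ _ f _ [:: v] x _ ns) => y; rewrite /part_Im => ->.
Qed.

Lemma Cc_oo_sub (U : set V) f g : Cc_oo U f -> csmooth g ->
  (forall x, ~ supp f x -> g x = 0) -> Cc_oo U g.
Proof.
move=> [_ cf fU] sg gf.
have gsub : supp g `<=` supp f.
  move=> x gx; apply: (@closed_supp _ _ f) => B xB; have [y [gy By]] := gx B xB.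
  by exists y; split=> //; apply: contrapT => /gf; exact/eqP.
split=> //; last exact: subset_trans fU.
apply: subclosed_compact cf gsub; exact: closed_supp.
Qed.

Lemma Cc_oo_derive (U : set V) f v : Cc_oo U f -> Cc_oo U (cderive v f).
Proof.
move=> fU; apply: (Cc_oo_sub fU).
  by apply: csmooth_derive; have [] := fU.
by move=> x; exact: cderive_notin_supp.
Qed.

Lemma Cc_oo_bounded (U : set V) f : Cc_oo U f ->
  exists2 M : R, 0 < M & forall x, cnorm (f x) <= M.
Proof.
move=> [[f1 f2] cf _].
have [|x /notin_supp|M1 M10 h1] := @compact_support_bounded R _ _ (part_Re f) cf.
- exact: smooth_continuous.
- by rewrite /part_Re => ->.
have [|x /notin_supp|M2 M20 h2] := @compact_support_bounded R _ _ (part_Im f) cf.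
- exact: smooth_continuous.
- by rewrite /part_Im => ->.
exists (M1 + M2); first exact: addr_gt0.
by move=> x; apply: le_trans (cnorm_le_ReIm _) _; exact: (lerD (h1 x) (h2 x)).
Qed.

End complex_calculus.

(** * Localized plane waves *)

Section plane_wave_test_functions.
Context {R : realType} {d : nat}.
Local Notation Rd := 'rV[R]_d.
Implicit Types (xi : Rd) (s : R).

Definition wave s xi (x : Rd) : R[i] := cis (s * dotR x xi).

Let lD s xi (h : R) (v x : Rd) :
  s * dotR (h *: v + x) xi = h * (s * dotR v xi) + s * dotR x xi.
Proof. by rewrite dotRD dotRZ; ring. Qed.

Let cl s xi : continuous (fun x : Rd => s * dotR x xi).
Proof.
apply: ctsM; first exact: ctsC.
have -> : (fun x : Rd => dotR x xi) = dotR xi by apply/funext => x; exact: dotRC.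
exact: continuous_dotR.
Qed.

Lemma csmooth_wave s xi : csmooth (wave s xi).
Proof.
split.
  exact: (smooth_cos_linear (lD s xi) (@cl s xi)).
exact: (smooth_sin_linear (lD s xi) (@cl s xi)).
Qed.

Lemma dotR_ebasis (i : 'I_d) xi : dotR (ebasis i) xi = xi ord0 i.
Proof.
rewrite /dotR (bigD1 i)//= big1 ?addr0 => [|j ji].
  by rewrite !mxE !eqxx mul1r.
by rewrite !mxE (negbTE ji) mul0r.
Qed.

(** The factor by which the [i]-th derivative multiplies a plane wave. *)
Definition ifreq s xi (i : 'I_d) : R[i] := 0 +i* (s * xi ord0 i).

Lemma cderive_wave s xi (i : 'I_d) x :
  cderive (ebasis i) (wave s xi) x = ifreq s xi i * wave s xi x.
Proof.
apply: complex_eqP; rewrite ?ReM ?ImM /=.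
  have := derive_cos_linear (lD s xi) (ebasis i) x.
  by rewrite dotR_ebasis mul0r sub0r.
have := derive_sin_linear (lD s xi) (ebasis i) x.
by rewrite dotR_ebasis mul0r add0r.
Qed.

Lemma Cc_oo_wave (U : set Rd) s xi phi : Cc_oo U phi ->
  Cc_oo U (fun x => wave s xi x * phi x).
Proof.
move=> phiU; apply: (Cc_oo_sub phiU).
  by apply: csmoothM; [exact: csmooth_wave|have [] := phiU].
by move=> x /notin_supp ->; rewrite mulr0.
Qed.

Lemma cderive_wave_mul s xi (i : 'I_d) phi x : csmooth phi ->
  cderive (ebasis i) (fun x => wave s xi x * phi x) x =
  wave s xi x * (ifreq s xi i * phi x + cderive (ebasis i) phi x).
Proof.
move=> sphi; rewrite (cderiveM _ _ (csmooth_wave s xi) sphi) cderive_wave.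
by ring.
Qed.

End plane_wave_test_functions.

(** * Weak form of the Stokes system *)

Section distributions.
Context {R : realType} {d : nat}.
Local Notation Rd := 'rV[R]_d.
Local Notation leb := (lebesgue_rV d : {measure set Rd -> \bar R}).
Variable Omega : set Rd.
Hypothesis oO : open Omega.
Implicit Types (f g v psi phi q : Rd -> R[i]) (u Dq F : Rd -> 'rV[R[i]]_d).

Let mO : measurable Omega. Proof. exact: open_measurable_rV. Qed.

Definition tested f psi : R[i] := cintegral leb Omega (fun x => f x * psi x).

Definition laplacian psi (x : Rd) : R[i] :=
  \sum_i cderive (ebasis i) (cderive (ebasis i) psi) x.

Lemma csmooth_measurable psi : csmooth psi -> cmeasurable setT psi.
Proof.
move=> [p1 p2]; split; first exact: (measurable_smooth p1).
exact: (measurable_smooth p2).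
Qed.

Lemma cmeasurable_sub (D : set Rd) f :
  measurable D -> cmeasurable setT f -> cmeasurable D f.
Proof.
move=> mD [f1 f2]; split; first exact: (measurable_funS measurableT _ f1).
exact: (measurable_funS measurableT _ f2).
Qed.

(** Local integrability is assumed on compact subsets of [Omega] only; the
    support of a test function is one. *)
Lemma compact_measurable_rV (K : set Rd) : compact K -> measurable K.
Proof.
move=> cK; rewrite -[K]setCK; apply: measurableC; apply: open_measurable_rV.
by rewrite openC; apply: compact_closed => //; exact: norm_hausdorff.
Qed.

Lemma Cc_ooZ c psi : Cc_oo Omega psi -> Cc_oo Omega (fun x => c * psi x).
Proof.
move=> pO; apply: (Cc_oo_sub pO).
  by apply: csmoothM; [exact: csmooth_cst|have [] := pO].
by move=> x /notin_supp ->; rewrite mulr0.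
Qed.

Lemma cintegrable_tested f psi : L1loc Omega f -> Cc_oo Omega psi ->
  cintegrable leb Omega (fun x => f x * psi x).
Proof.
move=> lf psiO; have [spsi cK KO] := psiO; have [M M0 psiM] := Cc_oo_bounded psiO.
set K := supp psi in cK KO.
have mK := compact_measurable_rV cK.
have iK := lf K cK KO.
have ifK : cintegrable leb K (fun x => f x * psi x).
  apply: (@cintegrable_dominated _ _ _ _ _ _ (fun x => M * cnorm (f x))) => //.
  - apply: cmeasurableM; first exact: cintegrable_measurable iK.
    by apply: cmeasurable_sub => //; exact: csmooth_measurable.
  - have := integrableZl mK M (cintegrable_cnorm mK iK).
    by apply: eq_integrable => // x _; rewrite /= EFinM.
  - by move=> x _; rewrite cnormM mulrC; apply: ler_wpM2r => //; exact: cnorm_ge0.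
apply/(cintegrable_mkcond _ _ mO).
have -> : patch (fun=> 0) Omega (fun x => f x * psi x) =
    patch (fun=> 0) K (fun x => f x * psi x).
  apply/funext => x; rewrite /patch; case: ifPn => [xO|/negP xO].
    by case: ifPn => // /negP; rewrite inE => /notin_supp ->; rewrite mulr0.
  by case: ifPn => //; rewrite inE => /KO xO'; case: xO; rewrite inE.
exact/(cintegrable_mkcond _ _ mK).
Qed.

Lemma testedDr f psi phi : L1loc Omega f -> Cc_oo Omega psi -> Cc_oo Omega phi ->
  tested f (fun x => psi x + phi x) = tested f psi + tested f phi.
Proof.
move=> lf p1 p2; have i1 := cintegrable_tested lf p1.
rewrite /tested -(cintegralD mO i1 (cintegrable_tested lf p2)).
by apply: eq_cintegral => x _; rewrite mulrDr.
Qed.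

Lemma testedZr f c psi : L1loc Omega f -> Cc_oo Omega psi ->
  tested f (fun x => c * psi x) = c * tested f psi.
Proof.
move=> lf p1; rewrite /tested -(cintegralZ _ mO (cintegrable_tested lf p1)).
by apply: eq_cintegral => x _; rewrite mulrCA.
Qed.

Lemma testedZl f c psi : L1loc Omega f -> Cc_oo Omega psi ->
  tested (fun x => c * f x) psi = c * tested f psi.
Proof.
move=> lf p1; rewrite /tested -(cintegralZ _ mO (cintegrable_tested lf p1)).
by apply: eq_cintegral => x _; rewrite mulrA.
Qed.

Lemma tested_sumr f psi (I : finType) (p : I -> Rd -> R[i]) : L1loc Omega f ->
  (forall i, Cc_oo Omega (p i)) -> (forall x, psi x = \sum_i p i x) ->
  tested f psi = \sum_i tested f (p i).
Proof.
move=> lf pO psiE; rewrite /tested -cintegral_sum//.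
  by apply: eq_cintegral => x _; rewrite psiE mulr_sumr.
by move=> i; exact: cintegrable_tested.
Qed.

Lemma Cc_oo_laplacian psi : Cc_oo Omega psi -> Cc_oo Omega (laplacian psi).
Proof.
move=> pO; apply: (Cc_oo_sub pO).
  by apply: csmooth_sum => i; do 2 apply: csmooth_derive; have [] := pO.
move=> x xs; apply: big1 => i _; apply: cderive_notin_supp => xs'.
apply: xs; apply: (@closed_supp _ _ psi) => B xB; have [y [gy By]] := xs' B xB.
by exists y; split=> //; apply: contrapT => /(cderive_notin_supp (ebasis i)); exact/eqP.
Qed.

Lemma tested_laplacian f g psi : 'I_d -> weak_laplacian Omega f g -> Cc_oo Omega psi ->
  [/\ L1loc Omega f, L1loc Omega g & tested g psi = tested f (laplacian psi)].
Proof.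
move=> i0 [D [D2 [fD DD2 gE]]] pO.
have [lf _ _] := fD i0.
have lD i : L1loc Omega (D2 i) by have [] := DD2 i.
split=> //.
  move=> K cK KO.
  have mK := compact_measurable_rV cK.
  have -> : g = (fun x => \sum_i D2 i x) by apply/funext.
  by apply: cintegrable_sum => // i; exact: lD.
have -> : tested f (laplacian psi) =
    \sum_i tested f (cderive (ebasis i) (cderive (ebasis i) psi)).
  by apply: tested_sumr => // i; do 2 apply: Cc_oo_derive.
have -> : tested g psi = \sum_i tested (D2 i) psi.
  rewrite /tested -cintegral_sum//; last by move=> i; exact: cintegrable_tested.
  by apply: eq_cintegral => x _; rewrite gE mulr_suml.
apply: eq_bigr => i _.
have [_ _ Ef] := fD i; have [_ _ ED] := DD2 i.
have p1 := Cc_oo_derive (ebasis i) pO.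
have := Ef _ p1; have := ED _ pO; rewrite -!/(tested _ _) => E1 E2.
by rewrite E2 E1 opprK.
Qed.

Lemma ae_eq_cintegral f g : cmeasurable Omega f -> cmeasurable Omega g ->
  {ae leb, forall x, Omega x -> f x = g x} ->
  cintegral leb Omega f = cintegral leb Omega g.
Proof.
move=> [f1 f2] [g1 g2] fg; apply: complex_eqP => /=; congr fine.
  apply: ae_eq_integral => //; try exact/measurable_EFinP.
  by apply: filterS fg => x fgx Ox; rewrite /part_Re fgx.
apply: ae_eq_integral => //; try exact/measurable_EFinP.
by apply: filterS fg => x fgx Ox; rewrite /part_Im fgx.
Qed.

Lemma stokes_tested (h : R) u Dq F psi (j : 'I_d) :
  stokes Omega h u Dq F -> L1loc Omega (cmpt Dq j) -> L1loc Omega (cmpt F j) ->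
  Cc_oo Omega psi ->
  tested (cmpt F j) psi = - (h ^+ 2)%:C * tested (cmpt u j) (laplacian psi)
    - tested (cmpt u j) psi + h%:C * tested (cmpt Dq j) psi.
Proof.
move=> [Lu [_ [uLu _ eqn _]]] lD lF pO.
have [lu lL <-] := tested_laplacian j (uLu j) pO.
have iL := cintegrable_tested lL pO; have iu := cintegrable_tested lu pO.
have iD := cintegrable_tested lD pO; have iF := cintegrable_tested lF pO.
have iL' := cintegrableZ (- (h ^+ 2)%:C) mO iL.
have iu' := cintegrableN mO iu.
have iD' := cintegrableZ h%:C mO iD.
rewrite /tested -(cintegralN mO iu) -(cintegralZ _ mO iL) -(cintegralZ _ mO iD).
rewrite -(cintegralD mO iL' iu') -(cintegralD mO (cintegrableD mO iL' iu') iD').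
apply: ae_eq_cintegral.
- exact: cintegrable_measurable iF.
- exact: cintegrable_measurable (cintegrableD mO (cintegrableD mO iL' iu') iD').
apply: filterS eqn => x Ex Ox; rewrite -[in cmpt F j x]/(F x ord0 j).
rewrite {1}/cmpt -(Ex Ox) !mxE /cmpt.
move: (Lu x ord0 j) (u x ord0 j) (Dq x ord0 j) (psi x) (h ^+ 2)%:C h%:C => a1 a2 a3 a4 a5 a6.
by ring.
Qed.

(** Both sides are minus the pairing of [q] with a second derivative of [psi],
    which is symmetric in [i] and [j]. *)
Lemma curl_free q Dq psi (i j : 'I_d) : weak_grad Omega q Dq -> Cc_oo Omega psi ->
  tested (cmpt Dq i) (cderive (ebasis j) psi) = tested (cmpt Dq j) (cderive (ebasis i) psi).
Proof.
move=> qD pO; have [_ _ Ei] := qD i; have [_ _ Ej] := qD j; have [sp _ _] := pO.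
have := Ei _ (Cc_oo_derive (ebasis j) pO); have := Ej _ (Cc_oo_derive (ebasis i) pO).
move=> H1 H2; apply: oppr_inj; apply: etrans (esym H2) _; apply: etrans _ H1.
by apply: eq_cintegral => x _; rewrite (cderiveC _ _ _ sp).
Qed.

Lemma weak_div0_tested u psi : weak_div Omega u (fun=> 0) -> Cc_oo Omega psi ->
  \sum_j tested (cmpt u j) (cderive (ebasis j) psi) = 0.
Proof.
move=> [lu _ Eu] pO; rewrite /tested -cintegral_sum//; last first.
  by move=> j; apply: cintegrable_tested => //; exact: Cc_oo_derive.
rewrite (Eu _ pO) -[RHS]oppr0; congr (- _).
by under eq_fun do rewrite mul0r; exact: cintegral0.
Qed.

Lemma laplacian_derive psi (j : 'I_d) x : csmooth psi ->
  laplacian (cderive (ebasis j) psi) x = cderive (ebasis j) (laplacian psi) x.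
Proof.
move=> sp; rewrite /laplacian cderive_sum; last first.
  by move=> i; do 2 apply: csmooth_derive.
apply: eq_bigr => i _.
have E : cderive (ebasis i) (cderive (ebasis j) psi) =
  cderive (ebasis j) (cderive (ebasis i) psi).
  by apply/funext => y; exact: cderiveC.
rewrite E; apply: (@cderiveC R _ (cderive (ebasis i) psi) (ebasis i) (ebasis j) x).
exact: csmooth_derive.
Qed.

(** The pressure is harmonic: the divergence of the equation only retains it,
    since [u] and [F] are divergence free and the Laplacian commutes with
    derivatives. In weak form, coordinate [j] is tested against the [j]-th
    derivative of [psi] and the results are added. *)
Lemma pressure_div_free (h : R) u Dq F psi : stokes Omega h u Dq F ->
  (forall j, L1loc Omega (cmpt Dq j)) -> weak_div Omega u (fun=> 0) ->
  weak_div Omega F (fun=> 0) -> Cc_oo Omega psi ->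
  h%:C * \sum_j tested (cmpt Dq j) (cderive (ebasis j) psi) = 0.
Proof.
move=> st lD du dF pO; have [lF _ _] := dF; have [lu _ _] := du.
have := weak_div0_tested dF pO.
under eq_bigr => j _ do
  rewrite (stokes_tested st (lD j) (lF j) (Cc_oo_derive (ebasis j) pO)).
rewrite big_split/= big_split/= sumrN (weak_div0_tested du pO) subr0 -!mulr_sumr.
have -> : \sum_i tested (cmpt u i) (laplacian (cderive (ebasis i) psi)) = 0.
  rewrite -[RHS](weak_div0_tested du (Cc_oo_laplacian pO)).
  apply: eq_bigr => i _; apply: eq_cintegral => x _.
  by rewrite laplacian_derive//; have [] := pO.
by rewrite mulr0 add0r.
Qed.

End distributions.

(** * The equations on the Fourier side *)

Section fourier_side.
Context {R : realType} {d : nat}.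
Local Notation Rd := 'rV[R]_d.
Local Notation leb := (lebesgue_rV d : {measure set Rd -> \bar R}).
Variable Omega : set Rd.
Hypothesis oO : open Omega.
Implicit Types (f g v psi phi : Rd -> R[i]) (s : R) (xi : Rd).

(** Seen as a function of [xi], this is the Fourier transform of [phi * v]
    extended by 0 (see [windowedE]); seen as a pairing with a test function, it
    gives access to the weak equations satisfied by [v]. *)
Definition windowed v phi s xi : R[i] := tested Omega v (fun x => wave s xi x * phi x).

Definition windowed_FT v phi (x : Rd) : R[i] := phi x * patch (fun=> 0) Omega v x.

Lemma windowedE v phi s xi : windowed v phi s xi = FT s (windowed_FT v phi) xi.
Proof.
rewrite /windowed /tested cintegral_mkcond; apply: eq_cintegral => x _.
rewrite /windowed_FT /wave /patch; case: ifP => _; last by rewrite !mulr0.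
by rewrite mulrC mulrA.
Qed.

Section test_function.
Variable phi : Rd -> R[i].
Hypothesis phiO : Cc_oo Omega phi.
Local Notation D := (fun i => cderive (ebasis i) phi).

Let sphi : csmooth phi. Proof. by have [] := phiO. Qed.
Let DO i : Cc_oo Omega (D i). Proof. exact: Cc_oo_derive. Qed.

Lemma tested_derive_wave v s xi i : L1loc Omega v ->
  tested Omega v (cderive (ebasis i) (fun x => wave s xi x * phi x)) =
  ifreq s xi i * windowed v phi s xi + windowed v (D i) s xi.
Proof.
move=> lv; have w1 := Cc_oo_wave s xi phiO; have w2 := Cc_oo_wave s xi (DO i).
rewrite /windowed -(testedZr oO _ lv w1).
have w1' := Cc_ooZ (ifreq s xi i) w1.
rewrite -(testedDr oO lv w1' w2); apply: eq_cintegral => x _; congr (_ * _).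
by rewrite (cderive_wave_mul s xi i x sphi) mulrDr mulrCA.
Qed.

End test_function.

Lemma sum_sqr_ifreq s xi :
  \sum_i ifreq s xi i ^+ 2 = - (s ^+ 2 * dotR xi xi)%:C.
Proof.
rewrite /dotR mulr_sumr; apply: complex_eqP.
  rewrite Re_sum ReN /= -sumrN; apply: eq_bigr => i _.
  by rewrite mul0r sub0r; ring.
rewrite Im_sum ImN /= oppr0 big1// => i _.
by rewrite mul0r mulr0 addr0.
Qed.

Lemma tested_laplacian_wave phi v s xi : Cc_oo Omega phi -> L1loc Omega v ->
  tested Omega v (laplacian (fun x => wave s xi x * phi x)) =
  - (s ^+ 2 * dotR xi xi)%:C * windowed v phi s xi +
  \sum_i (2 * ifreq s xi i * windowed v (cderive (ebasis i) phi) s xi +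
    windowed v (cderive (ebasis i) (cderive (ebasis i) phi)) s xi).
Proof.
move=> phiO lv; have w1 := Cc_oo_wave s xi phiO; have [sphi _ _] := phiO.
pose D i := cderive (ebasis i) phi.
have DO i : Cc_oo Omega (D i) by exact: Cc_oo_derive.
have wD i := Cc_oo_wave s xi (DO i).
pose q i := ifreq s xi i.
pose P i x := cderive (ebasis i) (cderive (ebasis i) (fun x => wave s xi x * phi x)) x.
have PO i : Cc_oo Omega (P i) by do 2 apply: Cc_oo_derive.
rewrite (tested_sumr oO lv PO (fun x => erefl)).
have -> : - (s ^+ 2 * dotR xi xi)%:C * windowed v phi s xi =
    \sum_i (q i ^+ 2 * windowed v phi s xi).
  by rewrite -sum_sqr_ifreq mulr_suml.
rewrite -big_split/=; apply: eq_bigr => i _.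
have w1' := Cc_ooZ (q i) w1.
have E : P i = cderive (ebasis i) (fun x => q i * (wave s xi x * phi x) + wave s xi x * D i x).
  congr cderive; apply/funext => x.
  by rewrite (cderive_wave_mul s xi i x sphi) mulrDr mulrCA.
have [sq _ _] := w1'; have [sD _ _] := wD i; have [sw _ _] := w1.
have E' x : P i x = q i * cderive (ebasis i) (fun x => wave s xi x * phi x) x +
    cderive (ebasis i) (fun x => wave s xi x * D i x) x.
  rewrite E (cderiveD _ _ sq sD); congr (_ + _).
  by rewrite (cderiveM _ _ (csmooth_cst (q i)) sw) cderive_cst mulr0 addr0.
have dO1 := Cc_oo_derive (ebasis i) w1.
have dO2 := Cc_ooZ (q i) dO1.
have -> : tested Omega v (P i) = q i * (q i * windowed v phi s xi + windowed v (D i) s xi) +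
    (q i * windowed v (D i) s xi + windowed v (cderive (ebasis i) (D i)) s xi).
  rewrite -(tested_derive_wave phiO s xi i lv) -(tested_derive_wave (DO i) s xi i lv).
  rewrite -(testedZr oO _ lv dO1) -(testedDr oO lv dO2 (Cc_oo_derive (ebasis i) (wD i))).
  by apply: eq_cintegral => x _; rewrite E'.
rewrite -/(D i) -/(q i).
move: (windowed _ _ _ _) (windowed _ _ _ _) (windowed _ _ _ _) (q i) => a1 a2 a3 a4.
by ring.
Qed.

(** A derivative of the wave produces the factor [ifreq s xi i] and, since
    [h ^ 2 * s ^ 2 = 1], the operator [- h ^ 2 * Laplacian - 1] becomes the
    multiplication by [dotR xi xi - 1]. The last sum collects the commutators with
    the cutoff: each carries a factor [h ^ 2] against at most one factor [s]. *)
Lemma helmholtz_identity (h : R) s phi w V F xi : Cc_oo Omega phi -> L1loc Omega w ->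
  h ^+ 2 * s ^+ 2 = 1 ->
  (forall psi, Cc_oo Omega psi -> tested Omega F psi =
     - (h ^+ 2)%:C * tested Omega w (laplacian psi) - tested Omega w psi +
     tested Omega V psi) ->
  (dotR xi xi - 1)%:C * windowed w phi s xi =
  windowed F phi s xi - windowed V phi s xi +
  (h ^+ 2)%:C * \sum_i (2 * ifreq s xi i * windowed w (cderive (ebasis i) phi) s xi +
    windowed w (cderive (ebasis i) (cderive (ebasis i) phi)) s xi).
Proof.
move=> phiO lw hs E; have := E _ (Cc_oo_wave s xi phiO).
rewrite (tested_laplacian_wave s xi phiO lw) -!/(windowed _ _ _ _).
set S := \sum_i _; move: (windowed w phi s xi) (windowed V phi s xi) (windowed F phi s xi) S.
move=> a b c S ->.
have -> : (dotR xi xi - 1)%:C = (h ^+ 2)%:C * (s ^+ 2 * dotR xi xi)%:C - 1.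
  by rewrite -rmorphM/= mulrA hs mul1r rmorphB.
move: (h ^+ 2)%:C (s ^+ 2 * dotR xi xi)%:C => t r.
by ring.
Qed.

Section high_frequency.
Variable V : 'I_d -> Rd -> R[i].
Hypothesis lV : forall j, L1loc Omega (V j).
Hypothesis curlV : forall i j psi, Cc_oo Omega psi ->
  tested Omega (V i) (cderive (ebasis j) psi) = tested Omega (V j) (cderive (ebasis i) psi).
Hypothesis divV : forall psi, Cc_oo Omega psi ->
  \sum_j tested Omega (V j) (cderive (ebasis j) psi) = 0.

Definition commutator_terms phi (j l : 'I_d) s xi : R :=
  cnorm (windowed (V l) (cderive (ebasis l) phi) s xi) +
  (cnorm (windowed (V l) (cderive (ebasis j) phi) s xi) +
   cnorm (windowed (V j) (cderive (ebasis l) phi) s xi)).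

Lemma normr_coord_le xi (i : 'I_d) : `|xi ord0 i| <= Num.sqrt (dotR xi xi).
Proof.
rewrite -sqrtr_sqr; apply: ler_wsqrtr; rewrite /dotR (bigD1 i)//= -expr2 lerDl.
by apply: sumr_ge0 => k _; rewrite -expr2 sqr_ge0.
Qed.

Lemma cnorm_ifreq s xi (l : 'I_d) : cnorm (ifreq s xi l) <= `|s| * Num.sqrt (dotR xi xi).
Proof.
rewrite cnormE /= expr0n add0r sqrtr_sqr normrM; apply: ler_wpM2l => //.
exact: normr_coord_le.
Qed.

(** The Fourier side of Laplacian = grad div - curl curl. As [V] has neither
    curl nor divergence, only commutators with [phi] remain on the right. *)
Lemma harmonic_identity phi s xi (j : 'I_d) : Cc_oo Omega phi ->
  - (s ^+ 2 * dotR xi xi)%:C * windowed (V j) phi s xi =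
  \sum_l (- (ifreq s xi j * windowed (V l) (cderive (ebasis l) phi) s xi) +
   ifreq s xi l * (windowed (V l) (cderive (ebasis j) phi) s xi -
      windowed (V j) (cderive (ebasis l) phi) s xi)).
Proof.
move=> phiO; have wO := Cc_oo_wave s xi phiO.
have Ec l := curlV l j wO.
have Ed := divV wO.
have -> : - (s ^+ 2 * dotR xi xi)%:C * windowed (V j) phi s xi =
    \sum_l (ifreq s xi l ^+ 2 * windowed (V j) phi s xi) - ifreq s xi j *
    \sum_l tested Omega (V l) (cderive (ebasis l) (fun x => wave s xi x * phi x)).
  by rewrite Ed mulr0 subr0 -sum_sqr_ifreq mulr_suml.
rewrite mulr_sumr -sumrB.
apply: eq_bigr => l _.
have := Ec l; rewrite (tested_derive_wave phiO s xi j (lV l)).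
rewrite (tested_derive_wave phiO s xi l (lV j)) (tested_derive_wave phiO s xi l (lV l)).
move: (windowed (V l) phi s xi) (windowed (V j) phi s xi)
  (windowed (V l) (cderive (ebasis l) phi) s xi)
  (windowed (V l) (cderive (ebasis j) phi) s xi)
  (windowed (V j) (cderive (ebasis l) phi) s xi) => a b c x e.
move: (ifreq s xi l) (ifreq s xi j) => p q E.
have -> : p ^+ 2 * b = p * (p * b + e) - p * e by ring.
by rewrite -E; ring.
Qed.

(** The left side of [harmonic_identity] is quadratic in the frequency and its
    right side linear, which gains one power of the frequency. *)
Lemma high_frequency_bound phi s xi (j : 'I_d) (L : R) : Cc_oo Omega phi ->
  s != 0 -> 0 < L -> ~ box (L / `|s|) xi ->
  L * cnorm (windowed (V j) phi s xi) <= \sum_l commutator_terms phi j l s xi.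
Proof.
move=> phiO s0 L0 xiL.
set e := Num.sqrt (dotR xi xi).
have s0' : 0 < `|s| by rewrite normr_gt0.
have dE : e ^+ 2 = dotR xi xi.
  rewrite sqr_sqrtr//; apply: sumr_ge0 => i _; rewrite -expr2; exact: sqr_ge0.
have eL : L / `|s| < e.
  rewrite ltNge; apply/negP => eL; apply: xiL => i; apply: le_trans eL.
  exact: normr_coord_le.
have e0 : 0 < e by apply: le_lt_trans eL; rewrite divr_ge0// ltW.
have se : L <= `|s| * e by rewrite -ler_pdivrMl// mulrC ltW.
have key : (`|s| * e) * ((`|s| * e) * cnorm (windowed (V j) phi s xi)) <=
    (`|s| * e) * \sum_l commutator_terms phi j l s xi.
  have -> : (`|s| * e) * ((`|s| * e) * cnorm (windowed (V j) phi s xi)) =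
      cnorm (- (s ^+ 2 * dotR xi xi)%:C * windowed (V j) phi s xi).
    rewrite cnormM cnormN cnorm_real -dE -exprMn normrX normrM (gtr0_norm e0).
    by rewrite expr2 mulrA.
  rewrite (harmonic_identity s xi j phiO) mulr_sumr; apply: le_trans (cnorm_sum _ _ _) _.
  apply: ler_sum => l _; apply: le_trans (cnormD _ _) _.
  rewrite /commutator_terms [leRHS]mulrDr; apply: lerD.
    by rewrite cnormN cnormM; apply: (ler_wpM2r (cnorm_ge0 _)); exact: cnorm_ifreq.
  rewrite cnormM; apply: ler_pM (cnorm_ge0 _) (cnorm_ge0 _) (cnorm_ifreq _ _ _) _.
  by apply: le_trans (cnormD _ _) _; rewrite cnormN.
have se0 : 0 < `|s| * e by rewrite mulr_gt0.
move: key; rewrite (ler_pM2l se0); apply: le_trans.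
by apply: ler_wpM2r se; exact: cnorm_ge0.
Qed.

End high_frequency.

Section windowed_L2.
Variable B : R.
Hypothesis OB : Omega `<=` box B.

Lemma L2box_ext v : L2 Omega v -> L2box B (patch (fun=> 0) Omega v) /\
  sqnorm (patch (fun=> 0) Omega v) = L2norm Omega v ^+ 2.
Proof.
have mO := open_measurable_rV oO; move=> [[v1 v2] iv].
have E : (fun x => cnorm (patch (fun=> 0) Omega v x) ^+ 2) =
    patch (fun=> 0) Omega (fun x => cnorm (v x) ^+ 2).
  by apply/funext => x; rewrite /patch; case: ifP => // _; rewrite cnorm0 expr0n.
split; last first.
  rewrite /sqnorm E /L2norm -Rintegral_mkcond sqr_sqrtr//.
  by apply: Rintegral_ge0 => x _; exact: sqr_ge0.
split.
- have p0 (p : R[i] -> R) : p 0 = 0 -> p \o patch (fun=> 0) Omega v =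
      patch (fun=> 0) Omega (p \o v).
    by move=> p0; apply/funext => x; rewrite /patch /=; case: ifP; rewrite ?p0.
  split.
    have := p0 (@complex.Re R) erefl; rewrite /part_Re /comp => ->.
    exact/(measurable_restrictT _ mO).
  have := p0 (@complex.Im R) erefl; rewrite /part_Im /comp => ->.
  exact/(measurable_restrictT _ mO).
- rewrite E.
  have -> : EFin \o patch (fun=> 0) Omega (fun x => cnorm (v x) ^+ 2) =
      (EFin \o (fun x => cnorm (v x) ^+ 2)) \_ Omega.
    by apply/funext => x; rewrite /= /patch; case: ifP.
  apply/(integrable_mkcond _ mO); apply/integrableP; split.
    by apply/measurable_EFinP; exact: measurable_sqr_cnorm.
  apply: le_lt_trans iv; apply: ge0_le_integral => //.
  + apply: measurableT_comp => //; apply/measurable_EFinP; exact: measurable_sqr_cnorm.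

  + by apply/measurable_EFinP; exact: measurable_sqr_cnorm.
  + by move=> x _; rewrite /= ger0_norm ?sqr_ge0.
- by move=> x xB; rewrite /patch; case: ifP => //; rewrite inE => /OB.
Qed.

Lemma L2box_windowed v psi M : L2 Omega v -> Cc_oo Omega psi ->
  (forall x, cnorm (psi x) <= M) ->
  L2box B (windowed_FT v psi) /\
  sqnorm (windowed_FT v psi) <= M ^+ 2 * L2norm Omega v ^+ 2.
Proof.
move=> v2 [sp _ _] psiM; have [vB <-] := L2box_ext v2.
exact: (L2boxM (csmooth_measurable sp) psiM vB).
Qed.

End windowed_L2.

End fourier_side.

(** * Sequences tending to 0 *)

Section vanishing_sequences.
Context {R : realType}.
Implicit Types (p q : nat -> R).

Definition vanishes p := forall e : R, 0 < e -> \forall k \near \oo, `|p k| <= e.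

Lemma vanishesP p : vanishes p <-> p k @[k --> \oo] --> (0 : R).
Proof. by split => [p0|/cvgr0Pnorm_le//]; apply/cvgr0Pnorm_le. Qed.

Lemma vanishes_le p q : vanishes q -> (\forall k \near \oo, `|p k| <= q k) -> vanishes p.
Proof.
move=> q0 pq e e0; near=> k; apply: le_trans (_ : q k <= _); first by near: k.
by apply: le_trans (ler_norm _) _; near: k; exact: q0.
Unshelve. all: by end_near. Qed.

Lemma vanishesD p q : vanishes p -> vanishes q -> vanishes (fun k => p k + q k).
Proof.
move=> p0 q0 e e0; have e2 : 0 < e / 2 by rewrite divr_gt0.
near=> k; apply: le_trans (ler_normD _ _) _.
by rewrite [leRHS]splitr; apply: lerD; near: k; [exact: p0|exact: q0].
Unshelve. all: by end_near. Qed.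

Lemma vanishesM_bounded p q (C : R) : vanishes p ->
  (\forall k \near \oo, `|q k| <= C) -> vanishes (fun k => p k * q k).
Proof.
move=> p0 qC e e0; have C1 : 0 < `|C| + 1 by rewrite ltr_wpDl.
have e1 : 0 < e / (`|C| + 1) by rewrite divr_gt0.
near=> k; rewrite normrM.
have h1 : `|p k| <= e / (`|C| + 1) by near: k; exact: p0.
have h2 : `|q k| <= `|C| + 1.
  by apply: le_trans (_ : C <= _); [near: k|rewrite ler_wpDr// ler_norm].
apply: le_trans (ler_pM (normr_ge0 _) (normr_ge0 _) h1 h2) _.
by rewrite divfK// gt_eqF.
Unshelve. all: by end_near. Qed.

Lemma vanishesZ p (c : R) : vanishes p -> vanishes (fun k => c * p k).
Proof.
move=> p0; have -> : (fun k => c * p k) = (fun k => p k * c).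
  by apply/funext => k; rewrite mulrC.
by apply: (@vanishesM_bounded p (fun=> c) `|c| p0); apply: nearW.
Qed.

Lemma vanishes_sqr p : vanishes p -> vanishes (fun k => p k ^+ 2).
Proof.
move=> p0; have p1 : \forall k \near \oo, `|p k| <= 1 by exact: p0.
by have := vanishesM_bounded p0 p1; under eq_fun do rewrite -expr2.
Qed.

Lemma vanishes_sum I (r : seq I) (p : I -> nat -> R) : (forall i, vanishes (p i)) ->
  vanishes (fun k => \sum_(i <- r) p i k).
Proof.
move=> p0; elim: r => [|i r IH].
  by move=> e e0; apply: nearW => k; rewrite big_nil normr0 ltW.
have -> : (fun k => \sum_(j <- i :: r) p j k) = (fun k => p i k + \sum_(j <- r) p j k).
  by apply/funext => k; rewrite big_cons.
exact: vanishesD.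
Qed.

(** The form in which every splitting with a free parameter is used: a part
    that vanishes for fixed [delta], and a part of size [delta]. *)
Lemma vanishes_weighted p (q : R -> nat -> R) (K : R) :
  (forall delta, 0 < delta -> vanishes (q delta)) ->
  (forall delta, 0 < delta -> \forall k \near \oo, `|p k| <= q delta k + delta * K) ->
  vanishes p.
Proof.
move=> q0 pq e e0; have K0 : 0 < `|K| + 1 by rewrite ltr_wpDl.
pose delta := e / 2 / (`|K| + 1).
have d0 : 0 < delta by rewrite !divr_gt0.
near=> k; apply: le_trans (_ : q delta k + delta * K <= _); first by near: k; exact: pq.
rewrite [leRHS]splitr; apply: lerD.
  apply: le_trans (ler_norm _) _; near: k; apply: q0 => //; exact: divr_gt0.
apply: (@le_trans _ _ (delta * (`|K| + 1))).
  by apply: ler_wpM2l; [exact: ltW|rewrite ler_wpDr// ler_norm].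
by rewrite /delta divfK// gt_eqF.
Unshelve. all: by end_near. Qed.

End vanishing_sequences.

(** * Bounded frequencies at scale 1 *)

Section fourier_estimates.
Context {R : realType} {n : nat}.
Local Notation Rn := 'rV[R]_n.
Local Notation leb := (lebesgue_rV n : {measure set Rn -> \bar R}).
Implicit Types (v w : Rn -> R[i]) (p q : Rn -> R).

Lemma normr_sin_sub (x y : R) : `|sin x - sin y| <= `|x - y|.
Proof.
wlog yx : x y / y <= x.
  move=> H; have [|/ltW] := leP y x; first exact: H.
  by move=> /H; rewrite distrC (distrC y).
have [|c _ ->] := @MVT_segment R sin cos y x yx (fun t _ => is_derive_sin t).
  by apply: continuous_subspaceT; exact: continuous_sin.
by rewrite normrM; apply: ler_piMl => //; exact: normr_cos_le1.
Qed.

Lemma normr_cos_sub (x y : R) : `|cos x - cos y| <= `|x - y|.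
Proof.
wlog yx : x y / y <= x.
  move=> H; have [|/ltW] := leP y x; first exact: H.
  by move=> /H; rewrite distrC (distrC y).
have [|c _ ->] := @MVT_segment R cos (fun t => - sin t) y x yx (fun t _ => is_derive_cos t).
  by apply: continuous_subspaceT; exact: continuous_cos.
by rewrite normrM normrN; apply: ler_piMl => //; exact: normr_sin_le1.
Qed.

Lemma cnorm_cis_sub (x y : R) : cnorm (cis x - cis y) <= 2 * `|x - y|.
Proof.
apply: le_trans (cnorm_le_ReIm _) _; rewrite mulr_natl mulr2n; apply: lerD => /=.
  exact: normr_cos_sub.
exact: normr_sin_sub.
Qed.

Lemma normr_dotR_le (x y : Rn) (B e : R) : box B x -> (forall i, `|y ord0 i| <= e) ->
  `|dotR x y| <= n%:R * (B * e).
Proof.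
move=> xB ye; apply: le_trans (ler_norm_sum _ _ _) _.
rewrite -[n in n%:R]card_ord -sumr_const mulr_suml; apply: ler_sum => i _.
by rewrite mul1r normrM; apply: ler_pM.
Qed.

Lemma L1_le_L2box B v : 0 <= B -> L2box B v ->
  \int[leb]_x cnorm (v x) <= (2 * B) ^+ n + sqnorm v.
Proof.
move=> B0 vB; have [mv iv v0] := vB.
rewrite -(Rintegral_box1 n B0) -(RintegralD measurableT (integrable_box1 n B) iv).
apply: le_Rintegral => //.
- exact: L2box_integrable_cnorm vB.
- exact: integrableDR (integrable_box1 n B) iv.
move=> x _; have [xB|xB] := pselect (box B x).
  rewrite box1_in//; set t := cnorm _.
  by have := sqr_ge0 (t - 1 / 2); nra.
by rewrite v0// cnorm0 addr_ge0 ?box1_ge0 ?sqr_ge0.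
Qed.

Lemma FT_Lipschitz B v (e : R) (xi eta : Rn) : 0 <= B -> 0 <= e -> L2box B v ->
  (forall i, `|xi ord0 i - eta ord0 i| <= e) ->
  cnorm (FT 1 v xi - FT 1 v eta) <=
  4 * (n%:R * (B * e)) * ((2 * B) ^+ n + sqnorm v).
Proof.
move=> B0 e0 vB xe; have [mv iv v0] := vB.
have iv1 := L2box_integrable_cnorm vB.
have i1 := FT_integrable 1 xi vB; have i2 := FT_integrable 1 eta vB.
have [m1 _ _] := L2box_wave 1 xi vB; have [m2 _ _] := L2box_wave 1 eta vB.
have -> : FT 1 v xi - FT 1 v eta =
    cintegral leb setT (fun x => cis (1 * dotR x xi) * v x + - (cis (1 * dotR x eta) * v x)).
  by rewrite (cintegralD measurableT i1 (cintegrableN measurableT i2)) (cintegralN measurableT i2).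
set C := n%:R * (B * e).
apply: le_trans (cnorm_cintegral_le (g := fun x => 2 * C * cnorm (v x)) _ _ _) _.
- by apply: cmeasurableD => //; exact: cmeasurableN.
- exact: integrableZR.
- move=> x; rewrite -mulrBl cnormM; have [xB|xB] := pselect (box B x); last first.
    by rewrite v0// cnorm0 !mulr0.
  apply: (ler_wpM2r (cnorm_ge0 _)); apply: le_trans (cnorm_cis_sub _ _) _.
  rewrite !mul1r; apply: ler_wpM2l => //.
  have -> : dotR x xi - dotR x eta = dotR x (xi - eta).
    by rewrite dotRC (dotRC x eta) (dotRC x) dotRD dotRN.
  by apply: normr_dotR_le => // i; rewrite !mxE.
rewrite (RintegralZl _ measurableT iv1) mulrA.
have C0 : 0 <= C by rewrite /C mulr_ge0// mulr_ge0.
have C0' : 0 <= 2 * (2 * C) by apply: mulr_ge0 => //; apply: mulr_ge0.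
apply: le_trans (ler_wpM2l C0' (L1_le_L2box B0 vB)) _.
by rewrite mulrA (_ : 2 * 2 = 4 :> R)//; ring.
Qed.

Lemma FT_scale s v xi : FT s v xi = FT 1 v (s *: xi).
Proof.
by apply: eq_cintegral => x _; rewrite mul1r [dotR x (_ *: _)]dotRC dotRZ (dotRC xi).
Qed.

(** On functions supported in a fixed box and bounded in L^2, Fourier transforms
    are equi-Lipschitz, so pointwise convergence to 0 is uniform on compact
    sets. *)
Lemma FT_vanishes_uniformly (v : nat -> Rn -> R[i]) (B L M e : R) : 0 <= B ->
  (forall k, L2box B (v k)) -> (\forall k \near \oo, sqnorm (v k) <= M) ->
  (forall eta, vanishes (fun k => cnorm (FT 1 (v k) eta))) -> 0 < e ->
  \forall k \near \oo, forall eta, box L eta -> cnorm (FT 1 (v k) eta) <= e.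
Proof.
move=> B0 vB vM v0 e0.
have := @compact_box R n L; move/compact_near_coveringP.
move=> /(_ nat \oo (fun k eta => cnorm (FT 1 (v k) eta) <= e) _); apply => eta _.
pose C := 4 * (n%:R * B) * ((2 * B) ^+ n + M).
have C1 : 0 < `|C| + 1 by rewrite ltr_wpDl.
pose r := e / 2 / (`|C| + 1).
have r0 : 0 < r by rewrite !divr_gt0.
exists (ball eta r, [set k | sqnorm (v k) <= M /\ `|cnorm (FT 1 (v k) eta)| <= e / 2]).
  split; first exact: nbhsx_ballx.
  by apply: filterI => //; apply: v0; rewrite divr_gt0.
move=> [eta' k] /= [etaB [kM ke]].
have -> : FT 1 (v k) eta' = (FT 1 (v k) eta' - FT 1 (v k) eta) + FT 1 (v k) eta.
  by rewrite subrK.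
apply: le_trans (cnormD _ _) _; rewrite [leRHS]splitr; apply: lerD; last first.
  by apply: le_trans ke; exact: ler_norm.
have d i : `|eta' ord0 i - eta ord0 i| <= r.
  rewrite distrC; apply: ltW; have [_] := etaB; exact.
apply: le_trans (FT_Lipschitz B0 (ltW r0) (vB k) d) _.
have sM : (2 * B) ^+ n + sqnorm (v k) <= (2 * B) ^+ n + M by rewrite lerD2l.
have D0 : 0 <= 4 * (n%:R * (B * r)) by rewrite !mulr_ge0// ltW.
apply: le_trans (ler_wpM2l D0 sM) _.
have -> : 4 * (n%:R * (B * r)) * ((2 * B) ^+ n + M) = C * r by rewrite /C; ring.
apply: (@le_trans _ _ ((`|C| + 1) * r)).
  by apply: ler_wpM2r; [exact: ltW|rewrite ler_wpDr// ler_norm].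
by rewrite /r mulrC divfK// gt_eqF.
Qed.

End fourier_estimates.

(** * Rescaled energy on a bounded set of frequencies *)

Section energy.
Context {R : realType} {n : nat}.
Local Notation Rn := 'rV[R]_n.
Local Notation leb := (lebesgue_rV n : {measure set Rn -> \bar R}).
Variable Ra : R.
Implicit Types (p q : Rn -> R) (v : Rn -> R[i]) (h s : R).

Definition bounded_measurable p :=
  measurable_fun setT p /\ exists M, forall xi, `|p xi| <= M.

(** The normalisation makes Plancherel uniform in [h]: see [energy_FT]. *)
Definition energy h p : R := h ^- n * \int[leb]_xi (box1 Ra xi * p xi ^+ 2).

Lemma bounded_measurableD p q : bounded_measurable p -> bounded_measurable q ->
  bounded_measurable (fun xi => p xi + q xi).
Proof.
move=> [mp [M pM]] [mq [N qN]]; split; first exact: measurable_funD.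
by exists (M + N) => xi; apply: le_trans (ler_normD _ _) _; exact: lerD.
Qed.

Lemma bounded_measurableM p q : bounded_measurable p -> bounded_measurable q ->
  bounded_measurable (fun xi => p xi * q xi).
Proof.
move=> [mp [M pM]] [mq [N qN]]; split; first exact: measurable_funM.
by exists (M * N) => xi; rewrite normrM; apply: ler_pM.
Qed.

Lemma bounded_measurable_cst (c : R) : bounded_measurable (fun=> c).
Proof. by split; [exact: measurable_cst|exists `|c|]. Qed.

Lemma bounded_measurable_box1 (L : R) : bounded_measurable (box1 L).
Proof.
split; first exact: measurable_box1.
by exists 1 => xi; rewrite ger0_norm ?box1_ge0//; exact: box1_le1.
Qed.

Lemma bounded_measurable_FT B s v : L2box B v ->
  bounded_measurable (fun xi => cnorm (FT s v xi)).
Proof.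
move=> vB; have [mv _ _] := vB; split.
  by apply: measurable_cnorm; exact: cmeasurable_FT.
exists (2 * \int[leb]_x cnorm (v x)) => xi.
by rewrite ger0_norm ?cnorm_ge0//; exact: FT_bounded vB.
Qed.

Lemma integrable_energy p : bounded_measurable p ->
  leb.-integrable setT (EFin \o (fun xi => box1 Ra xi * p xi ^+ 2)).
Proof.
move=> [mp [M pM]]; apply: (@integrable_bounded_box _ _ _ (M ^+ 2)).
  exact: measurable_funX.
move=> xi; rewrite normrX; have M0 : 0 <= M by apply: le_trans (pM 0).
by rewrite ler_sqr ?nnegrE.
Qed.

Lemma energy_ge0 h p : 0 < h -> 0 <= energy h p.
Proof.
move=> h0; apply: mulr_ge0; first by rewrite invr_ge0 exprn_ge0 ?ltW.
by apply: Rintegral_ge0 => xi _; rewrite mulr_ge0 ?box1_ge0 ?sqr_ge0.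
Qed.

Lemma le_energy h p q : 0 < h -> bounded_measurable p -> bounded_measurable q ->
  (forall xi, box Ra xi -> `|p xi| <= q xi) -> energy h p <= energy h q.
Proof.
move=> h0 bp bq pq; apply: ler_wpM2l; first by rewrite invr_ge0 exprn_ge0 ?ltW.
apply: le_Rintegral => //; [exact: integrable_energy|exact: integrable_energy|].
move=> xi _; have [xB|/box1_out ->] := pselect (box Ra xi); last by rewrite !mul0r.
apply: (ler_wpM2l (box1_ge0 _ _)); have := pq xi xB => pqx.
rewrite -(real_normK (num_real (p xi))) ler_sqr ?nnegrE//.
exact: le_trans pqx.
Qed.

Lemma energyD h p q : 0 < h -> bounded_measurable p -> bounded_measurable q ->
  energy h (fun xi => p xi + q xi) <= 2 * (energy h p + energy h q).
Proof.
move=> h0 bp bq.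
have ip := integrable_energy bp; have iq := integrable_energy bq.
have i2 := integrableZR 2 (integrableDR ip iq).
rewrite /energy -mulrDr mulrCA; apply: ler_wpM2l; first by rewrite invr_ge0 exprn_ge0 ?ltW.
rewrite -(RintegralD measurableT ip iq) -(RintegralZl _ measurableT (integrableDR ip iq)).
apply: le_Rintegral => //; first exact: integrable_energy (bounded_measurableD bp bq).
move=> xi _; rewrite -mulrDr [leRHS]mulrCA; apply: (ler_wpM2l (box1_ge0 _ _)).
by have := sqr_ge0 (p xi - q xi); nra.
Qed.

Lemma energyZ h p (c : R) : bounded_measurable p ->
  energy h (fun xi => c * p xi) = c ^+ 2 * energy h p.
Proof.
move=> bp; rewrite /energy mulrCA -(RintegralZl _ measurableT (integrable_energy bp)).
by congr (_ * _); apply: eq_Rintegral => xi _; rewrite exprMn mulrCA.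
Qed.

Lemma energy0 h : energy h (fun=> 0) = 0.
Proof.
rewrite /energy; under eq_Rintegral do rewrite expr0n/= mulr0.
by rewrite /Rintegral integral0 mulr0.
Qed.

Lemma energy_FT B h s v : 0 < Ra -> 0 < B -> 0 < h -> `|s| = h^-1 -> L2box B v ->
  energy h (fun xi => cnorm (FT s v xi)) <= plancherel_cst n Ra * sqnorm v.
Proof.
move=> Ra0 B0 h0 sh vB.
have s0 : s != 0 by rewrite -normr_gt0 sh invr_gt0.
have hn : 0 <= h ^- n by rewrite invr_ge0 exprn_ge0 ?ltW.
apply: le_trans (ler_wpM2l hn (plancherel_box Ra0 B0 s0 vB)) _.
rewrite sh exprVn invrK; have : h ^+ n != 0 by rewrite expf_neq0// gt_eqF.
move: (h ^+ n) (plancherel_cst n Ra) (sqnorm v) => t C S t0.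
by rewrite (_ : t^-1 * _ = C * S)//; field.
Qed.

(** The frequencies of the box of size [L * h] fill a volume [(2 * L * h) ^ n],
    which the normalisation of the energy compensates exactly; on this box the
    transform with parameter [1 / h] is one with parameter 1 at the frequencies
    [s *: xi] of size [L], by [FT_scale]. *)
Lemma energy_low_frequency h s v (L e B : R) : 0 < h -> 0 <= L -> 0 <= e ->
  `|s| = h^-1 -> L2box B v ->
  (forall eta, box L eta -> cnorm (FT 1 v eta) <= e) ->
  energy h (fun xi => box1 (L * h) xi * cnorm (FT s v xi)) <= e ^+ 2 * (2 * L) ^+ n.
Proof.
move=> h0 L0 e0 sh vB low; rewrite /energy.
have hn : 0 < h ^- n by rewrite invr_gt0 exprn_gt0.
have ib : leb.-integrable setT (EFin \o (fun xi => e ^+ 2 * box1 (L * h) xi)).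
  exact: integrableZR (integrable_box1 n _).
rewrite -ler_pdivlMl// invrK.
have -> : h ^+ n * (e ^+ 2 * (2 * L) ^+ n) = \int[leb]_xi (e ^+ 2 * box1 (L * h) xi).
  rewrite (RintegralZl _ measurableT (integrable_box1 n _)) Rintegral_box1.
    by rewrite mulrA exprMn [in RHS]exprMn exprMn; ring.
  by rewrite mulr_ge0// ltW.
apply: le_Rintegral => //.
  apply: integrable_energy; apply: bounded_measurableM.
    exact: bounded_measurable_box1.
  exact: bounded_measurable_FT vB.
move=> xi _; have [xL|xL] := pselect (box (L * h) xi); last first.
  by rewrite (box1_out xL) mul0r expr0n/= !mulr0.
rewrite (box1_in xL) mul1r mulr1; apply: (@le_trans _ _ (1 * cnorm (FT s v xi) ^+ 2)).
  by apply: (ler_wpM2r (sqr_ge0 _)); exact: box1_le1.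
rewrite mul1r ler_sqr ?nnegrE ?cnorm_ge0// FT_scale; apply: low => i.
by rewrite mxE normrM sh ler_pdivrMl// mulrC; exact: xL.
Qed.

Definition energy_bounded (h : nat -> R) (p : nat -> Rn -> R) :=
  (forall k, bounded_measurable (p k)) /\
  exists C, \forall k \near \oo, energy (h k) (p k) <= C.

Lemma energy_boundedD (h : nat -> R) (p q : nat -> Rn -> R) : (forall k, 0 < h k) ->
  energy_bounded h p -> energy_bounded h q ->
  energy_bounded h (fun k xi => p k xi + q k xi).
Proof.
move=> h0 [bp [C pC]] [bq [K qK]]; split; first by move=> k; exact: bounded_measurableD.
exists (2 * (C + K)); near=> k; apply: le_trans (energyD (h0 k) (bp k) (bq k)) _.
by apply: ler_wpM2l => //; apply: lerD; near: k.
Unshelve. all: by end_near. Qed.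

Lemma energy_bounded_sum (h : nat -> R) I (r : seq I) (p : I -> nat -> Rn -> R) :
  (forall k, 0 < h k) -> (forall i, energy_bounded h (p i)) ->
  energy_bounded h (fun k xi => \sum_(i <- r) p i k xi).
Proof.
move=> h0 pC; elim: r => [|i r IH].
  have -> : (fun k xi => \sum_(i <- [::]) p i k xi) = (fun _ _ => 0).
    by apply/funext => k; apply/funext => xi; rewrite big_nil.
  split; first by move=> k; exact: bounded_measurable_cst.
  by exists 0; apply: nearW => k; rewrite energy0.
have -> : (fun k xi => \sum_(j <- i :: r) p j k xi) =
    (fun k xi => p i k xi + \sum_(j <- r) p j k xi).
  by apply/funext => k; apply/funext => xi; rewrite big_cons.
exact: energy_boundedD.
Qed.

Lemma energy_bounded_FT (h s : nat -> R) B (v : nat -> Rn -> R[i]) : 0 < Ra -> 0 < B ->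
  (forall k, 0 < h k) -> (forall k, `|s k| = (h k)^-1) -> (forall k, L2box B (v k)) ->
  (exists C, \forall k \near \oo, sqnorm (v k) <= C) ->
  energy_bounded h (fun k xi => cnorm (FT (s k) (v k) xi)).
Proof.
move=> Ra0 B0 h0 sh vB [C vC]; split; first by move=> k; exact: bounded_measurable_FT (vB k).
exists (plancherel_cst n Ra * C); apply: filterS vC => k vk.
apply: le_trans (energy_FT Ra0 B0 (h0 k) (sh k) (vB k)) _.
by apply: ler_wpM2l => //; exact: plancherel_cst_ge0.
Qed.

Definition energy_vanishes (h : nat -> R) (p : nat -> Rn -> R) :=
  (forall k, bounded_measurable (p k)) /\ vanishes (fun k => energy (h k) (p k)).

Lemma energy_vanishesD (h : nat -> R) (p q : nat -> Rn -> R) : (forall k, 0 < h k) ->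
  energy_vanishes h p -> energy_vanishes h q ->
  energy_vanishes h (fun k xi => p k xi + q k xi).
Proof.
move=> h0 [bp p0] [bq q0]; split; first by move=> k; exact: bounded_measurableD.
apply: vanishes_le (vanishesZ 2 (vanishesD p0 q0)) _; apply: nearW => k.
by rewrite ger0_norm ?energy_ge0//; exact: energyD.
Qed.

Lemma energy_vanishes_sum (h : nat -> R) I (r : seq I) (p : I -> nat -> Rn -> R) :
  (forall k, 0 < h k) -> (forall i, energy_vanishes h (p i)) ->
  energy_vanishes h (fun k xi => \sum_(i <- r) p i k xi).
Proof.
move=> h0 p0; elim: r => [|i r IH].
  have -> : (fun k xi => \sum_(i <- [::]) p i k xi) = (fun _ _ => 0).
    by apply/funext => k; apply/funext => xi; rewrite big_nil.
  split; first by move=> k; exact: bounded_measurable_cst.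
  by move=> e e0; apply: nearW => k; rewrite energy0 normr0 ltW.
have -> : (fun k xi => \sum_(j <- i :: r) p j k xi) =
    (fun k xi => p i k xi + \sum_(j <- r) p j k xi).
  by apply/funext => k; apply/funext => xi; rewrite big_cons.
exact: energy_vanishesD.
Qed.

Lemma energy_vanishesZ (h c : nat -> R) (p : nat -> Rn -> R) : (forall k, 0 < h k) -> vanishes c ->
  energy_bounded h p -> energy_vanishes h (fun k xi => c k * p k xi).
Proof.
move=> h0 c0 [bp [C pC]]; split.
  by move=> k; apply: bounded_measurableM (bp k); exact: bounded_measurable_cst.
have cc := vanishes_sqr c0.
have -> : (fun k => energy (h k) (fun xi => c k * p k xi)) =
    (fun k => c k ^+ 2 * energy (h k) (p k)).
  by apply/funext => k; rewrite energyZ.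
apply: (@vanishesM_bounded _ _ _ C cc).
by apply: filterS pC => k; rewrite ger0_norm ?energy_ge0.
Qed.

Lemma energy_vanishes_FT (h s : nat -> R) B (v : nat -> Rn -> R[i]) : 0 < Ra -> 0 < B ->
  (forall k, 0 < h k) -> (forall k, `|s k| = (h k)^-1) -> (forall k, L2box B (v k)) ->
  vanishes (fun k => sqnorm (v k)) ->
  energy_vanishes h (fun k xi => cnorm (FT (s k) (v k) xi)).
Proof.
move=> Ra0 B0 h0 sh vB v0; split; first by move=> k; exact: bounded_measurable_FT (vB k).
apply: vanishes_le (vanishesZ (plancherel_cst n Ra) v0) _; apply: nearW => k.
by rewrite ger0_norm ?energy_ge0//; exact: energy_FT (sh k) (vB k).
Qed.

End energy.

(** * Decay of the energy away from the characteristic variety *)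

Section solution_sequence.
Context {R : realType} {d : nat}.
Local Notation Rd := 'rV[R]_d.
Local Notation leb := (lebesgue_rV d : {measure set Rd -> \bar R}).
Variables (Omega : set Rd) (B Ra : R).
Hypotheses (oO : open Omega) (OB : Omega `<=` box B) (B0 : 0 < B) (Ra0 : 0 < Ra).
Implicit Types (psi phi v : Rd -> R[i]).

Lemma cnorm_tested_le v psi M (delta : R) : L2 Omega v -> Cc_oo Omega psi ->
  (forall x, cnorm (psi x) <= M) -> 0 < delta ->
  cnorm (tested Omega v psi) <=
  delta^-1 * L2norm Omega v ^+ 2 + delta * (M ^+ 2 * (2 * B) ^+ d).
Proof.
move=> v2 pO psiM d0; have [vB <-] := L2box_ext oO OB v2.
have [wB _] := L2box_windowed oO OB v2 pO psiM.
have [mw _ _] := wB; have [mv iv v0] := vB.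
set w := patch _ _ _ in vB mv iv v0 *.
have -> : tested Omega v psi = cintegral leb setT (windowed_FT Omega v psi).
  rewrite /tested cintegral_mkcond; apply: eq_cintegral => x _.
  by rewrite /windowed_FT /patch; case: ifP => _; rewrite ?mulr0// mulrC.
have ib := integrable_box1 d B.
pose g x := delta^-1 / 2 * cnorm (w x) ^+ 2 + delta * M ^+ 2 / 2 * box1 B x.
have ig : leb.-integrable setT (EFin \o g) by apply: integrableDR; exact: integrableZR.
apply: le_trans (cnorm_cintegral_le mw ig _) _.
  move=> x; have [xB|xB] := pselect (box B x); last first.
    rewrite /windowed_FT -/w v0// mulr0 cnorm0 /g addr_ge0//.
      by rewrite mulr_ge0 ?sqr_ge0// divr_ge0// invr_ge0 ltW.
    by rewrite mulr_ge0 ?box1_ge0// divr_ge0// mulr_ge0 ?sqr_ge0// ltW.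
  rewrite /g box1_in// mulr1 /windowed_FT -/w cnormM.
  apply: le_trans (ler_wpM2r (cnorm_ge0 _) (psiM x)) _.
  have := sqr_ge0 (cnorm (w x) - delta * M).
  move: (cnorm (w x)) => t sq.
  have -> : delta^-1 / 2 * t ^+ 2 + delta * M ^+ 2 / 2 =
      M * t + delta^-1 / 2 * (t - delta * M) ^+ 2 by field; rewrite gt_eqF.
  by rewrite lerDl mulr_ge0// divr_ge0// invr_ge0 ltW.
rewrite (RintegralD measurableT (integrableZR _ iv) (integrableZR _ ib)).
rewrite (RintegralZl _ measurableT iv) (RintegralZl _ measurableT ib).
rewrite (Rintegral_box1 _ (ltW B0)) -/(sqnorm w).
rewrite le_eqVlt; apply/orP; left; apply/eqP.
by field; rewrite gt_eqF.
Qed.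

Variables (h : nat -> R) (U F V : nat -> 'I_d -> Rd -> R[i]).
Hypotheses (h0 : forall k, 0 < h k) (hto0 : vanishes h).
Hypotheses (U2 : forall k j, L2 Omega (U k j)) (F2 : forall k j, L2 Omega (F k j))
  (V2 : forall k j, L2 Omega (V k j)).
Hypotheses (lU : forall k j, L1loc Omega (U k j)) (lV : forall k j, L1loc Omega (V k j)).
Hypothesis helmholtz : forall k j psi, Cc_oo Omega psi ->
  tested Omega (F k j) psi = - (h k ^+ 2)%:C * tested Omega (U k j) (laplacian psi)
    - tested Omega (U k j) psi + tested Omega (V k j) psi.
Hypothesis curlV : forall k i j psi, Cc_oo Omega psi ->
  tested Omega (V k i) (cderive (ebasis j) psi) = tested Omega (V k j) (cderive (ebasis i) psi).
Hypothesis divV : forall k psi, Cc_oo Omega psi ->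
  \sum_j tested Omega (V k j) (cderive (ebasis j) psi) = 0.
Hypothesis bU : exists C, \forall k \near \oo, forall j, L2norm Omega (U k j) ^+ 2 <= C.
Hypothesis bV : exists C, \forall k \near \oo, forall j, L2norm Omega (V k j) ^+ 2 <= C.
Hypothesis F0 : forall j, vanishes (fun k => L2norm Omega (F k j) ^+ 2).
Hypothesis U0 : forall j psi, Cc_oo Omega psi ->
  vanishes (fun k => cnorm (tested Omega (U k j) psi)).

Lemma tested_vanishes (v : nat -> Rd -> R[i]) psi : (forall k, L2 Omega (v k)) ->
  vanishes (fun k => L2norm Omega (v k) ^+ 2) -> Cc_oo Omega psi ->
  vanishes (fun k => cnorm (tested Omega (v k) psi)).
Proof.
move=> v2 v0 pO; have [M M0 psiM] := Cc_oo_bounded pO.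
apply: (@vanishes_weighted _ _ (fun delta k => delta^-1 * L2norm Omega (v k) ^+ 2)
  (M ^+ 2 * (2 * B) ^+ d)).
  by move=> delta delta0; exact: vanishesZ.
move=> delta delta0; apply: nearW => k; rewrite ger0_norm ?cnorm_ge0//.
exact: cnorm_tested_le.
Qed.

(** The equation expresses [V] through [F], which is small, and through [U]
    tested against fixed functions, which tends to 0. *)
Lemma pressure_weakly_vanishes j psi : Cc_oo Omega psi ->
  vanishes (fun k => cnorm (tested Omega (V k j) psi)).
Proof.
move=> pO; have lO := Cc_oo_laplacian pO.
have F1 := tested_vanishes (F2 ^~ j) (F0 j) pO.
have U1 := U0 j pO; have U3 := U0 j lO.
have h2 : vanishes (fun k => h k * (h k * cnorm (tested Omega (U k j) (laplacian psi)))).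
  apply: (@vanishesM_bounded _ _ _ 1 hto0).
  by apply: (vanishesM_bounded hto0 (C := 1)) ltr01; exact: U3.
apply: vanishes_le (vanishesD F1 (vanishesD h2 U1)) _; apply: nearW => k.
rewrite ger0_norm ?cnorm_ge0//.
have -> : tested Omega (V k j) psi = tested Omega (F k j) psi +
    ((h k ^+ 2)%:C * tested Omega (U k j) (laplacian psi) + tested Omega (U k j) psi).
  rewrite (helmholtz k j pO); move: (tested _ _ _) (tested _ _ _) (tested _ _ _) => a b c.
  by ring.
apply: le_trans (cnormD _ _) _; rewrite lerD2l; apply: le_trans (cnormD _ _) _.
by rewrite lerD2r cnormM cnorm_real ger0_norm ?sqr_ge0// expr2 mulrA.
Qed.

(** With this parameter, [FT] integrates against the wave
    [cis (- dotR z xi / h k)]. *)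
Definition sfreq k : R := - (h k)^-1.

Let sh k : `|sfreq k| = (h k)^-1.
Proof. by rewrite /sfreq normrN gtr0_norm// invr_gt0. Qed.

Let windowedFE (v : nat -> Rd -> R[i]) psi :
  (fun k xi => cnorm (windowed Omega (v k) psi (sfreq k) xi)) =
  (fun k xi => cnorm (FT (sfreq k) (windowed_FT Omega (v k) psi) xi)).
Proof. by apply/funext => k; apply/funext => xi; rewrite windowedE. Qed.

Lemma energy_vanishes_windowed (v : nat -> Rd -> R[i]) psi : Cc_oo Omega psi ->
  (forall k, L2 Omega (v k)) -> vanishes (fun k => L2norm Omega (v k) ^+ 2) ->
  energy_vanishes Ra h (fun k xi => cnorm (windowed Omega (v k) psi (sfreq k) xi)).
Proof.
move=> pO v2 v0; have [M M0 psiM] := Cc_oo_bounded pO.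
rewrite windowedFE; apply: energy_vanishes_FT B0 h0 sh _ _ => //.
  by move=> k; have [] := L2box_windowed oO OB (v2 k) pO psiM.
apply: vanishes_le (vanishesZ (M ^+ 2) v0) _; apply: nearW => k.
by rewrite ger0_norm ?sqnorm_ge0//; have [] := L2box_windowed oO OB (v2 k) pO psiM.
Qed.

Lemma energy_bounded_windowed (v : nat -> Rd -> R[i]) psi : Cc_oo Omega psi ->
  (forall k, L2 Omega (v k)) ->
  (exists C, \forall k \near \oo, L2norm Omega (v k) ^+ 2 <= C) ->
  energy_bounded Ra h (fun k xi => cnorm (windowed Omega (v k) psi (sfreq k) xi)).
Proof.
move=> pO v2 [C vC]; have [M M0 psiM] := Cc_oo_bounded pO.
rewrite windowedFE; apply: energy_bounded_FT B0 h0 sh _ _ => //.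
  by move=> k; have [] := L2box_windowed oO OB (v2 k) pO psiM.
exists (M ^+ 2 * C); apply: filterS vC => k vk.
have [_ H] := L2box_windowed oO OB (v2 k) pO psiM; apply: le_trans H _.
by apply: ler_wpM2l => //; exact: sqr_ge0.
Qed.

Let bU1 j : exists C, \forall k \near \oo, L2norm Omega (U k j) ^+ 2 <= C.
Proof. by have [C UC] := bU; exists C; apply: filterS UC. Qed.

Let bV1 j : exists C, \forall k \near \oo, L2norm Omega (V k j) ^+ 2 <= C.
Proof. by have [C VC] := bV; exists C; apply: filterS VC. Qed.

Lemma pressure_low_frequency j phi (L : R) : Cc_oo Omega phi -> 0 < L ->
  energy_vanishes Ra h (fun k xi =>
    box1 (L * h k) xi * cnorm (windowed Omega (V k j) phi (sfreq k) xi)).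
Proof.
move=> pO L0; have [M M0 psiM] := Cc_oo_bounded pO.
have VB k := (L2box_windowed oO OB (V2 k j) pO psiM).1.
have E : (fun k xi => box1 (L * h k) xi * cnorm (windowed Omega (V k j) phi (sfreq k) xi)) =
    (fun k xi => box1 (L * h k) xi * cnorm (FT (sfreq k) (windowed_FT Omega (V k j) phi) xi)).
  by apply/funext => k; apply/funext => xi; rewrite windowedE.
rewrite E; split.
  move=> k; apply: bounded_measurableM; first exact: bounded_measurable_box1.
  exact: bounded_measurable_FT (VB k).
have [C VC] := bV1 j.
have vC : \forall k \near \oo, sqnorm (windowed_FT Omega (V k j) phi) <= M ^+ 2 * C.
  apply: filterS VC => k vk; apply: le_trans (L2box_windowed oO OB (V2 k j) pO psiM).2 _.
  by apply: ler_wpM2l => //; exact: sqr_ge0.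
have V1 eta : vanishes (fun k => cnorm (FT 1 (windowed_FT Omega (V k j) phi) eta)).
  have := pressure_weakly_vanishes j (Cc_oo_wave 1 eta pO).
  have -> // : (fun k => cnorm (tested Omega (V k j) (fun x => wave 1 eta x * phi x))) =
    (fun k => cnorm (FT 1 (windowed_FT Omega (V k j) phi) eta)).
  by apply/funext => k; rewrite -windowedE.
move=> e e0; pose K := (2 * L) ^+ d; have K0 : 0 < K + 1.
  by rewrite ltr_wpDl// exprn_ge0// mulr_ge0// ltW.
(* The bound at these frequencies will be e' ^ 2 * K. *)
pose e' := Num.sqrt (e / (K + 1)).
have e'0 : 0 < e' by rewrite sqrtr_gt0 divr_gt0.
have := FT_vanishes_uniformly L (ltW B0) VB vC V1 e'0.
apply: filterS => k Hk; rewrite ger0_norm ?energy_ge0//.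
apply: le_trans (energy_low_frequency Ra (h0 k) (ltW L0) (ltW e'0) (sh k) (VB k) Hk) _.
rewrite /e' sqr_sqrtr; last by rewrite divr_ge0// ltW.
rewrite -/K -mulrA ger_pMr// mulrC ler_pdivrMr// mul1r.
by rewrite lerDl.
Qed.

(** The pressure term is only bounded in L^2. Its frequencies beyond [L * h k]
    carry an energy of size [1 / L ^ 2] by [high_frequency_bound]; the others
    vanish in the limit by [pressure_low_frequency]. With [delta = 1 / L ^ 2],
    [vanishes_weighted] concludes. *)
Lemma pressure_energy_vanishes j phi : Cc_oo Omega phi ->
  energy_vanishes Ra h (fun k xi => cnorm (windowed Omega (V k j) phi (sfreq k) xi)).
Proof.
move=> pO.
pose D l := cderive (ebasis l) phi.
have DO l : Cc_oo Omega (D l) by exact: Cc_oo_derive.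
pose T k xi := \sum_l commutator_terms Omega (V k) phi j l (sfreq k) xi.
have bT : energy_bounded Ra h T.
  apply: energy_bounded_sum => // l; apply: energy_boundedD => //.
    exact: energy_bounded_windowed (DO l) (V2 ^~ l) (bV1 l).
  apply: energy_boundedD => //.
    exact: energy_bounded_windowed (DO j) (V2 ^~ l) (bV1 l).
  exact: energy_bounded_windowed (DO l) (V2 ^~ j) (bV1 j).
have [bmV _] := energy_bounded_windowed pO (V2 ^~ j) (bV1 j).
split=> //; have [bmT [C TC]] := bT.
pose L (delta : R) := (Num.sqrt delta)^-1.
pose low delta k xi := box1 (L delta * h k) xi * cnorm (windowed Omega (V k j) phi (sfreq k) xi).
apply: (@vanishes_weighted _ _ (fun delta k => 2 * energy Ra (h k) (low delta k)) (2 * C)).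
  move=> delta delta0; apply: vanishesZ; apply: (pressure_low_frequency _ _ _).2 => //.
  by rewrite invr_gt0 sqrtr_gt0.
move=> delta delta0; have L0 : 0 < L delta by rewrite invr_gt0 sqrtr_gt0.
have [bml _] := pressure_low_frequency j pO L0.
apply: filterS TC => k Tk; rewrite ger0_norm ?energy_ge0//.
have bmLT : bounded_measurable (fun xi => (L delta)^-1 * T k xi).
  by apply: bounded_measurableM (bmT k); exact: bounded_measurable_cst.
apply: (@le_trans _ _ (energy Ra (h k) (fun xi => low delta k xi + (L delta)^-1 * T k xi))).
  apply: (le_energy (h0 k) (bmV k) (bounded_measurableD (bml k) bmLT)) => xi _.
  rewrite ger0_norm ?cnorm_ge0// /low.
  have T0 : 0 <= (L delta)^-1 * T k xi.
    apply: mulr_ge0; first by rewrite invr_ge0 ltW.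
    by apply: sumr_ge0 => l _; rewrite !addr_ge0 ?cnorm_ge0.
  have [xL|xL] := pselect (box (L delta * h k) xi).
    by rewrite box1_in// mul1r lerDl.
  rewrite box1_out// mul0r add0r ler_pdivlMl//.
  have s0 : sfreq k != 0 by rewrite -normr_gt0 sh invr_gt0.
  have xL' : ~ box (L delta / `|sfreq k|) xi by rewrite sh invrK.
  exact: (high_frequency_bound oO (lV k) (@curlV k) (@divV k) j pO s0 L0 xL').
apply: le_trans (energyD _ (h0 k) (bml k) bmLT) _.
rewrite mulrDr lerD2l energyZ// /L invrK sqr_sqrtr ?(ltW delta0)// mulrCA.
by apply: (ler_wpM2l (ltW delta0)); apply: ler_wpM2l.
Qed.

Section elliptic_region.
Variables (c : R) (chi : Rd -> R).
Hypotheses (c0 : 0 < c) (mchi : measurable_fun setT chi)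
  (chiR : forall xi, 0 <= chi xi <= box1 Ra xi)
  (chic : forall xi, chi xi != 0 -> c <= `|dotR xi xi - 1|).

Lemma box1_neq0 (xi : Rd) : chi xi != 0 -> box Ra xi.
Proof.
move=> x0; apply: contrapT => /box1_out E; move: x0.
by have := chiR xi; rewrite E => /le_anti <-; rewrite eqxx.
Qed.

(** Where [c <= `|dotR xi xi - 1|], dividing [helmholtz_identity] bounds the
    transform of [U] by [P]: the transforms of [F] and of the pressure, and
    commutator terms with a factor [h k]. All have vanishing energy. *)
Theorem elliptic_energy_vanishes j phi : Cc_oo Omega phi ->
  vanishes (fun k => h k ^- d *
    \int[leb]_xi (chi xi * cnorm (windowed Omega (U k j) phi (sfreq k) xi) ^+ 2)).
Proof.
move=> pO.
pose D i := cderive (ebasis i) phi; pose D2 i := cderive (ebasis i) (D i).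
have DO l : Cc_oo Omega (D l) by exact: Cc_oo_derive.
have D2O l : Cc_oo Omega (D2 l) by exact: Cc_oo_derive.
pose w (v : nat -> 'I_d -> Rd -> R[i]) psi k xi := cnorm (windowed Omega (v k j) psi (sfreq k) xi).
pose P k xi := w F phi k xi + w V phi k xi +
  \sum_i (2 * Ra * h k * w U (D i) k xi + h k ^+ 2 * w U (D2 i) k xi).
have hh := vanishes_sqr hto0.
have P0 : energy_vanishes Ra h P.
  apply: energy_vanishesD => //.
    apply: energy_vanishesD => //.
      exact: energy_vanishes_windowed pO (F2 ^~ j) (F0 j).
    exact: pressure_energy_vanishes.
  apply: energy_vanishes_sum => // i; apply: energy_vanishesD => //.
    apply: (energy_vanishesZ h0 (vanishesZ (2 * Ra) hto0)).
    exact: energy_bounded_windowed (DO i) (U2 ^~ j) (bU1 j).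
  apply: (energy_vanishesZ h0 hh).
  exact: energy_bounded_windowed (D2O i) (U2 ^~ j) (bU1 j).
have [bP vP] := P0.
have [bw _] := energy_bounded_windowed pO (U2 ^~ j) (bU1 j).
apply: vanishes_le (vanishesZ (c ^- 2) vP) _; apply: nearW => k.
have hn : 0 <= h k ^- d by rewrite invr_ge0 exprn_ge0 ?ltW.
have chi0 xi : 0 <= chi xi by have /andP[] := chiR xi.
rewrite ger0_norm; last first.
  apply: mulr_ge0 => //; apply: Rintegral_ge0 => xi _.
  by rewrite mulr_ge0 ?sqr_ge0.
rewrite /energy mulrCA; apply: ler_wpM2l => //.
have iP := integrable_energy Ra (bP k).
have iw := integrable_energy Ra (bw k).
rewrite -(RintegralZl _ measurableT iP); apply: le_Rintegral => //.
- apply: (integrable_dominated measurableT _ iw).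
    apply: measurable_funM => //; apply: measurable_funX; exact: (bw k).1.
  move=> xi _; rewrite ger0_norm; last exact: mulr_ge0 (chi0 xi) (sqr_ge0 _).
  by apply: (ler_wpM2r (sqr_ge0 _)); have /andP[] := chiR xi.
- exact: integrableZR.
move=> xi _; have [->|x0] := eqVneq (chi xi) 0.
  have cc : 0 <= c ^- 2 by rewrite invr_ge0 sqr_ge0.
  by rewrite mul0r; exact: mulr_ge0 cc (mulr_ge0 (box1_ge0 _ _) (sqr_ge0 _)).
have xR := box1_neq0 x0; have cx := chic x0.
rewrite [leRHS]mulrCA; apply: ler_pM => //; first exact: sqr_ge0.
  by have /andP[] := chiR xi.
rewrite ler_pdivlMl ?exprn_gt0// -exprMn.
have key : c * cnorm (windowed Omega (U k j) phi (sfreq k) xi) <= P k xi.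
  apply: (@le_trans _ _ (cnorm ((dotR xi xi - 1)%:C * windowed Omega (U k j) phi (sfreq k) xi))).
    by rewrite cnormM cnorm_real; exact: (ler_wpM2r (cnorm_ge0 _) cx).
  have hs : h k ^+ 2 * sfreq k ^+ 2 = 1.
    by rewrite /sfreq sqrrN exprVn divff// expf_neq0// gt_eqF.
  rewrite (helmholtz_identity oO xi pO (lU k j) hs (helmholtz k j)).
  apply: le_trans (cnormD _ _) _; apply: lerD.
    by apply: le_trans (cnormD _ _) _; rewrite cnormN.
  rewrite mulr_sumr; apply: le_trans (cnorm_sum _ _ _) _; apply: ler_sum => i _.
  rewrite mulrDr; apply: le_trans (cnormD _ _) _.
  have h2 : cnorm (h k ^+ 2)%:C = h k ^+ 2 by rewrite cnorm_real ger0_norm ?sqr_ge0.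
  apply: lerD; last by rewrite cnormM h2.
  rewrite mulrA cnormM; apply: (ler_wpM2r (cnorm_ge0 _)).
  have two : cnorm (2 : R[i]) = 2.
    by rewrite -[2]/(1 + 1) -(rmorph1 (@real_complex R)) -rmorphD cnorm_real ger0_norm.
  rewrite !cnormM h2 two cnormE /= expr0n add0r sqrtr_sqr normrM sh.
  have -> : h k ^+ 2 * (2 * ((h k)^-1 * `|xi ord0 i|)) = 2 * `|xi ord0 i| * h k.
    by field; rewrite gt_eqF.
  by apply: ler_wpM2r; [exact: ltW|apply: ler_wpM2l => //; exact: xR].
rewrite ler_sqr ?nnegrE ?mulr_ge0 ?cnorm_ge0 ?(ltW c0)//.
by apply: le_trans key; rewrite mulr_ge0 ?cnorm_ge0// ltW.
Qed.

End elliptic_region.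

End solution_sequence.

(** * From the Fourier side to the quantized symbol *)

Section complex_limits.
Context {R : realType}.
Implicit Types (z : nat -> R[i]).

Lemma cvg0_vanishes z :
  (z k : R[i]^o) @[k --> \oo] --> (0 : R[i]^o) <-> vanishes (fun k => cnorm (z k)).
Proof.
have N (x : R[i]^o) : `|x| = (cnorm x)%:C by [].
split.
  move=> z0 e e0.
  have e0' : 0 < (e%:C : R[i]) by rewrite ltcR.
  move/cvgr0Pnorm_le : z0 => /(_ _ e0'); apply: filterS => k.
  by rewrite N lecR ger0_norm ?cnorm_ge0.
move=> z0; apply/cvgr0Pnorm_le => e e0.
have [er e1] : complex.Im e = 0 /\ 0 < complex.Re e.
  by move: e0; rewrite ltcE /= => /andP[/eqP -> ->].
have -> : e = (complex.Re e)%:C by case: e er {e0 e1} => a b /= ->.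
have := z0 _ e1; apply: filterS => k.
by rewrite ger0_norm ?cnorm_ge0// => zk; rewrite N lecR.
Qed.

End complex_limits.

Section assembly.
Context {R : realType} {d : nat}.
Local Notation Rd := 'rV[R]_d.
Local Notation leb := (lebesgue_rV d : {measure set Rd -> \bar R}).
Variables (Omega : set Rd) (a : Rd * Rd -> R[i]).
Hypotheses (oO : open Omega) (a_Cc : Cc_oo (Omega `*` setT) a)
  (a_Car : forall z, Car Omega z -> \forall w \near z, a w = 0).

(** [dotR xi xi - 1] does not vanish on the support of [a], which is compact and
    lies over [Omega]. *)
Lemma supp_elliptic : exists2 c : R, 0 < c &
  forall x xi, supp a (x, xi) -> c <= `|dotR xi xi - 1|.
Proof.
have [_ cK KO] := a_Cc.
pose g (z : Rd * Rd) := `|dotR z.2 z.2 - 1|.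
have cg : continuous g.
  have cd : continuous (fun z : Rd * Rd => dotR z.2 z.2 - 1).
    apply: ctsB; last exact: ctsC.
    apply: cts_sum => i; apply: ctsM => z.
      apply: (@cvg_comp _ _ _ snd (fun y : Rd => y ord0 i)); first exact: cvg_snd.
      exact: coord_continuous.
    apply: (@cvg_comp _ _ _ snd (fun y : Rd => y ord0 i)); first exact: cvg_snd.
    exact: coord_continuous.
  move=> z; apply: (@continuous_comp _ _ _ (fun z : Rd * Rd => dotR z.2 z.2 - 1)
    (fun t : R => `|t|)); first exact: cd.
  exact: norm_continuous.
have g0 z : supp a z -> 0 < g z.
  move=> az; rewrite lt_neqAle normr_ge0 andbT; apply/negP => /eqP gz.
  have Cz : Car Omega z.
    split; first by apply: subset_closure; have [] := KO z az.
    by apply/eqP; rewrite -subr_eq0 -normr_eq0 -/(g z) -gz.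
  by have [w [aw /= /eqP]] := az _ (a_Car Cz); rewrite (negbTE aw).
(* The compact support is covered by the increasing sets of points where g
   is at least 1/(k+1). *)
have /compact_near_coveringP := cK.
move=> /(_ nat \oo (fun k z => k.+1%:R^-1 <= g z) _) H.
have [|N _ HN] := H _.
  move=> z az; have gz := g0 z az; have g2 : 0 < g z / 2 by rewrite divr_gt0.
  have /cvgrPdist_lt/(_ _ g2) nz := cg z.
  have /cvgrPdist_lt/(_ _ g2) nk := @cvg_harmonic R.
  exists ([set z' | `|g z - g z'| < g z / 2], [set k | `|0 - (harmonic k : R)| < g z / 2]) => //.
  move=> [z' k] /= [h1 h2]; move: h2; rewrite sub0r normrN /harmonic ger0_norm ?invr_ge0// => h2.
  by apply: ltW; apply: lt_trans h2 _; move: h1; rewrite ltr_norml; lra.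
exists N.+1%:R^-1; first by rewrite invr_gt0.
by move=> x xi ax; exact: (HN N (leqnn N) (x, xi) ax).
Qed.

(** Splitting the phase [(x - z) . xi] shows that the quantized symbol acts on
    the Fourier transform of the localized function. *)
Lemma Op_h_pairing (h : R) phi (u : Rd -> 'rV[R[i]]_d) (B : R) :
  Omega `<=` box B -> 0 < B -> 0 < h -> (forall j, L2 Omega (cmpt u j)) -> Cc_oo Omega phi ->
  L2dot Omega (Op_h h a phi u) u =
  \sum_j cintegral leb setT (fun x =>
    cintegral leb setT (fun xi => cis (h^-1 * dotR x xi) * a (x, xi) *
      (((2 * pi * h) ^- d)%:C * windowed Omega (cmpt u j) phi (- h^-1) xi)) *
    (patch (fun=> 0) Omega (cmpt u j) x)^*).
Proof.
move=> OB B0 h0 u2 pO; apply: eq_bigr => j _.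
have [M M0 phiM] := Cc_oo_bounded pO.
have [wB _] := L2box_windowed oO OB (u2 j) pO phiM.
rewrite cintegral_mkcond; apply: eq_cintegral => x _.
rewrite /patch; case: ifPn => xO; last first.
  by rewrite rmorph0 mulr0.
congr (_ * _); rewrite mxE.
have [sa ca _] := a_Cc.
have [Ma Ma0 aM] := symbol_bounded sa ca.
have [Ba Ba0 aB] := supp_in_box ca.
pose w := windowed_FT Omega (cmpt u j) phi.
pose G xi := cis (h^-1 * dotR x xi) * a (x, xi) * FT (- h^-1) w xi.
have mG : cmeasurable setT G.
  apply: cmeasurableM; last by have [mw _ _] := wB; exact: cmeasurable_FT.
  apply: cmeasurableM.
    apply: cmeasurable_cis; apply: measurable_funM; first exact: measurable_cst.
    by apply: measurable_dotR; [exact: measurable_cst|exact: measurable_id].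
  have ma : cmeasurable setT a.
    split; apply: continuous_measurable_rV2.
      exact: (smooth_continuous sa.1).
    exact: (smooth_continuous sa.2).
  exact: (cmeasurable_comp ma (measurable_pair1 x)).
have iG : cintegrable leb setT G.
  apply: (cintegrable_dominated measurableT mG
    (integrableZR (Ma * (2 * \int[leb]_x cnorm (w x))) (integrable_box1 d Ba))).
  move=> xi _; rewrite /G !cnormM cnorm_cis mul1r.
  have [xB|xB] := pselect (box Ba xi).
    rewrite box1_in// mulr1; apply: ler_pM (cnorm_ge0 _) (cnorm_ge0 _) (aM _) _.
    exact: FT_bounded wB.
  rewrite (@notin_supp _ _ a (x, xi)); last by move=> /aB[].
  by rewrite cnorm0 mul0r box1_out// mulr0.
have -> : cintegral leb setT (fun xi => cis (h^-1 * dotR x xi) * a (x, xi) *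
    (((2 * pi * h) ^- d)%:C * windowed Omega (cmpt u j) phi (- h^-1) xi)) =
    ((2 * pi * h) ^- d)%:C * cintegral leb setT G.
  rewrite -(cintegralZ _ measurableT iG); apply: eq_cintegral => xi _.
  by rewrite windowedE mulrCA.
congr (_ * _); apply: eq_cintegral => xi _.
rewrite /G /FT -(cintegralZ _ measurableT (FT_integrable _ _ wB)).
apply: eq_cintegral => z _.
have -> : cis (dotR (x - z) xi / h) = cis (h^-1 * dotR x xi) * cis (- h^-1 * dotR z xi).
  by rewrite -cisD dotRD dotRN; congr cis; ring.
have wE : w z = phi z * u z ord0 j.
  apply/esym; rewrite /w /windowed_FT /patch; case: ifPn => // zO.
  rewrite (@notin_supp _ _ phi z) ?mul0r// => pz.
  by have [_ _ /(_ z pz) zO'] := pO; move: zO; rewrite mem_set.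
rewrite -/w wE; move: (cis _) (cis _) (a _) (phi z) (u z ord0 j) => c1 c2 az pz uz.
by ring.
Qed.


Lemma L2box_conj B (v : Rd -> R[i]) : L2box B v -> L2box B (fun x => (v x)^*) /\
  sqnorm (fun x => (v x)^*) = sqnorm v.
Proof.
move=> [mv iv v0]; have E : (fun x => cnorm ((v x)^*) ^+ 2) = (fun x => cnorm (v x) ^+ 2).
  by apply/funext => x; rewrite cnormJ.
split; last by rewrite /sqnorm E.
by split; [exact: cmeasurableJ|rewrite E|move=> x /v0 ->; rewrite rmorph0].
Qed.

(** In [pairing_bound], the weight [delta * h k ^- d] balances the powers of
    [h k]: up to constants, the pairing is at most the energy of the transform over
    the elliptic frequencies divided by [delta], plus [delta] times the squared
    norm of [u k]. *)
Theorem Op_h_vanishes phi (u : nat -> Rd -> 'rV[R[i]]_d) (h : nat -> R) (B : R) :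
  Omega `<=` box B -> 0 < B -> (forall k, 0 < h k) ->
  (forall k j, L2 Omega (cmpt (u k) j)) -> Cc_oo Omega phi ->
  (exists C, \forall k \near \oo, forall j, L2norm Omega (cmpt (u k) j) ^+ 2 <= C) ->
  (forall (c Ra : R) (chi : Rd -> R) j, 0 < c -> 0 < Ra -> measurable_fun setT chi ->
    (forall xi, 0 <= chi xi <= box1 Ra xi) ->
    (forall xi, chi xi != 0 -> c <= `|dotR xi xi - 1|) ->
    vanishes (fun k => h k ^- d * \int[leb]_xi (chi xi *
      cnorm (windowed Omega (cmpt (u k) j) phi (sfreq h k) xi) ^+ 2))) ->
  vanishes (fun k => cnorm (L2dot Omega (Op_h (h k) a phi (u k)) (u k))).
Proof.
move=> OB B0 h0 u2 pO [C uC] ell.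
have [sa ca _] := a_Cc; have [c c0 ac] := supp_elliptic; have [Ra Ra0 aR] := supp_in_box ca.
pose S := [set xi : Rd | c <= `|dotR xi xi - 1|].
have mS : measurable S.
  have md : measurable_fun setT (fun xi : Rd => `|dotR xi xi - 1|).
    apply: measurableT_comp => //; apply: measurable_funB; last exact: measurable_cst.
    by apply: measurable_dotR; exact: measurable_id.
  have := measurable_fun_ler (@measurable_cst _ _ _ _ setT c) md.
  move=> /(_ measurableT [set true]); rewrite setTI; apply.
  by [].
pose chi xi := box1 Ra xi * \1_S xi.
have mchi : measurable_fun setT chi.
  by apply: measurable_funM; [exact: measurable_box1|exact: measurable_indic].
have chiR xi : 0 <= chi xi <= box1 Ra xi.
  rewrite /chi indicE; case: (_ \in _); rewrite ?mulr1 ?mulr0 ?box1_ge0 ?lexx//.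
have chic xi : chi xi != 0 -> c <= `|dotR xi xi - 1|.
  by rewrite /chi indicE; case: (boolP (xi \in S)); rewrite ?inE// mulr0 eqxx.
have chia x xi : supp a (x, xi) -> chi xi = 1.
  move=> axi; have [_ xiR] := aR x xi axi.
  by rewrite /chi box1_in// indicE mem_set ?mulr1//; exact: ac axi.
have [K K0 HK] := pairing_bound sa ca B0 Ra0.
pose t k j := cintegral leb setT (fun x =>
    cintegral leb setT (fun xi => cis ((h k)^-1 * dotR x xi) * a (x, xi) *
      (((2 * pi * h k) ^- d)%:C * windowed Omega (cmpt (u k) j) phi (- (h k)^-1) xi)) *
    (patch (fun=> 0) Omega (cmpt (u k) j) x)^*).
have tE k : L2dot Omega (Op_h (h k) a phi (u k)) (u k) = \sum_j t k j.
  exact: Op_h_pairing OB B0 (h0 k) (u2 k) pO.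
suff t0 j : vanishes (fun k => cnorm (t k j)).
  apply: vanishes_le (vanishes_sum (index_enum 'I_d) t0) _; apply: nearW => k.
  by rewrite ger0_norm ?cnorm_ge0// tE; exact: cnorm_sum.
have E0 := ell c Ra chi j c0 Ra0 mchi chiR chic.
set E := fun k => _ in E0.
apply: (@vanishes_weighted _ _ (fun delta k => K * delta^-1 * ((2 * pi) ^- d) ^+ 2 * E k) (K * C)).
  by move=> delta delta0; exact: vanishesZ.
move=> delta delta0; apply: filterS uC => k uk; rewrite ger0_norm ?cnorm_ge0//.
have [M M0 phiM] := Cc_oo_bounded pO.
have [wB _] := L2box_windowed oO OB (u2 k j) pO phiM.
have [vB vn] := L2box_ext oO OB (u2 k j).
have [vB' vn'] := L2box_conj vB.
pose FF xi := ((2 * pi * h k) ^- d)%:C * windowed Omega (cmpt (u k) j) phi (- (h k)^-1) xi.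
have hk := h0 k.
have ch : 0 <= (2 * pi * h k) ^- d by rewrite invr_ge0 exprn_ge0// !mulr_ge0 ?pi_ge0// ltW.
have FFE xi : FF xi = ((2 * pi * h k) ^- d)%:C *
    FT (- (h k)^-1) (windowed_FT Omega (cmpt (u k) j) phi) xi by rewrite /FF windowedE.
have mFF : cmeasurable setT FF.
  have -> : FF = (fun xi => ((2 * pi * h k) ^- d)%:C *
    FT (- (h k)^-1) (windowed_FT Omega (cmpt (u k) j) phi) xi) by apply/funext.
  apply: cmeasurableM; first exact: cmeasurable_cst.
  by have [mw _ _] := wB; exact: cmeasurable_FT.
pose MF := (2 * pi * h k) ^- d *
  (2 * \int[leb]_x cnorm (windowed_FT Omega (cmpt (u k) j) phi x)).
have FFM xi : cnorm (FF xi) <= MF.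
  rewrite FFE cnormM cnorm_real (ger0_norm ch); apply: ler_wpM2l => //.
  exact: FT_bounded wB.
have s0 : (h k)^-1 != 0 by rewrite invr_eq0 gt_eqF.
have hd : 0 < h k ^- d by rewrite invr_gt0 exprn_gt0.
have D0 : 0 < delta * h k ^- d by rewrite mulr_gt0.
apply: le_trans (HK chi FF _ MF _ _ mchi chiR chia mFF FFM s0 vB' D0) _.
have hN : `|(h k)^-1| ^- d = h k ^+ d.
  by rewrite ger0_norm ?invr_ge0 ?(ltW hk)// exprVn invrK.
rewrite vn' vn hN.
have -> : \int[leb]_xi (chi xi * cnorm (FF xi) ^+ 2) =
    ((2 * pi * h k) ^- d) ^+ 2 * (h k ^+ d * E k).
  rewrite /E (mulrA (h k ^+ d)) divff ?mul1r ?expf_neq0 ?gt_eqF//.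
  rewrite -RintegralZl//.
    by apply: eq_Rintegral => xi _; rewrite /FF cnormM cnorm_real (ger0_norm ch) exprMn mulrCA.
  have [Cu bu] : exists C, forall xi,
      `|cnorm (windowed Omega (cmpt (u k) j) phi (- (h k)^-1) xi) ^+ 2| <= C.
    exists ((2 * \int[leb]_x cnorm (windowed_FT Omega (cmpt (u k) j) phi x)) ^+ 2) => xi.
    rewrite normrX windowedE ger0_norm ?cnorm_ge0// ler_sqr ?nnegrE ?cnorm_ge0//.
      exact: FT_bounded wB.
    by apply: mulr_ge0 => //; apply: Rintegral_ge0 => x _; exact: cnorm_ge0.
  apply: (integrable_dominated measurableT _ (integrableZR Cu (integrable_box1 d Ra))).
    apply: measurable_funM => //; apply: measurable_sqr_cnorm.
    have -> : windowed Omega (cmpt (u k) j) phi (sfreq h k) =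
        FT (- (h k)^-1) (windowed_FT Omega (cmpt (u k) j) phi).
      by apply/funext => xi; rewrite windowedE.
    by have [mw _ _] := wB; exact: cmeasurable_FT.
  move=> xi _; have /andP[cp cq] := chiR xi.
  rewrite normrM (ger0_norm cp) [leLHS]mulrC.
  exact: ler_pM (normr_ge0 _) cp (bu xi) cq.
have hd0 : h k ^+ d != 0 by rewrite expf_neq0// gt_eqF.
have p0 : (2 * pi) ^+ d != 0 :> R by rewrite expf_neq0// gt_eqF// mulr_gt0// pi_gt0.
have dn0 : delta != 0 by rewrite gt_eqF.
rewrite [(2 * pi * _) ^+ d]exprMn.
have := uk j; set N := L2norm _ _ ^+ 2 => NC.
move: (h k ^+ d) ((2 * pi) ^+ d) (E k) hd0 p0 {s0 hd D0 ch FFE mFF MF FFM} => x y e x0 y0.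
have -> : K * ((delta * x^-1)^-1 * (((y * x)^-1) ^+ 2 * (x * e)) + delta * x^-1 * (x * N)) =
    K * delta^-1 * (y^-1) ^+ 2 * e + delta * (K * N).
  by field; rewrite x0 y0 dn0.
by rewrite lerD2l; apply: ler_wpM2l; [exact: ltW|apply: ler_wpM2l => //; exact: ltW].
Qed.

End assembly.

(** * The sequence of solutions *)

Section sequence_hypotheses.
Context {R : realType} {d : nat}.
Local Notation Rd := 'rV[R]_d.
Local Notation leb := (lebesgue_rV d : {measure set Rd -> \bar R}).
Variable Omega : set Rd.
Hypothesis oO : open Omega.

Lemma L2Z (c : R[i]) (v : Rd -> R[i]) : L2 Omega v -> L2 Omega (fun x => c * v x).
Proof.
have mO := open_measurable_rV oO; move=> [mv iv].
have mcv := cmeasurableM (cmeasurable_cst _ c) mv.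
split=> //.
have E : (fun x => (cnorm (c * v x) ^+ 2)%:E) =
    (fun x => ((cnorm c ^+ 2)%:E * (cnorm (v x) ^+ 2)%:E)%E).
  by apply/funext => x; rewrite cnormM exprMn EFinM.
rewrite E ge0_integralZl_EFin//.
- by apply: lte_mul_pinfty => //; rewrite lee_fin sqr_ge0.
- by move=> x _; rewrite lee_fin sqr_ge0.
- by apply/measurable_EFinP; exact: measurable_sqr_cnorm.
- exact: sqr_ge0.
Qed.

Lemma L2_conj (v : Rd -> R[i]) : L2 Omega v -> L2 Omega (fun x => (v x)^*).
Proof.
move=> [mv iv]; split; first exact: cmeasurableJ.
by under eq_integral do rewrite cnormJ.
Qed.

Lemma L2_0 : L2 Omega (fun=> 0 : R[i]).
Proof.
split; first exact: cmeasurable_cst.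
by under eq_integral do rewrite cnorm0 expr0n/=; rewrite integral0.
Qed.

Lemma Cc_oo_L2 psi : Cc_oo Omega psi -> bounded_set Omega -> L2 Omega psi.
Proof.
have mO := open_measurable_rV oO; move=> pO /ex_strict_bound_gt0[B B0 OB].
have [M M0 psiM] := Cc_oo_bounded pO; have [sp _ _] := pO.
have OB' x : Omega x -> box B x.
  by move=> /OB xB j; apply: le_trans (rV_coord_le x j) (ltW xB).
have mpsi : cmeasurable Omega psi.
  by apply: cmeasurable_sub => //; exact: csmooth_measurable.
split=> //.
have ib := integrableZR (M ^+ 2) (integrable_box1 d B).
have : leb.-integrable Omega (EFin \o (fun x => cnorm (psi x) ^+ 2)).
  have ibO : leb.-integrable Omega (EFin \o (fun x => M ^+ 2 * box1 B x)).
    by apply: (integrableS measurableT mO _ ib).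
  apply: (integrable_dominated mO _ ibO); first exact: measurable_sqr_cnorm.
  move=> x /OB' xB; rewrite box1_in// mulr1 ger0_norm ?sqr_ge0//.
  by rewrite ler_sqr ?nnegrE ?cnorm_ge0// ltW.
move=> /integrableP[_]; apply: le_lt_trans; apply: ge0_le_integral => //.
- by move=> x _; rewrite lee_fin sqr_ge0.
- by apply/measurable_EFinP; exact: measurable_sqr_cnorm.
- apply: measurableT_comp => //; apply/measurable_EFinP; exact: measurable_sqr_cnorm.
- by move=> x _; rewrite /= ger0_norm ?sqr_ge0.
Qed.

Lemma L2norm_le_L2normv (w : Rd -> 'rV[R[i]]_d) j :
  L2norm Omega (cmpt w j) ^+ 2 <= L2normv Omega w ^+ 2.
Proof.
rewrite [leRHS]sqr_sqrtr; last by apply: sumr_ge0 => i _; exact: sqr_ge0.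
by rewrite (bigD1 j)//= lerDl sumr_ge0// => i _; exact: sqr_ge0.
Qed.

Lemma L2norm_bounded (w : nat -> Rd -> 'rV[R[i]]_d) :
  (fun k => L2normv Omega (w k)) =O_\oo (fun=> 1 : R) ->
  exists C, \forall k \near \oo, forall j, L2norm Omega (cmpt (w k) j) ^+ 2 <= C.
Proof.
move=> /eqO_exP[C C0 wC]; exists (C ^+ 2); apply: filterS wC => k wk j.
apply: le_trans (L2norm_le_L2normv _ _) _.
rewrite ler_sqr ?nnegrE ?sqrtr_ge0//; last exact: ltW.
by apply: le_trans (ler_norm _) _; apply: le_trans wk _; rewrite normr1 mulr1.
Qed.

Lemma L2norm_vanishes (w : nat -> Rd -> 'rV[R[i]]_d) (h : nat -> R) j :
  (fun k => L2normv Omega (w k)) =o_\oo h -> vanishes h ->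
  vanishes (fun k => L2norm Omega (cmpt (w k) j) ^+ 2).
Proof.
move=> /eqoP wo h0; apply: vanishes_le (vanishes_sqr h0) _.
have := wo 1 ltr01; apply: filterS => k; rewrite mul1r => wk.
rewrite ger0_norm ?sqr_ge0//; apply: le_trans (L2norm_le_L2normv _ _) _.
rewrite -(real_normK (num_real (h k))) ler_sqr ?nnegrE ?sqrtr_ge0//.
exact: le_trans (ler_norm _) wk.
Qed.

(** Weak convergence is tested against [conj psi] in one coordinate. *)
Lemma weakly_to0_tested (u : nat -> Rd -> 'rV[R[i]]_d) j psi : bounded_set Omega ->
  weakly_to0 Omega u -> Cc_oo Omega psi ->
  vanishes (fun k => cnorm (tested Omega (cmpt (u k) j) psi)).
Proof.
move=> bO u0 pO; pose v x : 'rV[R[i]]_d := \row_i (if i == j then (psi x)^* else 0).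
have v2 : L2v Omega v.
  move=> i; have [ij|ij] := eqVneq i j.
    have -> : cmpt v i = (fun x => (psi x)^*).
      by apply/funext => x; rewrite /cmpt mxE ij eqxx.
    by apply: L2_conj; exact: Cc_oo_L2.
  have -> : cmpt v i = (fun=> 0).
    by apply/funext => x; rewrite /cmpt mxE (negbTE ij).
  exact: L2_0.
have /cvg0_vanishes := u0 v v2.
have -> // : (fun k => cnorm (L2dot Omega (u k) v)) =
  (fun k => cnorm (tested Omega (cmpt (u k) j) psi)).
apply/funext => k; congr cnorm; rewrite /L2dot (bigD1 j)//= big1 ?addr0.
  by apply: eq_cintegral => x _; rewrite mxE eqxx conjCK.
move=> i ij; rewrite -[RHS](cintegral0 leb Omega).
by apply: eq_cintegral => x _; rewrite mxE (negbTE ij) rmorph0 mulr0.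
Qed.

End sequence_hypotheses.

Theorem proposition2p5 (R : realType) (d : nat) (Omega : set 'rV[R]_d)
  (h : nat -> R) (u f : nat -> 'rV[R]_d -> 'rV[R[i]]_d)
  (q : nat -> 'rV[R]_d -> R[i]) (Dq : nat -> 'rV[R]_d -> 'rV[R[i]]_d)
  (a : 'rV[R]_d * 'rV[R]_d -> R[i]) (phi : 'rV[R]_d -> R[i])
  (Omega_dom : smooth_bounded_domain Omega)
  (h_gt0 : forall k, 0 < h k) (h_to0 : h k @[k --> \oo] --> (0 : R))
  (uH2 : forall k j, Hm 2 Omega (cmpt (u k) j))
  (uV : forall k, spaceV Omega (u k))
  (fH : forall k, spaceH Omega (f k))
  (q_int : forall k, cintegrable (lebesgue_rV d) Omega (q k))
  (DqE : forall k, weak_grad Omega (q k) (Dq k))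
  (Dq_L2 : forall k, L2v Omega (Dq k))
  (u_stokes : forall k, stokes Omega (h k) (u k) (Dq k) (f k))
  (u_bounded : (fun k => L2normv Omega (u k)) =O_\oo (fun=> 1 : R))
  (f_small : (fun k => L2normv Omega (f k)) =o_\oo h)
  (Dq_bounded : (fun k => L2normv Omega (fun x => (h k)%:C *: Dq k x))
     =O_\oo (fun=> 1 : R))
  (q_mean0 : forall k, cintegral (lebesgue_rV d) Omega (q k) = 0)
  (u_weak0 : weakly_to0 Omega u)
  (a_Cc : Cc_oo (Omega `*` setT) a)
  (a_Car : forall z, Car Omega z -> \forall w \near z, a w = 0)
  (phi_Cc : Cc_oo Omega phi)
  (phi1 : forall z, supp a z -> \forall y \near z.1, phi y = 1) :
  exists s : nat -> nat, {homo s : m n / (m < n)%N} /\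
    (L2dot Omega (Op_h (h (s k)) a phi (u (s k))) (u (s k)) : R[i]^o)
      @[k --> \oo] --> (0 : R[i]^o).
Proof.
exists id; split=> //; apply/cvg0_vanishes.
have [oO _ _ bO _] := Omega_dom.
have [B B0 OB0] := ex_strict_bound_gt0 bO.
have OB : Omega `<=` box B.
  by move=> x /OB0 xB j; apply: le_trans (rV_coord_le x j) (ltW xB).
have h0 : vanishes h by apply/vanishesP.
have u2 k j : L2 Omega (cmpt (u k) j) by have [] := uH2 k j.
have f2 k j : L2 Omega (cmpt (f k) j) by have [H _ _] := fH k; exact: H.
have lD k j : L1loc Omega (cmpt (Dq k) j) by have [] := DqE k j.
have du k : weak_div Omega (u k) (fun=> 0) by have [] := uV k.
have df k : weak_div Omega (f k) (fun=> 0) by have [] := fH k.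
have lu k j : L1loc Omega (cmpt (u k) j) by have [H _ _] := du k; exact: H.
have lf k j : L1loc Omega (cmpt (f k) j) by have [H _ _] := df k; exact: H.
pose V k j := cmpt (fun x => (h k)%:C *: Dq k x) j.
have VE k j : V k j = (fun x => (h k)%:C * cmpt (Dq k) j x).
  by apply/funext => x; rewrite /V /cmpt mxE.
have tV k j psi : Cc_oo Omega psi ->
    tested Omega (V k j) psi = (h k)%:C * tested Omega (cmpt (Dq k) j) psi.
  by move=> pO; rewrite VE (testedZl oO _ (lD k j) pO).
have V2 k j : L2 Omega (V k j) by rewrite VE; apply: L2Z oO _ _ _; exact: Dq_L2.
have lV k j : L1loc Omega (V k j).
  move=> K cK KO; rewrite VE; apply: cintegrableZ; last exact: lD.
  exact: compact_measurable_rV.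
have bU := L2norm_bounded u_bounded; have bV := L2norm_bounded Dq_bounded.
have F0 j := L2norm_vanishes j f_small h0.
have U0 j psi := @weakly_to0_tested R d Omega oO u j psi bO u_weak0.
apply: (Op_h_vanishes oO a_Cc a_Car OB B0 h_gt0 u2 phi_Cc bU).
move=> c Ra chi j c0 Ra0 mchi chiR chic.
apply: (elliptic_energy_vanishes oO OB B0 Ra0 h_gt0 h0 u2 f2 V2 lu lV
  _ _ _ bU bV F0 U0 c0 mchi chiR chic j phi_Cc).
- move=> k i psi pO; rewrite tV//.
  exact: (stokes_tested oO (u_stokes k) (lD k i) (lf k i) pO).
- move=> k i l psi pO; rewrite (tV k i _ (Cc_oo_derive (ebasis l) pO)).
  rewrite (tV k l _ (Cc_oo_derive (ebasis i) pO)).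
  by rewrite (curl_free i l (DqE k) pO).
- move=> k psi pO; rewrite -[RHS](pressure_div_free oO (u_stokes k) (lD k) (du k) (df k) pO).
  by rewrite mulr_sumr; apply: eq_bigr => i _; rewrite tV//; exact: Cc_oo_derive.
Qed.
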